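(* Let $\Psi$ be a branching mechanism such that $\mathrm{T}=\mathrm{T}_\infty<\infty$ almost surely under $\mathbb{P}_x$ for every $x\in(0,\infty)$, i.e. the $\Psi$-CSBP explodes in finite time almost surely. Set $$\Phi(\lambda):=\int_{\lambda}^{0}\frac{du}{\Psi(u)},\qquad \lambda\ge 0 .$$ For any $\beta>0$ there exists a unique quasi-stationary distribution $\mu_\beta$ (a probability measure on $(0,\infty)$) with rate of decay $\beta$. This probability measure is infinitely divisible and is characterised by $$\int_{(0,\infty)}\mu_\beta(dr)\,e^{-r\lambda}=e^{-\beta\Phi(\lambda)}\qquad\text{for all }\lambda\ge 0 .$$ Additionally, the following dichotomy holds, where $\Psi(+\infty):=\lim_{u\to\infty}\Psi(u)\in[-\infty,0)$: (i) If $\Psi(+\infty)\in(-\infty,0)$, then for every $x\in(0,\infty)$, $$\lim_{t\to\infty}\mathbb{P}_x(\mathrm{Z}_t\in\cdot\,|\,\mathrm{T}>t)=\mu_{x\nu(0,\infty)}(\cdot)$$ in the sense of weak convergence of probability measures. (ii) If $\Psi(+\infty)=-\infty$, then for all $a,x\in(0,\infty)$, $$\lim_{t\to\infty}\mathbb{P}_x(\mathrm{Z}_t\le a\,|\,\mathrm{T}>t)=0 .$$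
   Context: A branching mechanism is a function $$\Psi(u)=\gamma u+\frac{\sigma^2}{2}u^2+\int_{(0,\infty)}(e^{-uh}-1+uh\mathbf{1}_{\{h<1\}})\,\nu(dh),\qquad u\ge0,$$ with $\gamma\in\mathbb{R}$, $\sigma\ge0$ and $\nu$ a Borel measure on $(0,\infty)$ with $\int_{(0,\infty)}(1\wedge h^2)\,\nu(dh)<\infty$. For $\lambda>0$ let $t\mapsto u(t,\lambda)$ be the unique solution of $\partial_t u(t,\lambda)=-\Psi(u(t,\lambda))$, $u(0,\lambda)=\lambda$. The $\Psi$-CSBP (continuous-state branching process) started from $x\in[0,\infty]$ is the $[0,\infty]$-valued càdlàg Markov process $\mathrm{Z}=(\mathrm{Z}_t)_{t\ge0}$ whose law $\mathbb{P}_x$ has semigroup characterised by $\mathbb{E}_x[e^{-\lambda \mathrm{Z}_t}]=e^{-x\,u(t,\lambda)}$ for all $t\ge0$, $\lambda>0$ (with $e^{-\infty}=0$); $0$ and $\infty$ are absorbing. For a probability measure $\mu$ on $(0,\infty)$, $\mathbb{P}_\mu:=\int\mu(dx)\mathbb{P}_x$. Set $\mathrm{T}_0:=\inf\{t\ge0:\mathrm{Z}_t=0\}$, $\mathrm{T}_\infty:=\inf\{t\ge0:\mathrm{Z}_t=\infty\}$ and $\mathrm{T}:=\mathrm{T}_0\wedge\mathrm{T}_\infty$. A quasi-stationary distribution is a probability measure $\mu$ on $(0,\infty)$ such that $\mathbb{P}_\mu(\mathrm{Z}_t\in\cdot\,|\,\mathrm{T}>t)=\mu(\cdot)$ for all $t\ge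 0$. Under $\mathbb{P}_\mu$ the variable $\mathrm{T}$ is then exponentially distributed, and its parameter is called the rate of decay of $\mu$. Almost sure explosion in finite time is equivalent to: $\int_{0+}\frac{du}{-\Psi(u)}<\infty$ and $\sup\{u\ge0:\Psi(u)\le0\}=\infty$. In that case $\Psi$ is convex, decreasing and non-positive, $\sigma=0$, $\int_{(0,1)}h\,\nu(dh)<\infty$, and $\Psi(u)=Du+\int_{(0,\infty)}(e^{-uh}-1)\,\nu(dh)$ with $D:=\gamma+\int_{(0,1)}h\,\nu(dh)$; moreover $\Psi(+\infty)\in(-\infty,0)$ if and only if $D=0$ and $\nu(0,\infty)<\infty$, in which case $\Psi(+\infty)=-\nu(0,\infty)$. *)

(* Defs.v *)
From HB Require Import structures.
From mathcomp Require Import all_boot all_order all_algebra.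
From mathcomp Require Import all_classical all_reals all_analysis.
From mathcomp Require Import measurable_realfun giry.

Set Implicit Arguments.
Unset Strict Implicit.
Unset Printing Implicit Defensive.

Import Order.TTheory GRing.Theory Num.Theory.
Import numFieldNormedType.Exports.

Local Open Scope classical_set_scope.
Local Open Scope ring_scope.

(* Borel measures on (0, oo) are encoded as measures on R that do not charge
   the complement of (0, oo). *)
Record branching_triple (R : realType) := BranchingTriple {
  bt_drift : R;
  bt_sigma : R;
  bt_nu : {measure set (measurableTypeR R) -> \bar R};
  bt_sigma_ge0 : 0 <= bt_sigma;
  bt_nu_pos : bt_nu `]-oo, 0]%classic = 0%E;
  bt_nu_int :
    (\int[bt_nu]_(h in `]0%R, +oo[) (Num.min 1 (h ^+ 2))%:E < +oo)%E
}.

Section CSBP.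
Context {R : realType}.

Definition branching_mechanism (b : branching_triple R) (u : R) : R :=
  bt_drift b * u + bt_sigma b ^+ 2 / 2 * u ^+ 2 +
  \int[bt_nu b]_(h in `]0, +oo[)
    (expR (- (u * h)) - 1 + u * h * (h < 1)%R%:R).

(* [Psi] only has a meaning on [0, oo), so solutions are required to be
   nonnegative.  Since [Psi] is continuous on [0, oo), continuity of
   [t |-> u t lambda] at 0 turns the equation on (0, oo) into the equation on
   [0, oo) with a right derivative at 0. *)
Definition cumulant_flow (Psi : R -> R) (u : R -> R -> R) : Prop :=
  forall lambda : R, 0 < lambda ->
  [/\ u 0 lambda = lambda,
      (forall t : R, 0 <= t -> 0 <= u t lambda),
      {within `[0, +oo[, continuous (u ^~ lambda)} &
      (forall t : R, 0 < t ->
         is_derive t 1 (u ^~ lambda) (- Psi (u t lambda)))].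

Definition Phi (Psi : R -> R) (lambda : R) : R :=
  - \int[@lebesgue_measure R]_(u in `[0, lambda]) (Psi u)^-1.

Section process.
Context {d : measure_display} {Omega : measurableType d}.
Implicit Types (P : R.-pker (\bar R) ~> Omega) (Z : R -> Omega -> \bar R).
Local Open Scope ereal_scope.

(* Time is the half-line [0, oo) of R; values of [Z] at negative times are
   never used. *)
Definition past Z (s : R) : set (set Omega) :=
  <<s [set A | exists r : R, exists B : set (\bar R),
         [/\ (0 <= r <= s)%R, measurable B & A = Z r @^-1` B]] >>.

(* [P x] is the law started from [x]; only [x] in [0, oo] matters.  That 0 and
   oo are traps is imposed on every path, as on the canonical path space; it
   makes the event {T > t} measurable. *)
Record is_csbp (u : R -> R -> R) P Z : Prop := IsCSBP {
  csbp_ge0 : forall (t : R) w, (0 <= t)%R -> 0 <= Z t w;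
  csbp_measurable : forall t : R, (0 <= t)%R -> measurable_fun setT (Z t);
  csbp_right_continuous : forall (t : R) w, (0 <= t)%R ->
    Z s w @[s --> t^'+] --> Z t w;
  csbp_left_limits : forall (t : R) w, (0 < t)%R -> cvg (Z s w @[s --> t^'-]);
  csbp_absorbing0 : forall (s t : R) w, (0 <= s <= t)%R ->
    Z s w = 0 -> Z t w = 0;
  csbp_absorbingoo : forall (s t : R) w, (0 <= s <= t)%R ->
    Z s w = +oo -> Z t w = +oo;
  csbp_start : forall x, 0 <= x -> P x (Z 0%R @^-1` [set x]) = 1;
  csbp_markov : forall x (s t : R) (A : set Omega) (B : set (\bar R)),
    0 <= x -> (0 <= s)%R -> (0 <= t)%R -> past Z s A -> measurable B ->
    P x (A `&` Z (s + t)%R @^-1` B) =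
    \int[P x]_(w in A) P (Z s w) (Z t @^-1` B);
  csbp_laplace : forall x (t lambda : R), 0 <= x -> (0 <= t)%R -> (0 < lambda)%R ->
    \int[P x]_w expeR (- (lambda%:E * Z t w)) =
    expeR (- (x * (u t lambda)%:E))
}.

Definition hit_time Z (a : \bar R) (w : Omega) : \bar R :=
  ereal_inf [set t%:E | t in [set t : R | (0 <= t)%R /\ Z t w = a]].

Definition T0 Z := hit_time Z 0.
Definition Too Z := hit_time Z +oo.
Definition lifetime Z (w : Omega) : \bar R := mine (T0 Z w) (Too Z w).

Definition alive Z (t : R) : set Omega := [set w | t%:E < lifetime Z w].

Definition explodes_as P Z : Prop :=
  forall x : R, (0 < x)%R ->
  {ae P x%:E, forall w, lifetime Z w = Too Z w /\ Too Z w < +oo}.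

Definition initial_law P (mu : set (measurableTypeR R) -> \bar R) : set Omega -> \bar R :=
  fun A => \int[mu]_(x in `]0%R, +oo[) P x%:E A.

Definition cond_prob (Q : set Omega -> \bar R) (A C : set Omega) : \bar R :=
  Q (A `&` C) / Q C.

Definition cond_law (Q : set Omega -> \bar R) Z (t : R) : set (measurableTypeR R) -> \bar R :=
  fun B => cond_prob Q (Z t @^-1` (EFin @` B)) (alive Z t).

Definition on_pos (mu : set (measurableTypeR R) -> \bar R) : Prop := mu `]0%R, +oo[%classic = 1.

Definition is_qsd P Z (mu : probability (measurableTypeR R) R) : Prop :=
  on_pos mu /\
  forall t : R, (0 <= t)%R ->
    0 < initial_law P mu (alive Z t) /\
    forall B : set (measurableTypeR R), measurable B ->
      cond_law (initial_law P mu) Z t B = mu B.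

Definition has_decay_rate P Z (mu : set (measurableTypeR R) -> \bar R) (beta : R) : Prop :=
  forall B : set (measurableTypeR R), measurable B ->
    initial_law P mu (lifetime Z @^-1` (EFin @` B)) = exponential_prob beta B.

End process.

Local Open Scope ereal_scope.

Definition convolution (m1 m2 : set (measurableTypeR R) -> \bar R) :
    set (measurableTypeR R) -> \bar R :=
  pushforward (m1 \x m2) (fun z => (z.1 + z.2)%R : measurableTypeR R).

Definition convolution_power (m : set (measurableTypeR R) -> \bar R)
    (n : nat) : set (measurableTypeR R) -> \bar R :=
  iter n (convolution m) (\d_(0%R : measurableTypeR R)).

(* Measures are total functions on all subsets, with unspecified values on
   non-measurable sets, hence equality is tested on measurable sets only. *)
Definition infinitely_divisible (mu : probability (measurableTypeR R) R) :=
  forall n : nat, (0 < n)%N ->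
  exists nu : probability (measurableTypeR R) R,
    forall B : set (measurableTypeR R), measurable B ->
      mu B = convolution_power nu n B.

Definition laplace (mu : set (measurableTypeR R) -> \bar R) (lambda : R) :=
  \int[mu]_(r in `]0%R, +oo[) (expR (- (r * lambda)))%:E.

Definition weak_cvg_pos (m : R -> set (measurableTypeR R) -> \bar R)
    (mu : set (measurableTypeR R) -> \bar R) : Prop :=
  forall f : R -> R, {within `]0%R, +oo[, continuous f} ->
    (exists M : R, forall y : R, (0 < y)%R -> (`|f y| <= M)%R) ->
    \int[m t]_(y in `]0%R, +oo[) (f y)%:E @[t --> +oo%R]
      --> \int[mu]_(y in `]0%R, +oo[) (f y)%:E.

End CSBP.

(* Main.v *)
(* The event {T > t} is {Z_t in (0, oo)}, and letting lambda -> 0 in the Laplace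
   transform of Z_t gives P_x(T > t) = exp (- x phi t) with phi t = u(t, 0+).
   Explosion forces phi t -> oo, hence Psi < 0 on (0, oo); then Phi is the inverse
   of phi and u(t, lambda) = phi (t + Phi lambda).  So, for a law mu on (0, oo)
   with Laplace transform f, P_mu(T > t) = f (phi t) and the law of Z_t on {T > t}
   has Laplace transform f (phi (t + Phi lambda)).  Rate of decay beta reads
   f (phi t) = exp (- beta t), that is f = exp (- beta Phi), and this f clearly
   gives a quasi-stationary law.  That exp (- beta Phi) is a Laplace transform
   follows by approximating beta Phi by exponents of compound Poisson laws built
   from the conditional laws P_x(Z_t in . | T > t), whose Laplace transforms are
   exp (- x (phi (t + Phi lambda) - phi t)).  Finally phi' = - Psi (phi), so
   phi (t + Phi lambda) - phi t tends to - Psi(+oo) Phi lambda as t -> oo, and the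
   dichotomy follows from the continuity theorem for Laplace transforms, together
   with nu(0, oo) = - Psi(+oo) when Psi(+oo) is finite, or from Markov's inequality
   when Psi(+oo) = - oo. *)
Require Import Defs.
From HB Require Import structures.
From mathcomp Require Import all_boot all_order all_algebra.
From mathcomp Require Import all_classical all_reals all_analysis.
From mathcomp Require Import measurable_realfun giry.
From mathcomp Require Import ring lra.
Import Order.TTheory GRing.Theory Num.Theory.
Import numFieldNormedType.Exports.
Local Open Scope classical_set_scope.
Local Open Scope ring_scope.
Set Implicit Arguments.
Unset Strict Implicit.

(** * Weierstrass approximation *)

(** Existence is the hard point. The target [exp (- beta Phi)] is only a limit of explicit Laplace
    transforms, so the limiting law has to be produced, and mass might escape to infinity or collect
    at 0. The former is excluded because [Phi] tends to 0 at [0+], the latter because [Phi] takes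
    every value, [Phi (phi M) = M]. Laws on [[0, oo)] form the intermediate class, since compound
    Poisson laws charge 0; the open half-line is recovered afterwards. That [Phi] is finite is
    itself extracted from explosion: if [v <= phi t], the flow started at a small [l] passes from
    [l] beyond [v] within time [t], so the integral of [- 1 / Psi] over [[l, v]] is at most [t],
    uniformly in [l]. Uniqueness and weak convergence rest on the substitution [w = exp (- y)]:
    Laplace transforms at integers become moments on [[0, 1]], where polynomials are dense. A test
    function on [(0, oo)] need not extend to the two endpoints, hence a cutoff and a tightness
    argument. *)

Fixpoint bernstein {R : realType} (n : nat) (h : nat -> R) : {poly R} :=
  if n is m.+1 then 'X * bernstein m (h \o succn) + (1 - 'X) * bernstein m h
  else (h 0)%:P.

Section bernstein_polynomials.
Context {R : realType}.
Implicit Types (h k : nat -> R) (x a : R).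

(** Conditioning on the first of [n.+1] Bernoulli trials of parameter [x]: [(bernstein n h).[x]] is
    the mean of [h] at a binomial variable, and [h \o succn] is what remains after a first success.
    The facts below are inductions along this recursion, without binomial coefficients. *)
Lemma horner_bernsteinS n h x :
  (bernstein n.+1 h).[x] =
  x * (bernstein n (h \o succn)).[x] + (1 - x) * (bernstein n h).[x].
Proof. by rewrite /= !hornerE. Qed.

Lemma bernsteinD n h k x :
  (bernstein n (fun i => h i + k i)).[x] =
  (bernstein n h).[x] + (bernstein n k).[x].
Proof.
elim: n h k => [|n IH] h k; first by rewrite /= !hornerE.
by rewrite !horner_bernsteinS (IH (h \o succn) (k \o succn)) IH; ring.
Qed.

Lemma bernsteinZ n a h x :
  (bernstein n (fun i => a * h i)).[x] = a * (bernstein n h).[x].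
Proof.
elim: n h => [|n IH] h; first by rewrite /= !hornerE.
by rewrite !horner_bernsteinS (IH (h \o succn)) IH; ring.
Qed.

Lemma bernstein_cst n a x : (bernstein n (fun=> a)).[x] = a.
Proof.
elim: n => [|n IH]; first by rewrite /= !hornerE.
by rewrite horner_bernsteinS (_ : _ \o _ = (fun=> a))// IH; ring.
Qed.

(** Binomial variance plus squared bias. The centre [a] is arbitrary because the shift by [succn]
    turns it into [a - 1] in the induction; only [a = n x] is used later. *)
Lemma bernstein_variance n a x :
  (bernstein n (fun i => (i%:R - a) ^+ 2)).[x] =
  n%:R * x * (1 - x) + (n%:R * x - a) ^+ 2.
Proof.
elim: n a => [|n IH] a; first by rewrite /= !hornerE; ring.
rewrite horner_bernsteinS IH.
rewrite (_ : _ \o _ = (fun i => (i%:R - (a - 1)) ^+ 2)); last first.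
  by apply/funext => i /=; rewrite -natr1; ring.
by rewrite IH -natr1; ring.
Qed.

Lemma le_bernstein n h k x : 0 <= x <= 1 ->
  (forall i, (i <= n)%N -> h i <= k i) ->
  (bernstein n h).[x] <= (bernstein n k).[x].
Proof.
move=> /andP[x0 x1]; elim: n h k => [|n IH] h k hk.
  by rewrite /= !hornerE; exact: hk.
rewrite !horner_bernsteinS lerD// ler_wpM2l ?subr_ge0// IH// => i lei.
  by rewrite /= hk.
by rewrite hk// (leq_trans lei).
Qed.

End bernstein_polynomials.

Lemma uniform_continuity_segment {R : realType} (g : R -> R) (a b e : R) :
  continuous g -> 0 < e ->
  exists2 r, 0 < r & forall x y, a <= x <= b -> `|x - y| < r -> `|g x - g y| < e.
Proof.
move=> cg e0.
have /compact_near_coveringP cK := @segment_compact R a b.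
have near_r := cK R (0^'+)
  (fun r x => forall y, `|x - y| < r -> `|g x - g y| < e) _ _.
have {}near_r : \forall r \near 0^'+, `[a, b]%classic `<=`
    (fun x : R => forall y, `|x - y| < r -> `|g x - g y| < e).
  apply: near_r => x _.
  have /cvgrPdist_lt/(_ (e / 2)) := cg x.
  rewrite divr_gt0// => /(_ isT)/nbhs_ballP[d /= d0 xd].
  exists (ball x (d / 2), [set r | r < d / 2]) => /=.
    split; first by apply: nbhsx_ballx; rewrite divr_gt0.
    by apply: nbhs_right_lt; rewrite divr_gt0.
  move=> [x' r] /= [xx' rd] y x'y.
  have xd1 : `|g x - g x'| < e / 2.
    by apply: xd; apply: lt_trans xx' _; lra.
  have xd2 : `|g x - g y| < e / 2.
    apply: xd; rewrite /ball/=.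
    have := ler_distD x' x y; move: xx'; rewrite /ball/= => xx'; lra.
  have := ler_distD (g x) (g x') (g y); rewrite (distrC (g x') (g x)); lra.
have : \forall r \near 0^'+, 0 < r /\ (forall x : R, a <= x <= b -> forall y, `|x - y| < r -> `|g x - g y| < e).
  near=> r; split => // x xab.
  by apply: (near near_r r) => //=; rewrite in_itv.
move=> /filter_ex[r [r0 rP]]; exists r => // x y xab; exact: rP.
Unshelve. all: by end_near. Qed.

(** Bernstein's proof through Chebyshev: uniform continuity handles the indices with [i / n] close
    to [x], and the variance bounds the weight of the others. *)
Lemma weierstrass_approximation {R : realType} (g : R -> R) (e : R) :
  continuous g -> 0 < e ->
  exists p : {poly R}, forall x, 0 <= x <= 1 -> `|g x - p.[x]| <= e.
Proof.
move=> cg e0.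
have e20 : 0 < e / 2 by rewrite divr_gt0.
have [r r0 rP] := uniform_continuity_segment 0 1 cg e20.
have [M M0 gM] : exists2 M, 0 < M & forall x, 0 <= x <= 1 -> `|g x| <= M.
  have : bounded_set (g @` `[0, 1]).
    apply: compact_bounded; apply: continuous_compact.
      exact: continuous_subspaceT.
    exact: segment_compact.
  move=> /ex_strict_bound_gt0[M M0 MP]; exists M => // x x01.
  by apply/ltW/MP => /=; exists x => //=; rewrite in_itv.
(* Chosen so that [M / (r ^+ 2 * n) <= e / 2]; this bounds the variance term below, as
   [2 * (x * (1 - x)) <= 1]. *)
pose n := (Num.trunc (M / (r ^+ 2 * (e / 2)))).+1.
exists (bernstein n (fun i => g (i%:R / n%:R))) => x x01.
have n0 : 0 < n%:R :> R by rewrite ltr0n.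
have key i : (i <= n)%N ->
    `|g x - g (i%:R / n%:R)| <=
    e / 2 + 2 * M / (r ^+ 2 * n%:R ^+ 2) * (i%:R - n%:R * x) ^+ 2.
  move=> lein.
  have [xr|rx] := ltP `|x - i%:R / n%:R| r.
    apply: (le_trans (ltW (rP _ _ x01 xr))); rewrite lerDl.
    by rewrite mulr_ge0 ?sqr_ge0// divr_ge0// ?mulr_ge0 ?sqr_ge0// ltW.
  have i01 : 0 <= (i%:R / n%:R : R) <= 1.
    by rewrite divr_ge0//= ler_pdivrMr// mul1r ler_nat.
  apply: (@le_trans _ _ (2 * M)).
    have := ler_normB (g x) (g (i%:R / n%:R)).
    have := gM _ x01; have := gM _ i01; lra.
  have -> : (i%:R - n%:R * x) ^+ 2 = n%:R ^+ 2 * `|x - i%:R / n%:R| ^+ 2.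
    by rewrite real_normK ?num_real//; field; rewrite gt_eqF.
  have -> : 2 * M / (r ^+ 2 * n%:R ^+ 2) * (n%:R ^+ 2 * `|x - i%:R / n%:R| ^+ 2)
     = 2 * M * (`|x - i%:R / n%:R| / r) ^+ 2.
    by field; rewrite !gt_eqF.
  have : 1 <= (`|x - i%:R / n%:R| / r) ^+ 2.
    by rewrite exprn_ege1// ler_pdivlMr// mul1r.
  nra.
have bound : (bernstein n (fun i =>
     e / 2 + 2 * M / (r ^+ 2 * n%:R ^+ 2) * (i%:R - n%:R * x) ^+ 2)).[x] <= e.
  rewrite bernsteinD bernstein_cst bernsteinZ bernstein_variance subrr.
  rewrite expr0n/= addr0.
  have -> : 2 * M / (r ^+ 2 * n%:R ^+ 2) * (n%:R * x * (1 - x)) =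
      2 * (x * (1 - x)) * (M / (r ^+ 2) / n%:R) by field; rewrite !gt_eqF.
  have : M / r ^+ 2 / n%:R <= e / 2.
    rewrite ler_pdivrMr// -ler_pdivrMl//.
    rewrite (_ : (e / 2)^-1 * (M / r ^+ 2) = M / (r ^+ 2 * (e / 2))); last first.
      by field; rewrite !gt_eqF.
    by apply/ltW/truncnS_gt.
  have : 0 <= M / r ^+ 2 / n%:R by rewrite !divr_ge0// ltW// ?exprn_gt0.
  have : x * (1 - x) <= 2^-1 by have := sqr_ge0 (x - 2^-1); rewrite sqrrB; lra.
  have : 0 <= x * (1 - x) by move: x01 => /andP[? ?]; rewrite mulr_ge0// subr_ge0.
  move: (x * (1 - x)) (M / r ^+ 2 / n%:R) => p q; nra.
rewrite ler_norml; apply/andP; split.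
  rewrite lerBrDr addrC lerBlDr.
  apply: le_trans (lerD (lexx (g x)) bound).
  rewrite -(bernstein_cst n (g x) x) -bernsteinD le_bernstein// => i /key.
  by rewrite ler_norml => /andP[]; lra.
rewrite lerBlDr; apply: (@le_trans _ _ ((bernstein n (fun i => g x)).[x])).
  by rewrite bernstein_cst.
rewrite addrC; apply: le_trans (lerD (lexx _) bound).
rewrite -bernsteinD le_bernstein// => i /key.
by rewrite ler_norml => /andP[]; lra.
Qed.

(** * Laplace transforms of laws on the half-line *)

Section bounded_integrands.
Context {d} {T : measurableType d} {R : realType}.
Variables (m : probability T R) (D : set T).
Hypothesis mD : measurable D.
Implicit Types (h : T -> R) (M : R).

Lemma integrable_bounded h M : measurable_fun D h ->
  (forall x, D x -> `|h x| <= M) -> m.-integrable D (EFin \o h).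
Proof.
move=> mh hM; apply: measurable_bounded_integrable => //.
  by rewrite (le_lt_trans (probability_le1 m mD))// ltry.
exists M; split; rewrite ?num_real// => x Mx y Dy /=.
by rewrite (le_trans (hM _ Dy))// ltW.
Qed.

Lemma normr_Rintegral_le h M : 0 <= M -> measurable_fun D h ->
  (forall x, D x -> `|h x| <= M) -> `|\int[m]_(x in D) h x| <= M.
Proof.
move=> M0 mh hM.
apply: le_trans (le_normr_Rintegral mD (integrable_bounded mh hM)) _.
apply: (@le_trans _ _ (\int[m]_(x in D) M)).
  apply: le_Rintegral => //.
  - apply: (@integrable_bounded _ M); first exact: measurableT_comp.
    by move=> x Dx; rewrite normr_id hM.
  - by apply: (@integrable_bounded _ M) => // x _; rewrite ger0_norm.
rewrite Rintegral_cst// ler_piMr// -lee_fin fineK ?probability_le1//.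
exact: fin_num_measure.
Qed.

Lemma bounded_cvg_Rintegral (h_ : nat -> T -> R) h M :
  (forall n, measurable_fun D (h_ n)) ->
  (forall n x, D x -> `|h_ n x| <= M) ->
  (forall x, D x -> h_ n x @[n --> \oo] --> h x) ->
  \int[m]_(x in D) h_ n x @[n --> \oo] --> \int[m]_(x in D) h x.
Proof.
move=> mh hM hh.
have mh' : measurable_fun D h by exact: measurable_fun_cvg mh hh.
have hM' x : D x -> `|h x| <= M.
  move=> Dx; have /cvg_norm/cvgP := hh x Dx.
  move=> c; have <- := cvg_lim _ (cvg_norm (hh x Dx)) => //.
  by apply: limr_le => //; apply: nearW => n; exact: hM.
apply: fine_cvg; rewrite fineK; last first.
  by apply: integrable_fin_num => //; exact: integrable_bounded hM'.
apply: (@dominated_cvg _ _ _ m D mD (fun n x => (h_ n x)%:E) (EFin \o h) (cst M%:E)).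
- by move=> n; exact/measurable_EFinP.
- by move=> x Dx; apply: cvg_EFin; [exact: nearW|exact: hh].
- by [].
- apply: (@integrable_bounded (cst M) `|M|) => //.
- by move=> n x Dx; rewrite lee_fin hM.
Qed.

End bounded_integrands.

Lemma Rintegral_sum d (T : measurableType d) (R : realType)
    (m : {measure set T -> \bar R}) (D : set T) (n : nat) (f : nat -> T -> R) :
  measurable D -> (forall i, m.-integrable D (EFin \o f i)) ->
  \int[m]_(x in D) (\sum_(i < n) f i x) = \sum_(i < n) \int[m]_(x in D) f i x.
Proof.
move=> mD intf; elim: n => [|n IH].
  by under eq_Rintegral do rewrite big_ord0; rewrite big_ord0 Rintegral_cst// mul0r.
under eq_Rintegral do rewrite big_ord_recr/=.
rewrite RintegralD//; first by rewrite IH big_ord_recr.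
apply: (eq_integrable mD (fun x => \sum_(i < n) (f i x)%:E)%E).
  by move=> x _ /=; rewrite sumEFin.
by apply: integrable_sum => // i _; exact: intf.
Qed.

(** Open right rays are stable under intersection, generate the Borel sets and exhaust the line.
    They are the sets on which both the ramp limits and the tails of the lifetime are computed
    below. *)
Lemma probability_eq_ray {R : realType} (m1 m2 : {measure set (measurableTypeR R) -> \bar R}) :
  (m1 setT < +oo)%E ->
  (forall a : R, m1 `]a, +oo[%classic = m2 `]a, +oo[%classic) ->
  forall A, measurable A -> m1 A = m2 A.
Proof.
move=> fin1 m12.
apply: (@measure_unique _ R (measurableTypeR R) [set A | exists x : R, A = `]x, +oo[%classic]
   (fun n => `](- n%:R : R), +oo[%classic)).
- exact: RGenOInfty.measurableE.
- move=> _ _ [x ->] [y ->]; exists (Num.max x y).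
  apply/seteqP; split => z /=; rewrite !in_itv/= !andbT gt_max.
    by move=> [-> ->].
  by move=> /andP[-> ->].
- by move=> n; exists (- n%:R).
- apply/seteqP; split => // x _; exists (Num.trunc `|x|).+1 => //=.
  rewrite in_itv/= andbT ltrNl (le_lt_trans _ (truncnS_gt _))//.
  by rewrite -normrN ler_norm.
- by move=> _ [a ->]; exact: m12.
- by move=> n; apply: le_lt_trans fin1; rewrite le_measure ?inE.
Qed.

Lemma probability_setC_eq0 d (T : measurableType d) (R : realType)
    (m : probability T R) (D : set T) :
  measurable D -> m D = 1%E -> m (~` D) = 0%E.
Proof. by move=> mD mD1; rewrite probability_setC// mD1 subee. Qed.

Lemma measureI_eq1 d (T : measurableType d) (R : realType)
    (m : probability T R) (A D : set T) :
  measurable A -> measurable D -> m D = 1%E -> m (A `&` D) = m A.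
Proof.
move=> mA mD mD1.
have mDC := probability_setC_eq0 mD mD1.
have mADC : m (A `&` ~` D) = 0%E.
  apply: (subset_measure0 _ _ _ mDC) => //; last exact: measurableC.
  exact: measurableI (measurableC mD).
have -> : m A = (m (A `&` D) + m (A `&` ~` D))%E.
  rewrite -measureU//; first by rewrite -setIUr setUv setIT.
  - exact: measurableI.
  - exact: measurableI (measurableC mD).
  - by rewrite setIACA setICr setI0.
by rewrite mADC adde0.
Qed.

Section laplace_transform.
Context {R : realType}.
Local Notation T := (measurableTypeR R).
Local Notation D := (`]0%R, +oo[%classic : set T).
Implicit Types m mu : probability T R.

Let mD : measurable D. Proof. exact: measurable_itv. Qed.

Lemma measurable_expNM (B : set T) (l : R) : measurable_fun B (fun y : T => expR (- (y * l))).
Proof.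
apply: measurable_funTS; apply: continuous_measurable_fun => x.
apply: continuous_comp; last exact: continuous_expR.
by apply: continuousN; apply: cvgMr_tmp; exact: cvg_id.
Qed.

Lemma horner_expRN (p : {poly R}) (y : R) :
  p.[expR (- y)] = \sum_(i < size p) p`_i * expR (- (y * i%:R)).
Proof.
rewrite horner_coef; apply: eq_bigr => i _; congr (_ * _).
by rewrite -expRM_natl; congr expR; ring.
Qed.

Lemma expRN_in01 (y : R) : 0 <= y -> 0 <= expR (- y) <= 1.
Proof. by move=> y0; rewrite expR_ge0/= -expR0 ler_expR oppr_le0. Qed.

Lemma integrable_expNM m (l : R) : 0 <= l ->
  m.-integrable D (EFin \o (fun y => expR (- (y * l)))).
Proof.
move=> l0; apply: (@integrable_bounded _ _ _ _ _ _ _ 1) => //.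
  exact: measurable_expNM.
move=> y /=; rewrite in_itv/= andbT => y0.
rewrite ger0_norm ?expR_ge0//.
by have /andP[] := @expRN_in01 (y * l) (mulr_ge0 (ltW y0) l0).
Qed.

Lemma Rintegral_horner_expRN m (p : {poly R}) :
  \int[m]_(y in D) p.[expR (- y)] =
  \sum_(i < size p) p`_i * \int[m]_(y in D) expR (- (y * i%:R)).
Proof.
transitivity (\int[m]_(y in D) (\sum_(i < size p) p`_i * expR (- (y * i%:R)))).
  by apply: eq_Rintegral => y _; rewrite horner_expRN.
rewrite (@Rintegral_sum _ T _ _ _ _ (fun i y => p`_i * expR (- (y * i%:R))) mD).
  by apply: eq_bigr => i _; rewrite RintegralZl// integrable_expNM.
by move=> i; apply: (integrableZl mD p`_i (integrable_expNM m (ler0n _ i))).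
Qed.

Lemma measurable_comp_expRN (B : set T) (g : R -> R) :
  measurable_fun setT g -> measurable_fun B (fun y : T => g (expR (- y))).
Proof.
move=> mg; apply: measurable_funTS.
apply: (@measurableT_comp _ _ _ _ _ _ g) => //.
by under eq_fun do rewrite -[X in - X]mulr1; exact: measurable_expNM.
Qed.

(** With [w = exp (- y)] the hypothesis is convergence of all moments on [[0, 1]], hence of the
    integrals of polynomials; a uniform approximation of [g] then costs [e / 3] on each side,
    whatever the law. *)
Lemma laplace_cvg_continuous {I : Type} (F : set_system I) {FF : Filter F}
    (m : I -> probability T R) mu :
  (forall n : nat, \int[m i]_(y in D) expR (- (y * n%:R)) @[i --> F] -->
                   \int[mu]_(y in D) expR (- (y * n%:R))) ->
  forall g : R -> R, continuous g ->
  \int[m i]_(y in D) g (expR (- y)) @[i --> F] -->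
  \int[mu]_(y in D) g (expR (- y)).
Proof.
move=> mmu g cg; apply/cvgrPdist_le => e e0.
have e30 : 0 < e / 3 by rewrite divr_gt0.
have [p pg] := weierstrass_approximation cg e30.
have mp : measurable_fun setT (fun x => p.[x]).
  by apply: continuous_measurable_fun; exact: continuous_horner.
have mg := continuous_measurable_fun cg.
have y01 (y : T) : D y -> 0 <= expR (- y) <= 1.
  by rewrite /= in_itv/= andbT => /ltW; exact: expRN_in01.
have pbound : exists M, forall x, 0 <= x <= 1 -> `|p.[x]| <= M.
  exists (\sum_(i < size p) `|p`_i|) => x /andP[x0 x1].
  rewrite horner_coef (le_trans (ler_norm_sum _ _ _))// ler_sum// => i _.
  by rewrite normrM ler_piMr// ger0_norm ?exprn_ge0// exprn_ile1.
have [M pM] := pbound.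
have ip (k : probability T R) : k.-integrable D (EFin \o (fun y : T => p.[expR (- y)])).
  apply: (@integrable_bounded _ _ _ k _ mD _ M).
    exact: (measurable_comp_expRN mp).
  by move=> y /y01; exact: pM.
have ig (k : probability T R) : k.-integrable D (EFin \o (fun y : T => g (expR (- y)))).
  apply: (@integrable_bounded _ _ _ k _ mD _ (M + e / 3)).
    exact: (measurable_comp_expRN mg).
  move=> y /y01 y1; have := pM _ y1; have := pg _ y1.
  by rewrite !ler_norml => /andP[? ?] /andP[? ?]; lra.
have close (k : probability T R) : `|\int[k]_(y in D) g (expR (- y)) - \int[k]_(y in D) p.[expR (- y)]| <= e / 3.
  rewrite -(RintegralB mD (ig k) (ip k)).
  apply: (@normr_Rintegral_le _ _ _ k D mD) => //; first exact: ltW.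
    by apply: measurable_funB; exact: measurable_comp_expRN.
  by move=> y /y01; exact: pg.
have : \int[m i]_(y in D) p.[expR (- y)] @[i --> F] --> \int[mu]_(y in D) p.[expR (- y)].
  rewrite Rintegral_horner_expRN; under eq_cvg do rewrite Rintegral_horner_expRN.
  apply: cvg_big => [|i _]; first exact: add_continuous.
  by apply: cvgMl_tmp; exact: mmu.
move=> /cvgrPdist_le/(_ _ e30); apply: filterS => i.
have := close mu; have := close (m i).
by rewrite !ler_norml => /andP[? ?] /andP[? ?] /andP[? ?]; lra.
Qed.

(** A trapezoid: 0 when [w] is within [1 / k] of an endpoint of [[0, 1]], 1 when it is at distance
    at least [2 / k] from both. In [y = - ln w] it removes neighbourhoods of 0 and of infinity. *)
Definition cutoff (k : nat) (w : R) : R :=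
  Num.min 1 (Num.max 0 (Num.min (k%:R * w - 1) (k%:R * (1 - w) - 1))).

Lemma cutoff_in01 k w : 0 <= cutoff k w <= 1.
Proof. by rewrite /cutoff le_min ge_min lexx ler01 le_max lexx. Qed.

Lemma cutoff_eq0 k w : k%:R * w < 1 \/ k%:R * (1 - w) < 1 -> cutoff k w = 0.
Proof.
move=> h; rewrite /cutoff.
have -> : Num.max 0 (Num.min (k%:R * w - 1) (k%:R * (1 - w) - 1)) = 0.
  by apply/max_idPl; rewrite ge_min; case: h => h; apply/orP; [left|right]; lra.
by apply/min_idPr.
Qed.

Lemma cutoff_continuous k : continuous (cutoff k).
Proof.
move=> w.
suff : {for w, continuous ((fun=> 1 : R^o) \min ((fun=> 0 : R^o) \max
    ((fun w => k%:R * w - 1 : R^o) \min (fun w => k%:R * (1 - w) - 1 : R^o))))} by [].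
apply: continuous_min; first exact: cvg_cst.
apply: continuous_max; first exact: cvg_cst.
apply: continuous_min.
  by apply: cvgB; [apply: cvgMl_tmp; exact: cvg_id|exact: cvg_cst].
apply: cvgB; last exact: cvg_cst.
by apply: cvgMl_tmp; apply: cvgB; [exact: cvg_cst|exact: cvg_id].
Qed.

Lemma cutoff_cvg w : 0 < w < 1 -> cutoff k w @[k --> \oo] --> (1 : R).
Proof.
move=> /andP[w0 w1]; apply: cvg_near_cst; near=> k.
have h1 : 2 <= k%:R * w.
  by rewrite -ler_pdivrMr//; near: k; exact: nbhs_infty_ger.
have h2 : 2 <= k%:R * (1 - w).
  by rewrite -ler_pdivrMr ?subr_gt0//; near: k; exact: nbhs_infty_ger.
rewrite /cutoff; apply/min_idPl; rewrite le_max le_min; apply/orP; right.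
by apply/andP; split; lra.
Unshelve. all: by end_near. Qed.

(** After multiplication by a cutoff, [f (- ln w)] becomes continuous on the whole line. The error
    is at most [M] times the mass that the cutoff misses: small for [mu], which lives on [(0, oo)],
    and then eventually small for [m i], since the cutoff is itself a continuous function of [w].
    This is tightness at both ends. *)
Lemma laplace_weak_cvg {I : Type} (F : set_system I) {FF : Filter F}
    (m : I -> probability T R) mu :
  (forall i, on_pos (m i)) -> on_pos mu ->
  (forall n : nat, \int[m i]_(y in D) expR (- (y * n%:R)) @[i --> F] -->
                   \int[mu]_(y in D) expR (- (y * n%:R))) ->
  forall (f : R -> R) (M : R), {within `]0%R, +oo[, continuous f} ->
  (forall y, 0 < y -> `|f y| <= M) ->
  \int[m i]_(y in D) f y @[i --> F] --> \int[mu]_(y in D) f y.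
Proof.
move=> m1 mu1 mmu f M cf fM; apply/cvgrPdist_le => e e0.
have mf : measurable_fun D (f : T -> R).
  by apply: subspace_continuous_measurable_fun.
have fM' (y : T) : D y -> `|f y| <= M by rewrite /= in_itv/= andbT; exact: fM.
have M0 : 0 <= M by rewrite (le_trans (normr_ge0 _) (fM 1 ltr01)).
have D1 (k : probability T R) : on_pos k -> \int[k]_(y in D) 1 = 1.
  by move=> k1; rewrite Rintegral_cst// mul1r; exact: (congr1 fine k1).
have i1 (p : probability T R) : p.-integrable D (EFin \o (fun=> 1 : R)).
  by apply: (@integrable_bounded _ _ _ p _ mD _ 1) => // y _; rewrite normr1.
have mc k := continuous_measurable_fun (@cutoff_continuous k).
have ic (p : probability T R) k :
    p.-integrable D (EFin \o (fun y : T => cutoff k (expR (- y)))).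
  apply: (@integrable_bounded _ _ _ p _ mD _ 1).
    exact: (measurable_comp_expRN (mc k)).
  by move=> y _; have /andP[? ?] := cutoff_in01 k (expR (- y)); rewrite ger0_norm.
have : \int[mu]_(y in D) cutoff k (expR (- y)) @[k --> \oo] --> (1 : R).
  rewrite -(D1 _ mu1); apply: (@bounded_cvg_Rintegral _ _ _ mu _ mD _ _ 1).
  - by move=> k; exact: (measurable_comp_expRN (mc k)).
  - by move=> k y _; have /andP[? ?] := cutoff_in01 k (expR (- y)); rewrite ger0_norm.
  - move=> y; rewrite /= in_itv/= andbT => y0; apply: cutoff_cvg.
    by rewrite expR_gt0/= -expR0 ltr_expR oppr_lt0.
(* The budget is [e / 4] for [g], [M * e'] for the cutoff error under [mu] and [2 * M * e'] under
   [m i]. The [+ 1] keeps the denominator positive when [M = 0]. *)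
pose e' := e / (4 * (M + 1)).
have M10 : 0 < M + 1 by lra.
have e'0 : 0 < e' by rewrite divr_gt0// mulr_gt0.
have e'E : e' * (M + 1) = e / 4 by rewrite /e'; field; rewrite gt_eqF.
move=> /cvgrPdist_le/(_ _ e'0) [k _ /(_ k (leqnn k))] /=.
rewrite ler_norml => /andP[_ kmu].
(* Near any point where [ln w] is meaningless or [- ln w] leaves [(0, oo)] the cutoff vanishes on a
   neighbourhood, so [g] is continuous at every real [w]. *)
pose g w := f (- ln w) * cutoff k w.
have gc : continuous g.
  move=> w.
  have [w0|w0] := ltP (k%:R * w) 1.
    have : \forall v \near w, g v = 0.
      have : \forall v \near w, k%:R * v < 1.
        have /cvgr_lt : k%:R * v @[v --> w] --> k%:R * w.
          by apply: cvgMl_tmp; exact: cvg_id.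
        exact.
      by apply: filterS => v vk; rewrite /g cutoff_eq0 ?mulr0//; left.
    move=> near0; rewrite /continuous_at (nbhs_singleton near0 : g w = 0).
    exact: cvg_near_cst.
  have [w1|w1] := ltP (k%:R * (1 - w)) 1.
    have : \forall v \near w, g v = 0.
      have : \forall v \near w, k%:R * (1 - v) < 1.
        have /cvgr_lt : k%:R * (1 - v) @[v --> w] --> k%:R * (1 - w).
          by apply: cvgMl_tmp; apply: cvgB; [exact: cvg_cst|exact: cvg_id].
        exact.
      by apply: filterS => v vk; rewrite /g cutoff_eq0 ?mulr0//; right.
    move=> near0; rewrite /continuous_at (nbhs_singleton near0 : g w = 0).
    exact: cvg_near_cst.
  have k0 : 0 < k%:R :> R.
    rewrite lt_neqAle ler0n andbT eq_sym; apply: contraTneq w0 => ->.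
    by rewrite mul0r -ltNge.
  have w_gt0 : 0 < w by rewrite -(pmulr_rgt0 _ k0); lra.
  have w_lt1 : w < 1 by rewrite -subr_gt0 -(pmulr_rgt0 _ k0); lra.
  apply: cvgM; last exact: cutoff_continuous.
  apply: (@continuous_comp _ _ _ (fun v => - ln v) f).
    by apply: continuousN; exact: continuous_ln.
  have : {in `]0%R, +oo[%classic, continuous f}.
    by rewrite -continuous_open_subspace//; exact: interval_open.
  apply; rewrite inE/= in_itv/= andbT oppr_gt0.
  by rewrite ln_lt0// w_gt0.
have gE (y : R) : g (expR (- y)) = f y * cutoff k (expR (- y)).
  by rewrite /g expRK opprK.
have diff (p : probability T R) : on_pos p ->
    `|\int[p]_(y in D) f y - \int[p]_(y in D) g (expR (- y))| <=
    M * (1 - \int[p]_(y in D) cutoff k (expR (- y))).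
  move=> p1.
  have i1c : p.-integrable D (EFin \o (fun y : T => 1 - cutoff k (expR (- y)))).
    apply: (@integrable_bounded _ _ _ p _ mD _ 1).
      by apply: measurable_funB => //; exact: (measurable_comp_expRN (mc k)).
    move=> y _; have /andP[? ?] := cutoff_in01 k (expR (- y)).
    by rewrite ger0_norm; lra.
  have ifp : p.-integrable D (EFin \o (f : T -> R)) by exact: integrable_bounded fM'.
  have igp : p.-integrable D (EFin \o (fun y : T => g (expR (- y)))).
    apply: (@integrable_bounded _ _ _ p _ mD _ M).
      exact: (measurable_comp_expRN (continuous_measurable_fun gc)).
    move=> y Dy; rewrite gE normrM.
    have /andP[? ?] := cutoff_in01 k (expR (- y)).
    by rewrite (ger0_norm (x := cutoff _ _))// -[leRHS]mulr1 ler_pM// fM'.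
  rewrite -[X in M * (X - _)](D1 p p1) -(RintegralB mD (i1 p) (ic p k)).
  rewrite -(RintegralZl _ mD i1c) -(RintegralB mD ifp igp).
  have ifg : p.-integrable D (EFin \o (fun y : T => f y - g (expR (- y)))).
    exact: (integrableB mD ifp igp).
  apply: le_trans (le_normr_Rintegral mD ifg) _.
  apply: le_Rintegral => //.
  - exact: (integrable_norm ifg).
  - exact: (integrableZl mD M i1c).
  move=> y Dy; rewrite gE -[X in X - _]mulr1 -mulrBr normrM.
  have /andP[? ?] := cutoff_in01 k (expR (- y)).
  by rewrite [`|1 - _|]ger0_norm ?subr_ge0// ler_wpM2r ?subr_ge0// fM'.
have cvg_g := @laplace_cvg_continuous _ F FF m mu mmu _ gc.
have cvg_c := @laplace_cvg_continuous _ F FF m mu mmu _ (@cutoff_continuous k).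
have e40 : 0 < e / 4 by lra.
near=> i.
have h1 : `|\int[mu]_(y in D) g (expR (- y)) - \int[m i]_(y in D) g (expR (- y))| <= e / 4.
  by near: i; move/cvgrPdist_le : cvg_g; apply.
have h2 : `|\int[mu]_(y in D) cutoff k (expR (- y)) -
    \int[m i]_(y in D) cutoff k (expR (- y))| <= e'.
  by near: i; move/cvgrPdist_le : cvg_c; apply.
have h3 := diff _ mu1; have h4 := diff _ (m1 i).
move: h1 h2 h3 h4; rewrite !ler_norml => /andP[? ?] /andP[? ?] /andP[? ?] /andP[? ?].
have ? : M * (1 - \int[mu]_(y in D) cutoff k (expR (- y))) <= M * e'.
  by rewrite ler_wpM2l.
have ? : M * (1 - \int[m i]_(y in D) cutoff k (expR (- y))) <= M * (e' + e').
  by rewrite ler_wpM2l//; lra.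
by apply/andP; split; lra.
Unshelve. all: by end_near. Qed.

(** Uniqueness follows from the convergence statement applied to a constant sequence: both laws
    integrate the bounded continuous [ramp a n] alike, and these ramps tend to the indicator of []a,
    +oo[]. *)
Lemma laplace_inj mu1 mu2 : on_pos mu1 -> on_pos mu2 ->
  (forall n : nat, laplace mu1 n%:R = laplace mu2 n%:R) ->
  measure_eq mu1 mu2.
Proof.
move=> mu1D mu2D mu12.
have Rmu12 (n : nat) : \int[mu1]_(y in D) expR (- (y * n%:R)) =
    \int[mu2]_(y in D) expR (- (y * n%:R)) by exact: (congr1 fine (mu12 n)).
pose ramp (a : R) (n : nat) (y : R) : R := Num.min 1 (Num.max 0 (n%:R * (y - a))).
have ramp01 a n y : 0 <= ramp a n y <= 1.
  by rewrite /ramp le_min ge_min lexx ler01 le_max lexx.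
have ramp_cont a n : continuous (ramp a n).
  move=> y.
  suff : {for y, continuous ((fun=> 1 : R^o) \min ((fun=> 0 : R^o) \max
      (fun y => n%:R * (y - a) : R^o)))} by [].
  apply: continuous_min; first exact: cvg_cst.
  apply: continuous_max; first exact: cvg_cst.
  by apply: cvgMl_tmp; apply: cvgB; [exact: cvg_id|exact: cvg_cst].
have ramp_cvg a y : ramp a n y @[n --> \oo] --> (\1_(`]a, +oo[%classic) y : R).
  rewrite indicE; have [ya|ya] := leP y a.
    rewrite memNset; last by rewrite /= in_itv/= andbT; apply/negP; rewrite -leNgt.
    apply: cvg_near_cst; apply: nearW => n; rewrite /ramp max_l ?min_r//.
    by rewrite mulr_ge0_le0// subr_le0.
  rewrite mem_set/=; last by rewrite in_itv/= ya.
  apply: cvg_near_cst; near=> n.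
  rewrite /ramp min_l// le_max; apply/orP; right.
  rewrite -ler_pdivrMr ?subr_gt0//; near: n; exact: nbhs_infty_ger.
have mu12_ramp a n : \int[mu1]_(y in D) ramp a n y = \int[mu2]_(y in D) ramp a n y.
  have : (fun=> \int[mu1]_(y in D) ramp a n y) @ \oo --> \int[mu2]_(y in D) ramp a n y.
    apply: (@laplace_weak_cvg nat \oo _ (fun=> mu1) mu2 (fun=> mu1D) mu2D _ (ramp a n) 1).
    - by move=> k; rewrite Rmu12; exact: cvg_cst.
    - exact: continuous_subspaceT.
    - by move=> y _; have /andP[? ?] := ramp01 a n y; rewrite ger0_norm.
  by move/(cvg_unique _ (@cvg_cst _ _ nat \oo _)); apply.
have lim_ramp (p : probability T R) a : on_pos p ->
    \int[p]_(y in D) ramp a n y @[n --> \oo] --> fine (p `]a, +oo[%classic).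
  move=> pD.
  have -> : fine (p `]a, +oo[%classic) = \int[p]_(y in D) \1_(`]a, +oo[%classic) y.
    rewrite /Rintegral (integral_indic _ mD)//; congr fine; apply/esym.
    exact: (@measureI_eq1 _ _ _ p _ D).
  apply: (@bounded_cvg_Rintegral _ _ _ p _ mD _ _ 1).
  - move=> n; apply: measurable_funTS; apply: continuous_measurable_fun.
    exact: ramp_cont.
  - by move=> n y _; have /andP[? ?] := ramp01 a n y; rewrite ger0_norm.
  - by move=> y _; exact: ramp_cvg.
apply: probability_eq_ray; first by apply: le_lt_trans (ltry 1); exact: probability_le1.
move=> a; suff: fine (mu1 `]a, +oo[%classic) = fine (mu2 `]a, +oo[%classic).
  move=> h.
  have fin (p : probability T R) : p `]a, +oo[%classic \is a fin_num.
    exact: fin_num_measure.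
  exact: etrans (esym (fineK (fin mu1))) (etrans (congr1 EFin h) (fineK (fin mu2))).
have h1 := lim_ramp _ a mu1D.
have h2 : \int[mu1]_(y in D) ramp a n y @[n --> \oo] --> fine (mu2 `]a, +oo[%classic).
  by under eq_cvg do rewrite mu12_ramp; exact: lim_ramp.
exact: (cvg_unique _ h1 h2).
Unshelve. all: by end_near. Qed.

End laplace_transform.

(** * Continuity theorem: producing a law from a limit of Laplace transforms *)

Lemma exists_probability_cdf {R : realType} (F : R -> R) :
  nondecreasing F -> right_continuous F ->
  F @ -oo --> (0 : R) -> F @ +oo --> (1 : R) ->
  exists p : probability (measurableTypeR R) R,
    forall a, p `]-oo, a]%classic = (F a)%:E.
Proof.
move=> ndF rcF F0 F1.
pose F' : cumulativeBounded (0 : R) (1 : R) :=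
  HB.pack F (isCumulative.Build R _ R F ndF rcF)
    (isCumulativeBounded.Build R 0 1 F F0 F1).
exists (lebesgue_stieltjes_measure F') => a.
by have := cdf_lebesgue_stieltjes_id F' a; rewrite /cdf /distribution /pushforward preimage_id.
Qed.

(** Replaces the diagonal extraction in Helly's selection theorem: along one ultrafilter,
    distribution functions converge at all real points simultaneously. *)
Lemma ultra_cvg_segment {R : realType} {I : Type} (U : set_system I)
    (f : I -> R) (a b : R) : UltraFilter U -> (forall i, a <= f i <= b) ->
  exists2 p, a <= p <= b & f @ U --> p.
Proof.
move=> UU fab.
have := @segment_compact R a b (f @ U) _ _.
case=> [|p []]; first by apply: (@filterE _ U) => i /=; rewrite in_itv; exact: fab.
rewrite /= in_itv/= => pab clp; exists p => // V Vp.
have [//|UV] := in_ultra_setVsetC (f @^-1` V) UU.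
by have [q [/= nVq Vq]] := clp (~` V) V UV Vp.
Qed.

Section laplace_step_bounds.
Context {R : realType}.
Local Notation T := (measurableTypeR R).
Local Notation D := (`[0%R, +oo[%classic : set T).
Variables (m : probability T R) (h l : R).
Hypotheses (mD1 : m D = 1%E) (h0 : 0 < h) (l0 : 0 <= l).

Let mD : measurable D. Proof. exact: measurable_itv. Qed.

Let e (i : nat) := expR (- (h * i%:R * l)).

Let e_ge i j : (i <= j)%N -> e j <= e i.
Proof. by move=> ij; rewrite ler_expR lerN2 ler_wpM2r// ler_pM2l// ler_nat. Qed.

Let F (a : R) := fine (m `]-oo, a]%classic).

Let ind (a y : R) : R := \1_(`]-oo, a]%classic) y.

Let indE a y : ind a y = if y <= a then 1 else 0.
Proof. by rewrite /ind indicE mem_setE in_itv/=; case: ifP. Qed.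

(** The sum telescopes to [e j], where [j] is the first index with [y <= h * j], or to 0 if there is
    none up to [M]. *)
Let step_le (M : nat) (y : R) :
  \sum_(i < M) (e i - e i.+1) * ind (h * i%:R) y + e M * ind (h * M%:R) y
  <= expR (- (y * l)).
Proof.
elim: M => [|M IH].
  rewrite big_ord0 add0r indE; case: ifP => y0; last by rewrite mulr0 expR_ge0.
  by rewrite mulr1 /e ler_expR lerN2 ler_wpM2r.
rewrite big_ord_recr/=; have [yM|yM] := leP y (h * M%:R).
  rewrite indE yM mulr1 [in e M.+1 * _]indE.
  have -> : y <= h * M.+1%:R by rewrite (le_trans yM)// ler_pM2l// ler_nat.
  by move: IH; rewrite indE yM !mulr1; lra.
rewrite big1 => [|i _]; last first.
  rewrite indE lt_geF ?mulr0// (le_lt_trans _ yM)// ler_pM2l// ler_nat.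
  exact: ltnW.
rewrite !indE (lt_geF yM) mulr0 !add0r.
case: ifP => yM1; last by rewrite mulr0 expR_ge0.
by rewrite mulr1 /e ler_expR lerN2 ler_wpM2r.
Qed.

(** The sum telescopes to [e j] with [j] the first index such that [y <= h * j.+1], so that
    [h * j <= y]; if no [j < M] qualifies, the term [e M] alone suffices. *)
Let step_ge (M : nat) (y : R) : 0 <= y -> expR (- (y * l)) <=
  \sum_(i < M) (e i - e i.+1) * ind (h * i.+1%:R) y + e M.
Proof.
move=> y0; elim: M => [|M IH].
  rewrite big_ord0 add0r /e mulr0 mul0r oppr0.
  by rewrite ler_expR oppr_le0 mulr_ge0.
rewrite big_ord_recr/= indE; have [yM|yM] := leP y (h * M.+1%:R).
  by move: IH; lra.
rewrite mulr0 addr0; apply: (@le_trans _ _ (e M.+1)).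
  by rewrite ler_expR lerN2 ler_wpM2r// ltW.
rewrite lerDr sumr_ge0// => i _; by rewrite mulr_ge0 ?subr_ge0 ?e_ge.
Qed.

Let measurable_ind a : measurable_fun D (ind a : T -> R).
Proof. exact: measurable_indic. Qed.

Let ind_norm a y : `|ind a y| <= 1.
Proof. by rewrite indE; case: ifP => _; rewrite ?normr1 ?normr0. Qed.

Let Rintegral_ind a : \int[m]_(y in D) ind a y = F a.
Proof.
rewrite /Rintegral (integral_indic _ mD)//; congr fine.
exact: (@measureI_eq1 _ _ _ m _ D).
Qed.

Let integrable_ind a : m.-integrable D (EFin \o (ind a : T -> R)).
Proof. exact: (@integrable_bounded _ _ _ m D mD (ind a) 1). Qed.

Let Rintegral_steps (M : nat) (a c : nat -> R) :
  \int[m]_(y in D) (\sum_(i < M) c i * ind (a i) y) = \sum_(i < M) c i * F (a i).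
Proof.
rewrite (@Rintegral_sum _ T _ _ _ _ (fun i y => c i * ind (a i) y) mD).
  by apply: eq_bigr => i _; rewrite RintegralZl// Rintegral_ind.
by move=> i; exact: (integrableZl mD (c i) (integrable_ind (a i))).
Qed.

Let integrable_steps (M : nat) (a c : nat -> R) :
  m.-integrable D (EFin \o (fun y : T => \sum_(i < M) c i * ind (a i) y)).
Proof.
apply: (eq_integrable mD (fun y => \sum_(i < M) (c i * ind (a i) y)%:E)%E).
  by move=> y _ /=; rewrite sumEFin.
apply: integrable_sum => // i _.
exact: (integrableZl mD (c i) (integrable_ind (a i))).
Qed.

Let integrable_exp : m.-integrable D (EFin \o (fun y : T => expR (- (y * l)))).
Proof.
apply: (@integrable_bounded _ _ _ m D mD _ 1); first exact: measurable_expNM.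
move=> y /=; rewrite in_itv/= andbT => y0.
rewrite ger0_norm ?expR_ge0//.
by have /andP[] := @expRN_in01 R (y * l) (mulr_ge0 y0 l0).
Qed.

(** Together with [laplace_le_steps], this frames the transform by finitely many values of the
    distribution function, so both inequalities survive a pointwise limit of distribution
    functions. *)
Lemma laplace_ge_steps (M : nat) :
  \sum_(i < M) (e i - e i.+1) * F (h * i%:R) <= \int[m]_(y in D) expR (- (y * l)).
Proof.
rewrite -(Rintegral_steps M (fun i => h * i%:R) (fun i => e i - e i.+1)).
apply: (le_Rintegral mD (integrable_steps M (fun i => h * i%:R)
  (fun i => e i - e i.+1)) integrable_exp).
move=> y _; apply: le_trans (step_le M y); rewrite lerDl mulr_ge0//; exact: expR_ge0.
Qed.

Lemma laplace_le_steps (M : nat) : \int[m]_(y in D) expR (- (y * l)) <=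
  \sum_(i < M) (e i - e i.+1) * F (h * i.+1%:R) + e M.
Proof.
have -> : e M = \int[m]_(y in D) e M.
  by rewrite Rintegral_cst// -[LHS]mulr1; congr (_ * _); exact: esym (congr1 fine mD1).
have icst : m.-integrable D (EFin \o (fun=> e M)).
  by apply: (@integrable_bounded _ _ _ m D mD _ `|e M|) => // y _.
rewrite -(Rintegral_steps M (fun i => h * i.+1%:R) (fun i => e i - e i.+1)).
rewrite -(RintegralD mD (integrable_steps M (fun i => h * i.+1%:R)
  (fun i => e i - e i.+1)) icst).
apply: (le_Rintegral mD integrable_exp).
  exact: (integrableD mD (integrable_steps M (fun i => h * i.+1%:R)
    (fun i => e i - e i.+1)) icst).
by move=> y; rewrite /= in_itv/= andbT; exact: step_ge.
Qed.

End laplace_step_bounds.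

(** An atom at 0 is allowed: binomial mixtures and compound Poisson laws have one. *)
Definition is_laplace_transform {R : realType} (g : R -> R) : Prop :=
  exists m : probability (measurableTypeR R) R, m `[0, +oo[%classic = 1%E /\
    forall l, 0 <= l -> \int[m]_(y in `[0, +oo[) expR (- (y * l)) = g l.

Lemma exists_expRN_le {R : realType} (c e : R) : 0 < c -> 0 < e ->
  exists M : nat, expR (- (M%:R * c)) <= e.
Proof.
move=> c0 e0; exists (Num.trunc (e^-1 / c)).+1.
rewrite expRN -[leRHS]invrK lef_pV2 ?posrE ?expR_gt0 ?invr_gt0//.
apply: (@le_trans _ _ ((Num.trunc (e^-1 / c)).+1%:R * c)).
  by rewrite -ler_pdivrMr// ltW// truncnS_gt.
by apply: le_trans (expR_ge1Dx _); rewrite lerDr.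
Qed.

(** Helly selection followed by identification of the transform. The hypothesis at [0^'+] is
    tightness: it prevents mass from escaping to infinity. *)
Lemma is_laplace_transform_cvg {R : realType} (g_ : nat -> R -> R) (g : R -> R) :
  (forall n, is_laplace_transform (g_ n)) ->
  (forall l, 0 <= l -> g_ n l @[n --> \oo] --> g l) ->
  g l @[l --> 0^'+] --> (1 : R) ->
  is_laplace_transform g.
Proof.
move=> /choice[m mP] g_g g1.
have [U [UU Uoo]] := @ultraFilterLemma nat \oo _.
pose F_ n a := fine (m n `]-oo, a]%classic).
have F_01 a n : 0 <= F_ n a <= 1.
  rewrite fine_ge0//= -lee_fin fineK ?probability_le1//.
  exact: fin_num_measure.
have F_nd n : nondecreasing (F_ n).
  move=> a b ab; apply: fine_le; rewrite ?fin_num_measure// le_measure ?inE//.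
  by apply: subset_itvl; rewrite bnd_simp.
have /choice[F FP] : forall a : R, exists p : R, 0 <= p <= 1 /\ F_ n a @[n --> U] --> p.
  by move=> a; have [p ? ?] := ultra_cvg_segment UU (F_01 a); exists p.
have Fnd : nondecreasing F.
  move=> a b ab; apply: ler_cvg_to (FP a).2 (FP b).2 _.
  by apply: filterE => n; exact: F_nd.
have Fneg a : a < 0 -> F a = 0.
  move=> a0; apply: cvg_unique (FP a).2 _ => //; apply: cvg_near_cst.
  apply: filterE => n; rewrite /F_.
  rewrite (_ : m n `]-oo, a]%classic = 0%E)//.
  apply: (@subset_measure0 _ _ _ (m n) _ (~` `[0%R, +oo[%classic)) => //.
  - exact: measurableC.
  - move=> y /=; rewrite !in_itv/= andbT => ya; apply/negP; rewrite -ltNge.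
    exact: le_lt_trans ya a0.
  - exact: probability_setC_eq0 (mP n).1.
have gU l : 0 <= l ->
    \int[m n]_(y in `[0%R, +oo[) expR (- (y * l)) @[n --> U] --> g l.
  move=> l0; apply: cvg_trans (g_g l l0).
  under eq_cvg do rewrite (mP _).2//.
  by move=> V; exact: Uoo.
have FcvgU (h l : R) (c : nat -> R) (a : nat -> R) M :
    \sum_(i < M) c i * F_ n (a i) @[n --> U] --> \sum_(i < M) c i * F (a i).
  apply: cvg_big => [|i _]; first exact: add_continuous.
  by apply: cvgMl_tmp; exact: (FP _).2.
pose e (h l : R) i := expR (- (h * i%:R * l)).
have g_ge h l M : 0 < h -> 0 <= l ->
    \sum_(i < M) (e h l i - e h l i.+1) * F (h * i%:R) <= g l.
  move=> h0 l0.
  apply: ler_cvg_to (FcvgU h l (fun i => e h l i - e h l i.+1) (fun i => h * i%:R) M) (gU l l0) _.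
  by apply: filterE => n; exact: (laplace_ge_steps (mP n).1).
have g_le h l M : 0 < h -> 0 <= l ->
    g l <= \sum_(i < M) (e h l i - e h l i.+1) * F (h * i.+1%:R) + e h l M.
  move=> h0 l0.
  apply: ler_cvg_to (gU l l0) (cvgD (FcvgU h l (fun i => e h l i - e h l i.+1)
    (fun i => h * i.+1%:R) M) (cvg_cst (e h l M))) _.
  by apply: filterE => n; exact: (laplace_le_steps (mP n).1).
(* The pointwise limit [F] need not be right-continuous; [G] is its right-continuous version. The
   two are interlaced, [F a <= G a <= F b] for [a < b], which is what the comparison at the end
   relies on. *)
pose G a := inf [set F b | b in `]a, +oo[%classic].
have Glb a : has_lbound [set F b | b in `]a, +oo[%classic].
  by exists 0 => _ [b _ <-]; have /andP[] := (FP b).1.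
have G_le a b : a < b -> G a <= F b.
  by move=> ab; apply: (ge_inf (Glb a)); exists b => //=; rewrite in_itv/= ab.
have F_le_G a : F a <= G a.
  apply: lb_le_inf; first by exists (F (a + 1)), (a + 1); rewrite //= in_itv/= ltrDl ltr01.
  by move=> _ [b + <-]; rewrite /= in_itv/= andbT => /ltW; exact: Fnd.
have Gnd : nondecreasing G.
  move=> a b; rewrite le_eqVlt => /predU1P[->//|ab].
  exact: le_trans (G_le _ _ ab) (F_le_G b).
have Grc : right_continuous G.
  move=> a; apply/cvgrPdist_le => eps eps0.
  have [|_ [b + <-] Fb] := @inf_adherent _ [set F b | b in `]a, +oo[%classic] _ eps0.
    by split => //; exists (F (a + 1)), (a + 1); rewrite //= in_itv/= ltrDl ltr01.
  rewrite /= in_itv/= andbT => ab.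
  near=> c.
  have ac : a <= c by near: c; exact: nbhs_right_ge.
  have cb : c < b by near: c; exact: nbhs_right_lt.
  have := Gnd _ _ ac; have := G_le _ _ cb; move: Fb; rewrite -/(G a).
  by rewrite ler_norml; lra.
have Gneg a : a < 0 -> G a = 0.
  move=> a0; have a20 : a / 2 < 0 by lra.
  apply/eqP; rewrite eq_le -{1}(Fneg _ a20) -(Fneg _ a0) F_le_G andbT.
  by apply: G_le; lra.
have G0 : G @ -oo --> (0 : R).
  apply: cvg_near_cst; near=> a.
  by rewrite Gneg//; near: a; exact: nbhs_ninfty_lt.
(* With a single step of width [a], the upper step bound reads [g l <= (1 - expR (- (a * l))) * F a
   + expR (- (a * l))]. Fixing [l] with [g l] near 1 and letting [a] grow forces [F a] towards 1. *)
have G1 : G @ +oo --> (1 : R).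
  apply/cvgrPdist_le => eps eps0.
  have eps20 : 0 < eps / 2 by lra.
  have : \forall l \near 0^'+, 0 < l /\ `|1 - g l| <= eps / 2.
    near=> l; split => //; near: l.
    by move/cvgrPdist_le : g1; apply.
  move=> /filter_ex[l [l0 gl]].
  have [M eM] := exists_expRN_le l0 eps20.
  near=> a.
  have aM : M%:R <= a by near: a; exact: nbhs_pinfty_ge.
  have a0 : 0 < a by near: a; exact: nbhs_pinfty_gt.
  have := g_le a l 1%N a0 (ltW l0); rewrite big_ord_recl big_ord0 addr0 /e.
  rewrite mulr1 mulr0 mul0r oppr0 expR0.
  have : expR (- (a * l)) <= expR (- (M%:R * l)) by rewrite ler_expR lerN2 ler_pM2r.
  have := F_le_G a; have /andP[Fa0 Fa1] := (FP a).1.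
  have Ga1 : G a <= 1.
    by apply: le_trans (G_le a (a + 1) _) _; [lra|have /andP[] := (FP (a + 1)).1].
  move: gl eM; rewrite !ler_norml => /andP[_ ?] ? ? ?.
  have := mulr_ge0 (expR_ge0 (- (a * l))) Fa0 => ? ?.
  by apply/andP; split; lra.
have [p pG] := exists_probability_cdf Gnd Grc G0 G1.
have pneg : p `]-oo, 0%R[%classic = 0%E.
  have -> : `]-oo, 0%R[%classic = \bigcup_n `]-oo, (- n.+1%:R^-1 : R)]%classic.
    apply/seteqP; split => y /=; rewrite in_itv/=.
      move=> y0; exists (Num.trunc (- y)^-1) => //=; rewrite in_itv/= lerNr.
      rewrite -[leRHS]invrK lef_pV2 ?posrE ?invr_gt0 ?oppr_gt0//.
      by rewrite ltW// truncnS_gt.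
    by move=> [n _]; rewrite /= in_itv/= => /le_lt_trans; apply; rewrite oppr_lt0 invr_gt0.
  apply/measure_negligible; first by apply: bigcup_measurable => n _.
  apply: negligible_bigcup => n; apply/negligibleP => //.
  have n0 : - n.+1%:R^-1 < 0 :> R by rewrite oppr_lt0 invr_gt0.
  by apply: (etrans (pG _)); rewrite Gneg.
have pD : p `[0, +oo[%classic = 1%E.
  have -> : `[0%R, +oo[%classic = ~` `]-oo, 0%R[%classic :> set (measurableTypeR R).
    by rewrite setCitvl.
  by rewrite probability_setC// pneg sube0.
exists p; split => // l; rewrite le_eqVlt => /predU1P[<-|l0].
  have L0 (q : probability (measurableTypeR R) R) : q `[0, +oo[%classic = 1%E ->
      \int[q]_(y in `[0%R, +oo[) expR (- (y * 0)) = 1.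
    move=> q1; under eq_Rintegral do rewrite mulr0 oppr0 expR0.
    by rewrite Rintegral_cst// mul1r; exact: (congr1 fine q1).
  have g01 : g_ n 0 @[n --> \oo] --> (1 : R).
    apply: cvg_near_cst; apply: nearW => n.
    by rewrite -(mP n).2// L0//; exact: (mP n).1.
  by rewrite L0//; exact: cvg_unique g01 (g_g 0 (lexx _)).
apply/eqP; rewrite -subr_eq0 -normr_le0; apply/ler_addgt0Pl => eps eps0.
rewrite addr0.
(* Consecutive weights then have ratio [expR (- (eps / 4))] and differ by at most [eps / 4].
   Division by [l] is why [l = 0] was settled separately. *)
pose h := eps / (4 * l).
have h0 : 0 < h by rewrite divr_gt0// mulr_gt0.
have hl : h * l = eps / 4 by rewrite /h; field; rewrite gt_eqF.
have [M eM] : exists M, e h l M <= eps / 2.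
  have [||M] := @exists_expRN_le _ (h * l) (eps / 2); first by rewrite mulr_gt0.
    by rewrite divr_gt0.
  by move=> eM; exists M; apply: le_trans eM; rewrite /e mulrCA mulrA.
have e_diff i : 0 <= e h l i - e h l i.+1 <= eps / 4.
  have -> : e h l i.+1 = e h l i * expR (- (eps / 4)).
    by rewrite /e -expRD -hl -natr1; congr expR; ring.
  have := expR_ge1Dx (- (eps / 4)).
  have ei0 := expR_gt0 (- (h * i%:R * l)).
  have ei1 : e h l i <= 1.
    rewrite -[leRHS]expR0 ler_expR oppr_le0.
    exact: mulr_ge0 (mulr_ge0 (ltW h0) (ler0n _ _)) (ltW l0).
  have : expR (- (eps / 4)) <= 1 by rewrite -[leRHS]expR0 ler_expR oppr_le0; lra.
  rewrite -/(e h l i) in ei0; move: (expR _) (e h l i) ei0 ei1 => w v *.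
  by apply/andP; split; nra.
have pE a : fine (p `]-oo, a]%classic) = G a by rewrite pG.
have L_ge := laplace_ge_steps pD h0 (ltW l0) M.
have L_le := laplace_le_steps pD h0 (ltW l0) M.
(* Passing between [F] and [G] and between adjacent grid points costs at most an increment of [F]
   over two cells. These increments sum to at most 2, so the weights [eps / 4] give [eps / 2], and
   the remainder [e h l M] takes the other half. *)
have tele : \sum_(i < M) (F (h * i.+2%:R) - F (h * i%:R)) =
    F (h * M.+1%:R) + F (h * M%:R) - F (h * 1) - F (h * 0).
  elim: M {eM L_ge L_le} => [|M IH]; first by rewrite big_ord0; ring.
  by rewrite big_ord_recr/= IH; ring.
have tele2 : \sum_(i < M) (F (h * i.+2%:R) - F (h * i%:R)) <= 2.
  rewrite tele; have /andP[_ ?] := (FP (h * M.+1%:R)).1.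
  have /andP[_ ?] := (FP (h * M%:R)).1.
  have /andP[? _] := (FP (h * 1)).1.
  by have /andP[? _] := (FP (h * 0)).1; lra.
have sum_diff (A B : nat -> R) : (forall i, B i - A i <= F (h * i.+2%:R) - F (h * i%:R)) ->
    \sum_(i < M) (e h l i - e h l i.+1) * B i -
    \sum_(i < M) (e h l i - e h l i.+1) * A i <= eps / 2.
  move=> BA; rewrite -sumrB.
  apply: (@le_trans _ _ (\sum_(i < M) eps / 4 * (F (h * i.+2%:R) - F (h * i%:R)))).
    apply: ler_sum => i _; rewrite -mulrBr.
    have /andP[d0 d1] := e_diff i.
    apply: (@le_trans _ _ ((e h l i - e h l i.+1) * (F (h * i.+2%:R) - F (h * i%:R)))).
      by rewrite ler_wpM2l.
    rewrite ler_wpM2r// subr_ge0; apply: Fnd; rewrite ler_pM2l// ler_nat.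
    exact: leqW.
  by rewrite -mulr_sumr; nra.
have hS i : h * i%:R < h * i.+1%:R by rewrite ltr_pM2l// ltr_nat.
have d1 := sum_diff (fun i => G (h * i%:R)) (fun i => F (h * i.+1%:R)).
have d2 := sum_diff (fun i => F (h * i%:R)) (fun i => G (h * i.+1%:R)).
have {}d1 : \sum_(i < M) (e h l i - e h l i.+1) * F (h * i.+1%:R) -
    \sum_(i < M) (e h l i - e h l i.+1) * G (h * i%:R) <= eps / 2.
  by apply: d1 => i; apply: lerB => //; exact: Fnd (ltW (hS _)).
have {}d2 : \sum_(i < M) (e h l i - e h l i.+1) * G (h * i.+1%:R) -
    \sum_(i < M) (e h l i - e h l i.+1) * F (h * i%:R) <= eps / 2.
  by apply: d2 => i; apply: lerB => //; exact: G_le.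
have g1' := g_le h l M h0 (ltW l0); have g2' := g_ge h l M h0 (ltW l0).
move: L_ge L_le; under eq_bigr do rewrite pE; move=> L_ge.
under eq_bigr do rewrite pE; move=> L_le.
rewrite -!/(e h l _) in L_ge L_le.
by rewrite ler_norml; apply/andP; split; lra.
Unshelve. all: by end_near. Qed.

(** * Operations on laws: convolution, mixture, compound Poisson *)

Section probability_of_measure.
Context {d} {T : measurableType d} {R : realType}.
Variable m : {measure set T -> \bar R}.
Hypothesis m1 : m setT = 1%E.

Let mcopy : set T -> \bar R := m.
#[local] HB.instance Definition _ := Measure.on mcopy.
#[local] HB.instance Definition _ := Measure_isProbability.Build _ _ _ mcopy m1.

(** The equality is between set functions, so that kernels, restrictions and product measures of
    total mass 1 can be rewritten into objects carrying the probability structure. *)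
Lemma exists_probability :
  exists p : probability T R, p = m :> (set T -> \bar R).
Proof. by exists mcopy. Qed.

End probability_of_measure.

Lemma exists_probability_pushforward d d' (T : measurableType d)
    (T' : measurableType d') (R : realType) (m : probability T R) (f : T -> T') :
  measurable_fun setT f ->
  exists p : probability T' R, p = pushforward m f :> (set T' -> \bar R).
Proof.
move=> mf; pose X : {mfun T >-> T'} := HB.pack f (isMeasurableFun.Build _ _ _ _ _ mf).
by exists (distribution m X).
Qed.

Lemma integral_setT_eq1 d (T : measurableType d) (R : realType)
    (m : probability T R) (D : set T) (f : T -> \bar R) :
  measurable D -> m D = 1%E -> measurable_fun setT f -> (forall x, 0 <= f x)%E ->
  (\int[m]_(x in D) f x = \int[m]_x f x)%E.
Proof.
move=> mD mD1 mf f0.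
have mDC := measurableC mD.
rewrite -[in RHS](setUv D) ge0_integral_setU//; last 2 first.
- by rewrite setUv.
- exact/disj_setPCl.
rewrite [X in (_ + X)%E](_ : _ = 0%E) ?adde0//.
apply: null_set_integral => //; first exact: measurable_funTS.
exact: probability_setC_eq0.
Qed.

Section laplace_of_convolution.
Context {R : realType}.
Local Notation T := (measurableTypeR R).
Local Notation D := (`[0%R, +oo[%classic : set T).
Implicit Types m : probability T R.
Local Open Scope ereal_scope.

Let mD : measurable D. Proof. exact: measurable_itv. Qed.

Lemma measurable_addT : measurable_fun setT (fun z : T * T => (z.1 + z.2)%R : T).
Proof. exact: measurable_funD. Qed.

Lemma exists_convolution m1 m2 : exists p : probability T R,
  p = convolution m1 m2 :> (set T -> \bar R).
Proof.
have [|P PE] := @exists_probability _ _ _ (m1 \x m2).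
  rewrite -setXTT; apply: etrans (product_measure1E m1 m2 measurableT measurableT) _.
  apply: etrans (congr2 mule (probability_setT m1) (probability_setT m2)) _.
  exact: mule1.
have [p pE] := exists_probability_pushforward P measurable_addT.
by exists p; rewrite pE PE.
Qed.

Lemma exists_convolution_power m n : exists p : probability T R,
  p = convolution_power m n :> (set T -> \bar R).
Proof.
elim: n => [|n [p pE]]; first by exists (\d_(0%R : T)).
have [q qE] := exists_convolution m p.
by exists q; rewrite qE pE.
Qed.

Lemma integral_exp_convolution m1 m2 (l : R) :
  \int[convolution m1 m2]_y (expR (- (y * l)))%:E =
  (\int[m1]_y (expR (- (y * l)))%:E) * \int[m2]_y (expR (- (y * l)))%:E.
Proof.
have mexp : measurable_fun [set: T] (fun y : T => (expR (- (y * l)))%:E).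
  by apply/measurable_EFinP; exact: measurable_expNM.
rewrite /convolution ge0_integral_pushforward//; last exact: measurable_addT.
rewrite preimage_setT fubini_tonelli1//; first last.
- by move=> z /=; rewrite lee_fin expR_ge0.
- by apply: measurableT_comp mexp _; exact: measurable_addT.
transitivity (\int[m1]_x ((expR (- (x * l)))%:E * \int[m2]_y (expR (- (y * l)))%:E)).
  apply: eq_integral => x _; rewrite /fubini_F/=.
  transitivity (\int[m2]_y ((expR (- (x * l)))%:E * (expR (- (y * l)))%:E)).
    apply: eq_integral => y _; rewrite -EFinM -expRD; congr (expR _)%:E.
    by rewrite mulrDl opprD.
  by apply: ge0_integralZl => // [y _|]; rewrite lee_fin expR_ge0.
by apply: ge0_integralZr => //; apply: integral_ge0 => y _; rewrite lee_fin expR_ge0.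
Qed.

Lemma convolution_eq1 m1 m2 : m1 D = 1 -> m2 D = 1 -> convolution m1 m2 D = 1.
Proof.
move=> m1D m2D; have [p pE] := exists_convolution m1 m2.
apply/eqP; rewrite eq_le -{1}pE probability_le1//=.
apply: (@le_trans _ _ ((m1 \x m2) (D `*` D))).
  rewrite [leRHS](product_measure1E m1 m2 mD mD).
  have -> : (1 = m1 D * m2 D :> \bar R) by rewrite m1D m2D mule1.
  exact: lexx.
rewrite /convolution /pushforward le_measure ?inE//.
- exact: measurableX.
- by rewrite -[X in measurable X]setTI; exact: measurable_addT.
- by move=> [x y] /=; rewrite !in_itv/= !andbT => -[? ?]; rewrite addr_ge0.
Qed.

End laplace_of_convolution.

(** Squeeze by [exp (- x / (1 - x)) <= 1 - x <= exp (- x)] at [x = z / n.+1], raised to the power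
    [n.+1]; both bounds are instances of [1 + y <= exp y]. *)
Lemma cvg_expR_compound {R : realType} (z : R) : 0 <= z ->
  (1 - z / n.+1%:R) ^+ n.+1 @[n --> \oo] --> expR (- z).
Proof.
move=> z0.
have zn0 : z / n.+1%:R @[n --> \oo] --> (0 : R).
  by rewrite -[X in _ --> X](mulr0 z); apply: cvgMl_tmp; exact: cvg_harmonic.
apply: (@squeeze_cvgr _ _ _ _ (fun n => expR (- (z / (1 - z / n.+1%:R)))) (fun=> expR (- z))).
- near=> n.
  have zn : z / n.+1%:R < 1.
    by near: n; move/cvgr_lt : zn0; apply; exact: ltr01.
  have pos : 0 < 1 - z / n.+1%:R by rewrite subr_gt0.
  have n0 : n.+1%:R != 0 :> R by rewrite pnatr_eq0.
  apply/andP; split; last first.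
    apply: (@le_trans _ _ (expR (- (z / n.+1%:R)) ^+ n.+1)).
      rewrite lerXn2r ?nnegrE ?expR_ge0//; first exact: ltW.
      exact: expR_ge1Dx.
    rewrite -expRM_natl (_ : n.+1%:R * - (z / n.+1%:R) = - z)//.
    by rewrite mulrN mulrC divfK.
  apply: (@le_trans _ _ (expR (- (z / n.+1%:R / (1 - z / n.+1%:R))) ^+ n.+1)).
    rewrite -expRM_natl (_ : n.+1%:R * _ = - (z / (1 - z / n.+1%:R)))//.
    by rewrite mulrN !mulrA [n.+1%:R * z]mulrC mulfK.
  rewrite lerXn2r ?nnegrE ?expR_ge0//; first exact: ltW.
  rewrite expRN -[leRHS]invrK lef_pV2 ?posrE ?expR_gt0 ?invr_gt0//.
  apply: le_trans (expR_ge1Dx _).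
  rewrite le_eqVlt; apply/orP; left; apply/eqP.
  have pos' : 1 - z / n.+1%:R != 0 by rewrite gt_eqF.
  by apply: (mulIf pos'); rewrite mulVf// mulrDl mul1r divfK// subrK.
- apply: (@continuous_cvg _ _ _ _ _ _ expR); first exact: continuous_expR.
  apply: cvgN; rewrite -[X in _ --> X]divr1; apply: cvgM; first exact: cvg_cst.
  apply: cvgV; first exact: oner_neq0.
  by rewrite -[X in _ --> X]subr0; apply: cvgB => //; exact: cvg_cst.
- exact: cvg_cst.
Unshelve. all: by end_near. Qed.

Section laplace_transform_closure.
Context {R : realType}.
Local Notation T := (measurableTypeR R).
Local Notation D := (`[0%R, +oo[%classic : set T).
Implicit Types g : R -> R.

Let mD : measurable D. Proof. exact: measurable_itv. Qed.

Lemma normr_expRNM_le1 (y l : R) : 0 <= y -> 0 <= l -> `|expR (- (y * l))| <= 1.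
Proof.
move=> y0 l0; rewrite ger0_norm ?expR_ge0//.
by have /andP[] := @expRN_in01 R (y * l) (mulr_ge0 y0 l0).
Qed.

Lemma laplace_fullE (m : probability T R) (A : set T) (l : R) :
  measurable A -> A `<=` D -> m A = 1%E -> 0 <= l ->
  (\int[m]_y (expR (- (y * l)))%:E =
   (\int[m]_(y in A) expR (- (y * l)))%:E)%E.
Proof.
move=> mA AD mA1 l0; rewrite -(integral_setT_eq1 mA mA1); first last.
- by move=> y; rewrite lee_fin expR_ge0.
- by apply/measurable_EFinP; exact: measurable_expNM.
rewrite /Rintegral fineK//; apply: integrable_fin_num => //.
apply: (@integrable_bounded _ _ _ m A mA _ 1); first exact: measurable_expNM.
move=> y /AD; rewrite /= in_itv/= andbT => y0.
exact: normr_expRNM_le1.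
Qed.

Lemma is_laplace_transformP g : is_laplace_transform g <->
  exists m : probability T R, m D = 1%E /\
    forall l, 0 <= l -> (\int[m]_y (expR (- (y * l)))%:E = (g l)%:E)%E.
Proof.
split=> -[m [mD1 mg]]; exists m; split => // l l0.
  by rewrite (@laplace_fullE m D)// mg.
by apply: EFin_inj; rewrite -mg// (@laplace_fullE m D).
Qed.

Lemma is_laplace_transform_at0 g : is_laplace_transform g -> g 0 = 1.
Proof.
move=> [m [mD1 mg]]; rewrite -mg//.
under eq_Rintegral do rewrite mulr0 oppr0 expR0.
by rewrite Rintegral_cst// mul1r; exact: (congr1 fine mD1).
Qed.

(** Dominated convergence along [1 / n.+1]; monotonicity in [l] extends it to the right
    neighbourhood of 0. *)
Lemma is_laplace_transform_cvg0 g : is_laplace_transform g ->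
  g l @[l --> 0^'+] --> (1 : R).
Proof.
move=> gL; have g0 := is_laplace_transform_at0 gL; move: gL => [m [mD1 mg]].
have g_seq : g (n.+1%:R^-1) @[n --> \oo] --> (1 : R).
  rewrite -[X in _ --> X]g0 -[g 0]mg//; under eq_cvg do rewrite -mg//.
  apply: (@bounded_cvg_Rintegral _ _ _ m D mD _ _ 1).
  - by move=> n; exact: measurable_expNM.
  - move=> n y; rewrite /= in_itv/= andbT => y0.
    by apply: normr_expRNM_le1; rewrite ?invr_ge0.
  - move=> y _; apply: (@continuous_cvg _ _ _ _ _ _ expR); first exact: continuous_expR.
    by apply: cvgN; apply: cvgMl_tmp; exact: cvg_harmonic.
have g_le l l' : 0 <= l -> l <= l' -> g l' <= g l.
  move=> l0 ll'; have l'0 := le_trans l0 ll'; rewrite -!mg//.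
  have int k : 0 <= k -> m.-integrable D (EFin \o (fun y : T => expR (- (y * k)))).
    move=> k0; apply: (@integrable_bounded _ _ _ m D mD _ 1).
      exact: measurable_expNM.
    move=> y; rewrite /= in_itv/= andbT => y0; exact: normr_expRNM_le1.
  apply: (le_Rintegral mD (int _ l'0) (int _ l0)) => y.
  by rewrite /= in_itv/= andbT => y0; rewrite ler_expR lerN2 ler_wpM2l.
apply/cvgrPdist_le => e e0.
move/cvgrPdist_le : g_seq => /(_ _ e0)[n _ /(_ n (leqnn n))] /= gn.
near=> l.
have l0 : 0 <= l by near: l; exact: nbhs_right_ge.
have ln : l <= n.+1%:R^-1 by near: l; apply: nbhs_right_le; rewrite invr_gt0 ltr0n.
have := g_le _ _ l0 ln; have := g_le _ _ (lexx 0) l0; rewrite g0.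
by move: gn; rewrite !ler_norml => /andP[? ?] ? ?; apply/andP; split; lra.
Unshelve. all: by end_near. Qed.

Let dirac0_D : \d_(0%R : T) D = 1%E :> \bar R.
Proof. by rewrite diracE mem_set//= in_itv/= lexx. Qed.

Lemma is_laplace_transform1 : is_laplace_transform (fun=> 1 : R).
Proof.
apply/is_laplace_transformP; exists (\d_(0%R : T)); split.
  exact: dirac0_D.
move=> l l0; rewrite integral_dirac//.
  by rewrite diracT mul1e mul0r oppr0 expR0.
by apply/measurable_EFinP; exact: measurable_expNM.
Qed.

Lemma is_laplace_transformM g1 g2 : is_laplace_transform g1 ->
  is_laplace_transform g2 -> is_laplace_transform (fun l => g1 l * g2 l).
Proof.
move=> /is_laplace_transformP[m1 [m1D m1g]] /is_laplace_transformP[m2 [m2D m2g]].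
have [p pE] := exists_convolution m1 m2.
apply/is_laplace_transformP; exists p; split.
  by rewrite pE; exact: convolution_eq1.
move=> l l0; rewrite pE; apply: etrans (integral_exp_convolution m1 m2 l) _.
by rewrite m1g// m2g.
Qed.

Lemma is_laplace_transformX g n : is_laplace_transform g ->
  is_laplace_transform (fun l => g l ^+ n).
Proof.
move=> gL; elim: n => [|n IH].
  by under eq_fun do rewrite expr0; exact: is_laplace_transform1.
by under eq_fun do rewrite exprS; exact: is_laplace_transformM.
Qed.

Lemma is_laplace_transform_mix g (p : R) : 0 <= p <= 1 -> is_laplace_transform g ->
  is_laplace_transform (fun l => 1 - p + p * g l).
Proof.
move=> /andP[p0 p1] /is_laplace_transformP[m [mD1 mg]].
have q0 : 0 <= 1 - p by rewrite subr_ge0.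
pose mu := measure_add (mscale (NngNum q0) \d_(0%R : T)) (mscale (NngNum p0) m).
have muE A : mu A = ((1 - p)%:E * \d_(0%R : T) A + p%:E * m A)%E.
  by rewrite /mu measure_addE.
have m_T : m setT = 1%E by exact: probability_setT.
have [|q qE] := @exists_probability _ _ _ mu.
  apply: etrans (muE _) _; rewrite diracT m_T !mule1 -EFinD.
  by congr EFin; exact: subrK.
apply/is_laplace_transformP; exists q; split.
  rewrite qE; apply: etrans (muE _) _; rewrite dirac0_D mD1 !mule1 -EFinD.
  by congr EFin; exact: subrK.
move=> l l0; rewrite qE.
have mexp : measurable_fun [set: T] (fun y : T => (expR (- (y * l)))%:E).
  by apply/measurable_EFinP; exact: measurable_expNM.
have exp0 (y : T) : (0 <= (expR (- (y * l)))%:E)%E by rewrite lee_fin expR_ge0.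
rewrite (ge0_integral_measure_add _ _ measurableT)//.
rewrite !ge0_integral_mscale// integral_dirac// diracT mul1e mul0r oppr0 expR0.
by rewrite mg//= -EFinM mulr1 -EFinM -EFinD.
Qed.

(** Poisson limit of binomials: the [n]-fold convolution of a law that is 0 with probability
    [1 - c / n] and distributed as [m] otherwise. *)
Lemma is_laplace_transform_compound g (c : R) : 0 <= c -> is_laplace_transform g ->
  is_laplace_transform (fun l => expR (- (c * (1 - g l)))).
Proof.
move=> c0 gL.
have gle1 l : 0 <= l -> g l <= 1.
  move=> l0; have [m [mD1 mg]] := gL; rewrite -mg//.
  apply: le_trans (ler_norm _) _; apply: normr_Rintegral_le => //.
    exact: measurable_expNM.
  move=> y; rewrite /= in_itv/= andbT => y0; exact: normr_expRNM_le1.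
(* Shifting the index by [N] makes [c / (n + N).+1] a probability for every [n]. *)
pose N := (Num.trunc c).+1.
apply: (@is_laplace_transform_cvg _
  (fun n l => (1 - c * (1 - g l) / (n + N).+1%:R) ^+ (n + N).+1)).
- move=> n.
  have -> : (fun l => (1 - c * (1 - g l) / (n + N).+1%:R) ^+ (n + N).+1) =
     (fun l => (1 - c / (n + N).+1%:R + c / (n + N).+1%:R * g l) ^+ (n + N).+1).
    by apply/funext => l; congr (_ ^+ _); ring.
  apply: is_laplace_transformX; apply: is_laplace_transform_mix => //.
  rewrite divr_ge0//= ler_pdivrMr// mul1r (le_trans (ltW (truncnS_gt c)))//.
  by rewrite ler_nat (leq_trans (leq_addl n N)).
- move=> l l0.
  have z0 : 0 <= c * (1 - g l) by rewrite mulr_ge0// subr_ge0 gle1.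
  have := cvg_expR_compound z0.
  by rewrite -(cvg_shiftn N).
- rewrite -[X in _ --> X]expR0; apply: (@continuous_cvg _ _ _ _ _ _ expR).
    exact: continuous_expR.
  rewrite -[X in _ --> X]oppr0; apply: cvgN.
  rewrite -[X in _ --> X](mulr0 c); apply: cvgMl_tmp.
  rewrite -[X in _ --> X](subrr (1 : R)); apply: cvgB; first exact: cvg_cst.
  exact: is_laplace_transform_cvg0.
Qed.

Lemma is_laplace_transform_compound_sum (K : nat) (c : nat -> R) (g_ : nat -> R -> R) :
  (forall k, 0 <= c k) -> (forall k, is_laplace_transform (g_ k)) ->
  is_laplace_transform (fun l => expR (- \sum_(k < K) c k * (1 - g_ k l))).
Proof.
move=> c0 gL; elim: K => [|K IH].
  by under eq_fun do rewrite big_ord0 oppr0 expR0; exact: is_laplace_transform1.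
under eq_fun do rewrite big_ord_recr/= opprD expRD.
by apply: is_laplace_transformM => //; exact: is_laplace_transform_compound.
Qed.

End laplace_transform_closure.

(** Telescoping with lag [m]: only the leading and the trailing block of length [m] survive. Below,
    the leading block is the Riemann sum and the trailing one is negligible. *)
Lemma sum_shift {R : realType} (f : nat -> R) (K m : nat) :
  \sum_(k < K) (f k - f (k + m)%N) = \sum_(k < m) f k - \sum_(k < m) f (K + k)%N.
Proof.
elim: K => [|K IH]; first by rewrite big_ord0 subrr.
rewrite big_ord_recr/= IH.
have -> : \sum_(k < m) f (K + k)%N = f K - f (K + m)%N + \sum_(k < m) f (K.+1 + k)%N.
  elim: m {IH} => [|m IH]; first by rewrite !big_ord0 addn0; ring.
  by rewrite !big_ord_recr/= IH addSnnS; ring.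
by ring.
Qed.

(* With [f r = exp (- phi r / n)], the approximants are compound Poisson laws of
   Laplace exponent [beta/n * \sum_k (f (k/n) - f (k/n + Phi l))], a Riemann sum
   of [beta * \int_0^(Phi l) f], which tends to [beta * Phi l].  Each term is
   [f (k/n)] times one minus the hypothesised transform at [x = 1/n, t = k/n]. *)
Lemma is_laplace_transform_exp_flow {R : realType} (phi Phi : R -> R) (beta : R) :
  0 < beta ->
  (forall s t, 0 <= s -> s <= t -> phi s <= phi t) ->
  (forall t, 0 <= t -> 0 <= phi t) ->
  (forall A, exists2 t, 0 <= t & A <= phi t) ->
  (forall l, 0 <= l -> 0 <= Phi l) ->
  Phi l @[l --> 0^'+] --> (0 : R) ->
  (forall x t, 0 < x -> 0 <= t ->
     is_laplace_transform (fun l => expR (- (x * (phi (t + Phi l) - phi t))))) ->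
  is_laplace_transform (fun l => expR (- (beta * Phi l))).
Proof.
move=> beta0 phi_nd phi0 phi_oo Phi0 Phi_cvg0 L.
pose f (n : nat) (r : R) := expR (- (n.+1%:R^-1 * phi r)).
pose del (n : nat) : R := n.+1%:R^-1.
have del0 n : 0 < del n by rewrite invr_gt0 ltr0n.
have f0 n r : 0 < f n r by exact: expR_gt0.
have f1 n r : 0 <= r -> f n r <= 1.
  by move=> r0; rewrite -[leRHS]expR0 ler_expR oppr_le0 mulr_ge0 ?phi0// ltW.
have f_ni n s t : 0 <= s -> s <= t -> f n t <= f n s.
  by move=> s0 st; rewrite ler_expR lerN2 ler_pM2l ?phi_nd.
(* The number [K n] of grid points is large enough for [f n] to have dropped to [del n] at the end
   of the grid; this is where unboundedness of [phi] is used. *)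
have /choice[K KP] : forall n, exists K : nat, f n (K%:R * del n) <= del n.
  move=> n; have [M eM] := @exists_expRN_le R 1 _ ltr01 (del0 n).
  have [t t0 tM] := phi_oo (M%:R * n.+1%:R).
  exists (Num.trunc (t * n.+1%:R)).+1; apply: le_trans eM.
  rewrite ler_expR lerN2 mulr1 ler_pdivlMl//.
  rewrite mulrC (le_trans tM)// phi_nd// ler_pdivlMr// ltW//; exact: truncnS_gt.
pose G n k l := expR (- (n.+1%:R^-1 * (phi (k%:R * del n + Phi l) - phi (k%:R * del n)))).
pose S n l := \sum_(k < K n) (beta * del n * f n (k%:R * del n)) * (1 - G n k l).
have SE n l : S n l = beta * del n *
    \sum_(k < K n) (f n (k%:R * del n) - f n (k%:R * del n + Phi l)).
  rewrite /S mulr_sumr; apply: eq_bigr => k _; rewrite -mulrA; congr (_ * _).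
  rewrite mulrBr mulr1 /f /G -expRD; congr (_ - expR _); ring.
apply: (@is_laplace_transform_cvg _ (fun n l => expR (- S n l))).
- move=> n; apply: (is_laplace_transform_compound_sum (K n)
    (c := fun k => beta * del n * f n (k%:R * del n)) (g_ := G n)).
    by move=> k; rewrite !mulr_ge0// ltW.
  by move=> k; apply: L => //; rewrite mulr_ge0// ltW.
- move=> l l0; have s0 := Phi0 _ l0; set s := Phi l in s0 *.
  apply: (@continuous_cvg _ _ _ _ _ _ expR); first exact: continuous_expR.
  apply: cvgN; under eq_cvg do rewrite SE -mulrA; apply: cvgMl_tmp.
  (* The lag in grid steps: [s] lies between [m n] and [(m n).+1] steps, so monotonicity of [f n]
     permits rounding it either way. *)
  pose m n := Num.trunc (s * n.+1%:R).
  have m_le n : (m n)%:R * del n <= s.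
    by rewrite ler_pdivrMr// truncn_le mulr_ge0.
  have m_gt n : s < (m n).+1%:R * del n.
    by rewrite ltr_pdivlMr//; exact: truncnS_gt.
  have kd0 n k : 0 <= k%:R * del n by rewrite mulr_ge0// ltW.
  have upper n : del n * \sum_(k < K n) (f n (k%:R * del n) - f n (k%:R * del n + s))
      <= s + del n.
    apply: (@le_trans _ _ (del n * (m n).+1%:R)).
      rewrite ler_pM2l//.
      apply: (@le_trans _ _ (\sum_(k < K n) (f n (k%:R * del n) - f n ((k + (m n).+1)%:R * del n)))).
        apply: ler_sum => k _; apply: lerB => //; apply: f_ni; first exact: addr_ge0.
        by rewrite natrD mulrDl lerD2l ltW.
      rewrite (sum_shift (fun k => f n (k%:R * del n))).
      rewrite lerBlDr -[leLHS]addr0 lerD//; last by apply: sumr_ge0 => k _; exact: ltW.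
      apply: (@le_trans _ _ (\sum_(k < (m n).+1) 1)).
        by apply: ler_sum => k _; exact: f1.
      by rewrite sumr_const card_ord.
    by rewrite mulrC -natr1 mulrDl mul1r lerD2r.
  (* The product bound needs [f n s - del n >= 0]. Since this difference tends to 1, the exceptional
     alternative eventually disappears. *)
  have lower n : (s - del n) * (f n s - del n) <=
      del n * \sum_(k < K n) (f n (k%:R * del n) - f n (k%:R * del n + s)) \/
      f n s < del n.
    have [fd|fd] := ltP (f n s) (del n); [by right|left].
    have fd0 : 0 <= f n s - del n by rewrite subr_ge0.
    apply: (@le_trans _ _ (del n * ((m n)%:R * (f n s - del n)))).
      rewrite mulrA ler_wpM2r// lerBlDr (le_trans (ltW (m_gt n)))//.
      by rewrite -natr1 mulrDl mul1r mulrC.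
    rewrite ler_pM2l//.
    apply: (@le_trans _ _ (\sum_(k < K n) (f n (k%:R * del n) - f n ((k + m n)%:R * del n)))); last first.
      apply: ler_sum => k _; apply: lerB => //; apply: f_ni => //.
      by rewrite natrD mulrDl lerD2l.
    rewrite (sum_shift (fun k => f n (k%:R * del n))) -sumrB.
    rewrite mulr_natl -[X in _ *+ X]card_ord -sumr_const.
    apply: ler_sum => k _; apply: lerB.
      apply: f_ni => //; apply: le_trans (m_le n).
      by rewrite ler_pM2r// ler_nat ltnW.
    apply: le_trans (KP n); apply: f_ni => //.
    by rewrite ler_pM2r// ler_nat leq_addr.
  have cdel : del n @[n --> \oo] --> (0 : R) by exact: cvg_harmonic.
  have cf : f n s @[n --> \oo] --> (1 : R).
    rewrite -[X in _ --> X]expR0; apply: (@continuous_cvg _ _ _ _ _ _ expR).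
      exact: continuous_expR.
    rewrite -[X in _ --> X]oppr0; apply: cvgN.
    by rewrite -[X in _ --> X](mul0r (phi s)); apply: cvgMr_tmp.
  have cfd : f n s - del n @[n --> \oo] --> (1 : R).
    by rewrite -[X in _ --> X]subr0; apply: cvgB.
  apply: (@squeeze_cvgr _ _ _ _ (fun n => (s - del n) * (f n s - del n)) (fun n => s + del n)).
  + near=> n; rewrite upper andbT; case: (lower n) => // /ltW; rewrite -subr_le0 leNgt.
    move=> /negP []; near: n; move/cvgr_gt : cfd; apply; exact: ltr01.
  + rewrite -[X in _ --> X]mulr1; apply: cvgM => //.
    by rewrite -[X in _ --> X]subr0; apply: cvgB => //; exact: cvg_cst.
  + by rewrite -[X in _ --> X]addr0; apply: cvgD => //; exact: cvg_cst.
- rewrite -[X in _ --> X]expR0; apply: (@continuous_cvg _ _ _ _ _ _ expR).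
    exact: continuous_expR.
  rewrite -[X in _ --> X]oppr0; apply: cvgN.
  by rewrite -[X in _ --> X](mulr0 beta); apply: cvgMl_tmp.
Unshelve. all: by end_near. Qed.

(** * Laws carried by the open half-line *)

Section laplace_on_pos.
Context {R : realType}.
Let T := measurableTypeR R.
Implicit Types (m p : probability T R) (g : R -> R).

Let mD : measurable (`]0%R, +oo[%classic : set T).
Proof. exact: measurable_itv. Qed.

Let mE : measurable (`[0%R, +oo[%classic : set T).
Proof. exact: measurable_itv. Qed.

Let D_sub_E : `]0%R, +oo[%classic `<=` (`[0%R, +oo[%classic : set R).
Proof. by move=> y /=; rewrite !in_itv/= !andbT; exact: ltW. Qed.

Lemma integral_exp_laplace m l : on_pos m -> 0 <= l ->
  (\int[m]_y (expR (- (y * l)))%:E = laplace m l)%E.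
Proof.
move=> mpos l0; apply: esym; apply: (integral_setT_eq1 mD mpos).
  by apply/measurable_EFinP; exact: measurable_expNM.
by move=> y; rewrite lee_fin expR_ge0.
Qed.

Lemma on_pos_nonneg m : on_pos m -> m `[0%R, +oo[%classic = 1%E.
Proof.
move=> mpos; apply/eqP; rewrite eq_le probability_le1//=.
by rewrite -[leLHS]mpos le_measure// inE.
Qed.

Lemma laplace_at0 m : on_pos m -> laplace m 0 = 1%E.
Proof.
move=> mpos; rewrite /laplace.
transitivity (\int[m]_(y in `]0%R, +oo[) (cst 1%E : T -> \bar R) y)%E.
  by apply: eq_integral => y _; rewrite mulr0 oppr0 expR0.
rewrite integral_cst// mul1e; exact: mpos.
Qed.

Lemma is_laplace_transform_on_pos m g : on_pos m ->
  (forall l, 0 <= l -> laplace m l = (g l)%:E) -> is_laplace_transform g.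
Proof.
move=> mpos mg; apply/is_laplace_transformP; exists m; split.
  exact: on_pos_nonneg.
by move=> l l0; rewrite integral_exp_laplace// mg.
Qed.

(* The mass at 0 is the limit of the Laplace transform at infinity. *)
Lemma on_pos_laplace_vanish m g : m `[0%R, +oo[%classic = 1%E ->
  (forall l, 0 <= l -> (\int[m]_y (expR (- (y * l)))%:E = (g l)%:E)%E) ->
  (forall e, 0 < e -> exists2 l, 0 <= l & g l <= e) -> on_pos m.
Proof.
move=> mE1 mg g_small; pose S0 : set T := [set (0 : R)].
have mS0 : measurable S0 by exact: measurable_set1.
have m0 : m S0 = 0%E.
  apply/eqP; rewrite eq_le measure_ge0 andbT; apply/lee_addgt0Pr => e e0; rewrite add0e.
  have [l l0 gle] := g_small e e0.
  apply: (@le_trans _ _ (g l)%:E); last by rewrite lee_fin.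
  rewrite -mg//.
  have -> : m S0 = (\int[m]_(y in S0) (expR (- (y * l)))%:E)%E.
    rewrite (eq_integral (cst 1%E)) ?integral_cst ?mul1e//.
    by move=> y /set_mem ->; rewrite mul0r oppr0 expR0.
  apply: ge0_subset_integral => //.
  by apply/measurable_EFinP; exact: measurable_expNM.
have EE : `[0%R, +oo[%classic = S0 `|` `]0%R, +oo[%classic.
  by rewrite -(@setU1itv _ _ +oo%O 0 false).
move: mE1; rewrite EE measureU//; last first.
  by apply/seteqP; split => // y [/= ->]; rewrite in_itv/= ltxx.
by move=> h; rewrite /on_pos -[RHS]h -[LHS]add0e; congr (_ + _)%E; exact: esym m0.
Qed.

(** Markov's inequality for [expR (a - y)], which is at least 1 where [y <= a]. *)
Lemma laplace_markov p a : on_pos p ->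
  (p `]-oo, a]%classic <= (expR a)%:E * laplace p 1)%E.
Proof.
move=> ppos; have mI : measurable (`]-oo, a]%classic : set T) by exact: measurable_itv.
rewrite -(measureI_eq1 mI mD ppos) /laplace.
have mexp : measurable_fun (`]0%R, +oo[%classic : set T)
    (fun y : T => (expR (- (y * 1)))%:E).
  by apply/measurable_EFinP; exact: measurable_expNM.
rewrite -ge0_integralZl//.
rewrite -(integral_indic p mD mI).
apply: ge0_le_integral => //.
- by apply/measurable_EFinP; exact: measurable_indic.
- exact: measurable_funeM.
- move=> y _; rewrite -EFinM lee_fin -expRD mulr1 indicE.
  have [/set_mem|_] := boolP (y \in _); last exact: expR_ge0.
  by rewrite /= in_itv/= => ya; rewrite -[leLHS]expR0 ler_expR subr_ge0.
Qed.

Lemma convolution_power_nonneg p n : p `[0%R, +oo[%classic = 1%E ->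
  convolution_power p n `[0%R, +oo[%classic = 1%E.
Proof.
move=> p1; elim: n => [|n IH] /=.
  by rewrite diracE mem_set//= in_itv/= lexx.
have [q qE] := exists_convolution_power p n.
rewrite -/(convolution_power p n) -qE; apply: convolution_eq1 => //.
by rewrite qE.
Qed.

Lemma integral_exp_convolution_power p n l r :
  (\int[p]_y (expR (- (y * l)))%:E = r%:E)%E ->
  (\int[convolution_power p n]_y (expR (- (y * l)))%:E = (r ^+ n)%:E)%E.
Proof.
move=> pr; elim: n => [|n IH].
  rewrite /convolution_power/= integral_dirac//; last first.
    by apply/measurable_EFinP; exact: measurable_expNM.
  by rewrite diracT mul1e mul0r oppr0 expR0 expr0.
have [q qE] := exists_convolution_power p n.
rewrite /= -/(convolution_power p n) -qE integral_exp_convolution pr qE IH.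
by rewrite -EFinM exprS.
Qed.

End laplace_on_pos.

(** Finiteness of [X] comes out of the equation itself, so Laplace transforms of conditional laws
    can be divided without first being shown finite. *)
Lemma mule_EFin_eq (R : realType) (X : \bar R) (c e : R) :
  0 < c -> (X * c%:E = e%:E)%E -> X = (e / c)%:E.
Proof.
move=> c0; case: X => [r| |].
- by move=> [<-]; rewrite mulfK// gt_eqF.
- by rewrite gt0_mulye// lte_fin.
- by rewrite gt0_mulNye// lte_fin.
Qed.

(** * The branching mechanism *)

(** The upper bound is [exp (- x) <= 1 / (1 + x) <= 1 - x + x ^+ 2], the last step because
    [(1 - x + x ^+ 2) * (1 + x) = 1 + x ^+ 3]. It controls the Levy integrand at small jumps. *)
Lemma expRN_bounds {R : realType} (x : R) : 0 <= x ->
  0 <= expR (- x) - 1 + x <= x ^+ 2.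
Proof.
move=> x0; apply/andP; split.
  by have := expR_ge1Dx (- x); lra.
have x10 : 0 < 1 + x by lra.
suff : expR (- x) <= 1 - x + x ^+ 2 by lra.
rewrite expRN; apply: (@le_trans _ _ (1 + x)^-1).
  by rewrite lef_pV2 ?posrE ?expR_gt0// expR_ge1Dx.
rewrite -div1r ler_pdivrMr//.
have -> : (1 - x + x ^+ 2) * (1 + x) = 1 + x ^+ 3 by ring.
by rewrite lerDl exprn_ge0.
Qed.

(** Average of the tangent-line inequality at the barycentre [m]. *)
Lemma expR_convex {R : realType} (t a c : R) : 0 <= t <= 1 ->
  expR (t * a + (1 - t) * c) <= t * expR a + (1 - t) * expR c.
Proof.
move=> /andP[t0 t1]; set m := t * a + (1 - t) * c.
have tangent x : expR m * (1 + (x - m)) <= expR x.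
  by rewrite -[in leRHS](subrK m x) (expRD (x - m)) mulrC ler_pM2r ?expR_gt0// expR_ge1Dx.
have ha := ler_wpM2l t0 (tangent a).
have t1' : 0 <= 1 - t by lra.
have hc := ler_wpM2l t1' (tangent c).
have hm : expR m = t * (expR m * (1 + (a - m))) + (1 - t) * (expR m * (1 + (c - m))).
  by move: (expR m) => E; rewrite /m; ring.
by rewrite hm; lra.
Qed.

Section branching_mechanism_theory.
Context {R : realType}.
Variable b : branching_triple R.
Local Notation T := (measurableTypeR R).
Local Notation D := (`]0%R, +oo[%classic : set T).
Local Notation Psi := (branching_mechanism b).
Local Notation nu := (bt_nu b).

Let mD : measurable D. Proof. exact: measurable_itv. Qed.

Let measurable_expNMl u : measurable_fun D (fun h : T => expR (- (u * h))).
Proof.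
rewrite (_ : (fun h => _) = (fun h : T => expR (- (h * u)))).
  exact: measurable_expNM.
by apply/funext => h; rewrite [u * h]mulrC.
Qed.

Let I (u : R) (h : T) : R := expR (- (u * h)) - 1 + u * h * (h < 1)%R%:R.

Let measurable_I u : measurable_fun D (I u).
Proof.
apply: measurable_funD.
  by apply: measurable_funB; [exact: measurable_expNMl|exact: measurable_cst].
apply: measurable_funM; first exact: measurable_funM.
rewrite (_ : (fun h : T => _) = \1_(`]-oo, 1%R[%classic : set T)); last first.
  by apply/funext => h; rewrite indicE mem_setE in_itv.
exact: measurable_indic.
Qed.

Let integrable_min : nu.-integrable D (fun h => (Num.min 1 (h ^+ 2))%:E).
Proof.
have m0 (h : T) : (0 <= (Num.min 1 (h ^+ 2))%:E)%E.
  by rewrite lee_fin le_min ler01 sqr_ge0.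
apply/integrableP; split.
  apply/measurable_EFinP; apply: measurable_minr; first exact: measurable_cst.
  by apply: (@measurable_funX _ T R D (fun h => h) 2); exact: measurable_id.
under eq_integral do rewrite gee0_abs//.
exact: bt_nu_int.
Qed.

(** Small jumps contribute [(u h) ^+ 2] and large ones at most 1, whence the constant. The resulting
    integrability is what licenses linearity of the real-valued integral everywhere below. *)
Let normr_I_le u (h : T) : 0 <= u -> D h ->
  `|I u h| <= (u ^+ 2 + 1) * Num.min 1 (h ^+ 2).
Proof.
rewrite /= in_itv/= andbT => u0 h0; rewrite /I.
have uh0 : 0 <= u * h by rewrite mulr_ge0// ltW.
have [h1|h1] := ltP h 1.
  have /andP[e0 e1] := expRN_bounds uh0.
  rewrite mulr1 ger0_norm// (le_trans e1)// min_r.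
    by rewrite exprMn mulrDl mul1r lerDl sqr_ge0.
  by rewrite expr_le1// ltW.
rewrite mulr0 addr0 min_l; last by rewrite exprn_ege1.
rewrite mulr1 ler0_norm.
  have := expR_ge0 (- (u * h)); have := sqr_ge0 u; lra.
by rewrite subr_le0 -[leRHS]expR0 ler_expR oppr_le0.
Qed.

Let integrable_I u : 0 <= u -> nu.-integrable D (EFin \o I u).
Proof.
move=> u0.
apply: (@le_integrable _ _ _ nu D mD _
  (fun h => (u ^+ 2 + 1)%:E * (Num.min 1 (h ^+ 2))%:E)%E).
- by apply/measurable_EFinP; exact: measurable_I.
- move=> h Dh; rewrite -EFinM /= lee_fin (le_trans (normr_I_le u0 Dh))//.
  exact: ler_norm.
- exact: integrableZl.
Qed.

Let PsiE u : Psi u = bt_drift b * u + bt_sigma b ^+ 2 / 2 * u ^+ 2 +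
  \int[nu]_(h in D) I u h.
Proof. by []. Qed.

Lemma branching_mechanism0 : Psi 0 = 0.
Proof.
rewrite PsiE expr0n/= !mulr0 !add0r.
rewrite (@eq_Rintegral _ _ _ _ _ (fun=> 0)); first by rewrite Rintegral_cst// mul0r.
by move=> h _; rewrite /I !mul0r oppr0 expR0 subrr add0r.
Qed.

Lemma branching_mechanism_convex u v t : 0 <= u -> 0 <= v -> 0 <= t <= 1 ->
  Psi (t * u + (1 - t) * v) <= t * Psi u + (1 - t) * Psi v.
Proof.
move=> u0 v0 /[dup] t01 /andP[t0 t1].
have t1' : 0 <= 1 - t by rewrite subr_ge0.
have w0 : 0 <= t * u + (1 - t) * v by rewrite addr_ge0 ?mulr_ge0.
have : \int[nu]_(h in D) I (t * u + (1 - t) * v) h <=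
    t * (\int[nu]_(h in D) I u h) + (1 - t) * \int[nu]_(h in D) I v h.
  rewrite -(RintegralZl t mD (integrable_I u0)) -(RintegralZl (1 - t) mD (integrable_I v0)).
  have iu := integrableZl mD t (integrable_I u0).
  have iv := integrableZl mD (1 - t) (integrable_I v0).
  rewrite -(RintegralD mD iu iv).
  apply: (le_Rintegral mD (integrable_I w0) (integrableD mD iu iv)) => h _.
  rewrite /I; have := expR_convex (- (u * h)) (- (v * h)) t01.
  rewrite (_ : t * - (u * h) + (1 - t) * - (v * h) = - ((t * u + (1 - t) * v) * h)); last by ring.
  move: (expR _) (expR _) (expR _) (_%:R) => *; lra.
have : (t * u + (1 - t) * v) ^+ 2 <= t * u ^+ 2 + (1 - t) * v ^+ 2.
  by have := mulr_ge0 (mulr_ge0 t0 t1') (sqr_ge0 (u - v)); lra.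
have : 0 <= bt_sigma b ^+ 2 / 2 by rewrite divr_ge0// sqr_ge0.
rewrite !PsiE; move: (bt_sigma b ^+ 2 / 2) ((t * u + (1 - t) * v) ^+ 2) => s q s0 q1.
have := ler_wpM2l s0 q1; lra.
Qed.

(* The combination [Psi (2 v) - 2 Psi v] cancels the drift and the compensator. *)
Lemma branching_mechanism_double v : 0 <= v ->
  Psi (2 * v) - 2 * Psi v = (bt_sigma b * v) ^+ 2 +
    \int[nu]_(h in D) (1 - expR (- (v * h))) ^+ 2.
Proof.
move=> v0; have v20 : 0 <= 2 * v by rewrite mulr_ge0.
have -> : \int[nu]_(h in D) (1 - expR (- (v * h))) ^+ 2 =
    \int[nu]_(h in D) (I (2 * v) h - 2 * I v h).
  apply: eq_Rintegral => h _; rewrite /I.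
  rewrite (_ : - (2 * v * h) = - (v * h) + - (v * h)); last by ring.
  by rewrite expRD; ring.
rewrite (RintegralB mD (integrable_I v20) (integrableZl mD 2 (integrable_I v0))).
by rewrite (RintegralZl 2 mD (integrable_I v0)) !PsiE; field.
Qed.

(** [Psi (2 n) - 2 * Psi n] tends to [L - 2 * L = - L]. On the other side of
    [branching_mechanism_double] boundedness kills [sigma], and monotone convergence turns the
    integral of [(1 - exp (- n h)) ^+ 2] into the mass of [nu]. *)
Lemma bt_nu_eq_limit (L : R) : Psi v @[v --> +oo] --> L -> nu D = (- L)%:E.
Proof.
move=> PsiL.
have PsiLn : Psi n%:R @[n --> \oo] --> L.
  exact: (cvg_comp _ _ (@cvgr_idn R) PsiL).
have PsiL2n : Psi (2 * n%:R) @[n --> \oo] --> L.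
  have c2 : (2 * n%:R : R) @[n --> \oo] --> +oo.
    apply/cvgryPge => A; near=> n; rewrite (@le_trans _ _ n%:R)//; last first.
      by rewrite ler_peMl// ler1n.
    by near: n; exact: nbhs_infty_ger.
  exact: (cvg_comp _ _ c2 PsiL).
have diffL : Psi (2 * n%:R) - 2 * Psi n%:R @[n --> \oo] --> - L.
  rewrite (_ : - L = L - 2 * L); last by ring.
  by apply: cvgB => //; exact: cvgMl_tmp.
have int_ge0 n : 0 <= \int[nu]_(h in D) (1 - expR (- (n%:R * h))) ^+ 2.
  by apply: Rintegral_ge0 => h _; exact: sqr_ge0.
(* Eventually [sigma ^+ 2 * n <= (sigma * n) ^+ 2 <= - L + 1]; dividing by [n] gives [sigma = 0]. *)
have sigma0 : bt_sigma b = 0.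
  apply/eqP; rewrite -sqrf_eq0 eq_le sqr_ge0 andbT.
  have : (- L + 1) / n.+1%:R @[n --> \oo] --> (0 : R).
    by rewrite -[X in _ --> X](mulr0 (- L + 1)); apply: cvgMl_tmp; exact: cvg_harmonic.
  move=> c0; apply: (cvgr_to_ge c0).
  have /cvgr_lt/(_ (- L + 1)) := diffL; rewrite ltrDl ltr01 => /(_ isT)[N _ NP].
  near=> n.
  rewrite ler_pdivlMr//.
  have : Psi (2 * n.+1%:R) - 2 * Psi n.+1%:R < - L + 1.
    by apply: NP; rewrite /= leqW//; near: n; exact: nbhs_infty_ge.
  rewrite branching_mechanism_double//; have := int_ge0 n.+1.
  have : bt_sigma b ^+ 2 * n.+1%:R <= (bt_sigma b * n.+1%:R) ^+ 2.
    rewrite exprMn ler_wpM2l ?sqr_ge0//.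
    by rewrite expr2 ler_peMr// ler1n.
  lra.
have int_cvg : (\int[nu]_(h in D) ((1 - expR (- (n%:R * h))) ^+ 2)%:E)%E @[n --> \oo] --> (- L)%:E.
  have : (Psi (2 * n%:R) - 2 * Psi n%:R)%:E @[n --> \oo] --> (- L)%:E.
    by apply: cvg_EFin; [exact: nearW|exact: diffL].
  apply: cvg_trans; apply: near_eq_cvg; apply: nearW => n.
  rewrite branching_mechanism_double// sigma0 mul0r expr0n/= add0r /Rintegral fineK//.
  apply: integrable_fin_num => //.
  have n20 : 0 <= 2 * n%:R :> R by rewrite mulr_ge0.
  apply: (eq_integrable mD (EFin \o (fun h => I (2 * n%:R) h - 2 * I n%:R h))).
    move=> h _ /=; rewrite /I; congr EFin.
    rewrite (_ : - (2 * n%:R * h) = - (n%:R * h) + - (n%:R * h)); last by ring.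
    by rewrite expRD; ring.
  exact: (integrableB mD (integrable_I n20) (integrableZl mD 2 (integrable_I (ler0n R n)))).
have nu_cvg : (\int[nu]_(h in D) ((1 - expR (- (n%:R * h))) ^+ 2)%:E)%E @[n --> \oo] --> nu D.
  rewrite (_ : nu D = \int[nu]_(h in D) (cst 1 h))%E; last by rewrite integral_cst// mul1e.
  rewrite (eq_integral (fun h : T => limn (fun n => ((1 - expR (- (n%:R * h))) ^+ 2)%:E))); last first.
    move=> h /set_mem; rewrite /= in_itv/= andbT => h0; apply/esym/cvg_lim => //.
    have h1 : 1 - expR (- (n%:R * h)) @[n --> \oo] --> (1 : R).
      rewrite -[X in _ --> X]subr0; apply: cvgB; first exact: cvg_cst.
      apply/cvgrPdist_le => e e0; have [M eM] := exists_expRN_le h0 e0.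
      near=> n; rewrite sub0r normrN ger0_norm ?expR_ge0// (le_trans _ eM)//.
      rewrite ler_expR lerN2 ler_pM2r// ler_nat; near: n; exact: nbhs_infty_ge.
    have h2 : (1 - expR (- (n%:R * h))) ^+ 2 @[n --> \oo] --> (1 : R).
      rewrite -[X in _ --> X]mulr1; under eq_cvg do rewrite expr2.
      exact: cvgM.
    by apply: cvg_EFin; [exact: nearW|exact: h2].
  apply: cvg_monotone_convergence => //.
  - move=> n; apply/measurable_EFinP; apply: measurable_funX.
    by apply: measurable_funB; [exact: measurable_cst|exact: measurable_expNMl].
  - by move=> n h _; rewrite lee_fin sqr_ge0.
  - move=> h; rewrite /= in_itv/= andbT => h0 n k nk.
    rewrite lee_fin lerXn2r ?nnegrE ?subr_ge0//.
    + by rewrite -[leRHS]expR0 ler_expR oppr_le0 mulr_ge0// ltW.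
    + by rewrite -[leRHS]expR0 ler_expR oppr_le0 mulr_ge0// ltW.
    + by rewrite lerB// ler_expR lerN2 ler_pM2r// ler_nat.
exact: cvg_unique nu_cvg int_cvg.
Unshelve. all: by end_near. Qed.

End branching_mechanism_theory.

(** * Convex functions that vanish at 0 and are negative afterwards *)

Section negative_convex.
Context {R : realType}.
Variable Psi : R -> R.
Hypothesis Psi00 : Psi 0 = 0.
Hypothesis Psi_convex : forall a c t, 0 <= a -> 0 <= c -> 0 <= t <= 1 ->
  Psi (t * a + (1 - t) * c) <= t * Psi a + (1 - t) * Psi c.

(** Convexity on [[0, w]] with [Psi 0 = 0]: the slope [Psi v / v] is nondecreasing, written without
    division. *)
Lemma convex_star v w : 0 < v -> v <= w -> w * Psi v <= v * Psi w.
Proof.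
move=> v0 vw; have w0 : 0 < w by exact: lt_le_trans vw.
have t01 : 0 <= v / w <= 1 by rewrite (divr_ge0 (ltW v0) (ltW w0))/= ler_pdivrMr// mul1r.
have := Psi_convex (ltW w0) (lexx 0) t01.
rewrite mulr0 addr0 Psi00 mulr0 addr0 divfK ?gt_eqF// => h.
by rewrite -(ler_pM2l (x := w^-1)) ?invr_gt0// mulKf ?gt_eqF// mulrA [_^-1 * _]mulrC.
Qed.

Hypothesis Psi_neg : forall v, 0 < v -> Psi v < 0.

Lemma negative_convex_nonincreasing v w : 0 <= v -> v <= w -> Psi w <= Psi v.
Proof.
rewrite le_eqVlt => /predU1P[<-|v0].
  by rewrite le_eqVlt => /predU1P[<-//|w0]; rewrite Psi00 ltW ?Psi_neg.
rewrite le_eqVlt => /predU1P[->//|vw]; rewrite leNgt; apply/negP => Pvw.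
have w0 : 0 < w by exact: lt_trans vw.
have Pw := Psi_neg w0.
pose c := w + (w - v) * (- Psi w) / (Psi w - Psi v).
have dP : 0 < Psi w - Psi v by rewrite subr_gt0.
have dv : 0 < w - v by rewrite subr_gt0.
have cw : 0 < c - w.
  by rewrite /c addrAC subrr add0r divr_gt0// mulr_gt0// oppr_gt0.
have c0 : 0 < c by lra.
have cv : 0 < c - v by lra.
pose t := (c - w) / (c - v).
have t01 : 0 <= t <= 1.
  by rewrite /t (divr_ge0 (ltW cw) (ltW cv))/= ler_pdivrMr// mul1r; lra.
have := Psi_convex (ltW v0) (ltW c0) t01.
have -> : t * v + (1 - t) * c = w by rewrite /t; field; rewrite gt_eqF.
rewrite -(ler_pM2r cv).
have -> : (t * Psi v + (1 - t) * Psi c) * (c - v) = (c - w) * Psi v + (w - v) * Psi c.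
  by rewrite /t; field; rewrite gt_eqF.
have h : (c - w) * (Psi w - Psi v) = (w - v) * (- Psi w).
  by rewrite /c addrAC subrr add0r divfK// gt_eqF.
have := Psi_neg c0; nra.
Qed.

Lemma negative_convex_continuous v : 0 < v -> {for v, continuous Psi}.
Proof.
move=> v0; apply/cvgrPdist_le => e e0.
have v20 : 0 < v / 2 by rewrite divr_gt0.
(* A Lipschitz constant near [v]: [convex_star] gives [a * (Psi a - Psi c) <= (c - a) * - Psi a],
   where [- Psi a <= - Psi (2 * v)] and [a >= v / 2]. *)
pose C := - Psi (2 * v) / (v / 2).
have C0 : 0 < C.
  by rewrite divr_gt0// oppr_gt0 Psi_neg// mulr_gt0.
have lip a c : v / 2 <= a -> a <= c -> a <= 2 * v -> Psi a - Psi c <= C * (c - a).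
  move=> va ac a2; have a0 : 0 < a by exact: lt_le_trans va.
  have := convex_star a0 ac.
  have Pa := negative_convex_nonincreasing (ltW a0) a2.
  have CE : C * (v / 2) = - Psi (2 * v) by rewrite /C divfK// gt_eqF.
  move=> h; rewrite -(ler_pM2l a0).
  have : a * (C * (c - a)) >= (- Psi (2 * v)) * (c - a).
    rewrite mulrA -CE ler_wpM2r ?subr_ge0// mulrC.
    by apply: ler_wpM2r va; exact: ltW.
  nra.
have d0 : 0 < e / C by rewrite divr_gt0.
near=> w.
have [w1 w2] : v / 2 <= w /\ w <= 2 * v.
  have : `|v - w| < v / 2 by near: w; exact: cvgr_dist_lt.
  by rewrite ltr_norml => /andP[? ?]; split; lra.
have wd : `|v - w| <= e / C by near: w; exact: cvgr_dist_le.
have w0 : 0 < w by exact: lt_le_trans w1.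
have Ce : C * `|v - w| <= e by rewrite mulrC -ler_pdivlMr.
apply: le_trans Ce; have [vw|wv] := leP v w.
  rewrite ger0_norm; last by rewrite subr_ge0 negative_convex_nonincreasing// ltW.
  rewrite distrC ger0_norm ?subr_ge0//; apply: lip => //; lra.
rewrite distrC ger0_norm; last by rewrite subr_ge0 negative_convex_nonincreasing// ltW.
by rewrite ger0_norm ?subr_ge0 ?(ltW wv)//; apply: lip => //; exact: ltW.
Unshelve. all: by end_near. Qed.

Lemma negative_convex_cvg : exists L : \bar R,
  [/\ (Psi v)%:E @[v --> +oo] --> L, (L < 0)%E &
      forall v, 0 <= v -> (L <= (Psi v)%:E)%E].
Proof.
(* [Psi] is monotone on [[0, oo)] only; freezing it at 0 on the left gives a function monotone on
   the whole line. *)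
pose f v := (Psi (Num.max 0 v))%:E.
have fE v : 0 <= v -> f v = (Psi v)%:E by move=> v0; rewrite /f max_r.
have f_ni : nonincreasing_fun f.
  move=> v w vw; rewrite lee_fin; apply: negative_convex_nonincreasing.
    by rewrite le_max lexx.
  by rewrite ge_max !le_max lexx/= vw orbT.
have L_le v : 0 <= v -> (ereal_inf (range f) <= (Psi v)%:E)%E.
  by move=> v0; rewrite -fE//; apply: ereal_inf_lbound; exists v.
exists (ereal_inf (range f)); split => //; last first.
  by apply: le_lt_trans (L_le 1 ler01) _; rewrite lte_fin Psi_neg.
apply: cvg_trans (nonincreasing_cvge f_ni).
apply: near_eq_cvg; near=> v; rewrite fE//; near: v; exact: nbhs_pinfty_ge.
Unshelve. all: by end_near. Qed.

End negative_convex.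

(** * The cumulant flow *)

Section csbp_flow.
Context {R : realType}.
Variables (Psi : R -> R) (u : R -> R -> R) (phi : R -> R).
Hypothesis Psi00 : Psi 0 = 0.
Hypothesis Psi_convex : forall a c t, 0 <= a -> 0 <= c -> 0 <= t <= 1 ->
  Psi (t * a + (1 - t) * c) <= t * Psi a + (1 - t) * Psi c.
Hypothesis flow : cumulant_flow Psi u.
Hypothesis flow_le : forall t l l', 0 <= t -> 0 < l -> l <= l' -> u t l <= u t l'.
Hypothesis phi_cvg : forall t, 0 <= t -> u t n.+1%:R^-1 @[n --> \oo] --> phi t.
Hypothesis phi_unbounded : forall A, exists2 t, 0 <= t & A <= phi t.

Local Notation mu := (@lebesgue_measure R).

Let phi_le_flow t l : 0 <= t -> 0 < l -> phi t <= u t l.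
Proof.
move=> t0 l0; apply: (cvgr_to_le (phi_cvg t0)); near=> n.
apply: flow_le => //.
rewrite -[leRHS]invrK lef_pV2 ?posrE ?invr_gt0//.
apply: (@le_trans _ _ n%:R); last by rewrite ler_nat.
by near: n; exact: nbhs_infty_ger.
Unshelve. all: by end_near. Qed.

Let flow_cont l t : 0 < l -> 0 <= t ->
  {within `[0, t], continuous (u ^~ l)}.
Proof.
move=> l0 t0; have [_ _ c _] := flow l0.
by apply: continuous_subspaceW c; apply: subset_itvl.
Qed.

Let flow_MVT l s t : 0 < l -> 0 <= s -> s < t ->
  exists2 r, s < r < t & u t l - u s l = - Psi (u r l) * (t - s).
Proof.
move=> l0 s0 st; have [_ _ _ du] := flow l0.
have [||r] := @MVT R (u ^~ l) (fun r => - Psi (u r l)) s t st.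
- by move=> r; rewrite in_itv/= => /andP[sr _]; apply: du; exact: le_lt_trans sr.
- have t0 : 0 <= t by rewrite (le_trans s0)// ltW.
  apply: continuous_subspaceW (flow_cont l0 t0).
  by move=> x /=; rewrite !in_itv/= => /andP[sx ->]; rewrite (le_trans s0).
- by rewrite in_itv/= => srt ->; exists r.
Qed.

(* If [Psi v0 >= 0] then [Psi >= 0] on [[v0, +oo)] by convexity, so that the
   solution started from [v0] cannot exceed [v0]. *)
Lemma flow_negative v0 : 0 < v0 -> Psi v0 < 0.
Proof.
move=> v00; rewrite ltNge; apply/negP => Pv0.
have Psi_ge0 v : v0 <= v -> 0 <= Psi v.
  move=> v0v; have := convex_star Psi00 Psi_convex v00 v0v.
  have : 0 <= v * Psi v0 by rewrite mulr_ge0// (le_trans (ltW v00)).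
  by move=> /le_trans h /h; rewrite pmulr_rge0.
have [u0 _ ucont _] := flow v00.
have [t t0 vt] := phi_unbounded (v0 + 1).
have ut : v0 < u t v0 by have := phi_le_flow t0 v00; lra.
(* Its supremum [s] is the last time before [t] at which the solution is at most [v0]. After [s] it
   stays where [Psi >= 0], so the mean value theorem on [[s, t]] forbids the rise to
   [u t v0 > v0]. *)
pose S := [set s : R | 0 <= s <= t /\ u s v0 <= v0].
have S0 : S 0 by rewrite /S/= lexx t0 u0 lexx.
have hS : has_sup S by split; [exists 0|exists t => s [/andP[]]].
pose s := sup S.
have s0 : 0 <= s by apply: ub_le_sup => //; case: hS.
have st : s <= t by apply: ge_sup; [exists 0|move=> r [/andP[]]].
have us : u s v0 <= v0.
  rewrite leNgt; apply/negP => us.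
  have cs : u r v0 @[r --> within `[0, +oo[ (nbhs s)] --> u s v0.
    by move/subspace_continuousP : ucont; apply; rewrite /= in_itv/= s0.
  have := cvgr_gt _ cs _ us; rewrite near_withinE => -[e /= e0 eP].
  have [r Sr sr] := sup_adherent e0 hS.
  have [/andP[r0 _]] := Sr; rewrite leNgt => /negP; apply; apply: eP.
    rewrite /ball/= ger0_norm ?subr_ge0; last by apply: ub_le_sup => //; case: hS.
    by rewrite ltrBlDr -ltrBlDl addrC; move: sr; rewrite -/s; lra.
  by rewrite /= in_itv/= r0.
have st' : s < t.
  by rewrite lt_neqAle st andbT; apply: contraTneq ut => <-; rewrite -leNgt.
have [r /andP[sr rt]] := flow_MVT v00 s0 st'.
have r_v0 : v0 < u r v0.
  rewrite ltNge; apply/negP => ur.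
  have Sr : S r by split => //; rewrite (ltW rt) andbT (le_trans s0)// ltW.
  have : r <= s by apply: ub_le_sup => //; case: hS.
  by rewrite leNgt sr.
have := Psi_ge0 _ (ltW r_v0); have : 0 < t - s by rewrite subr_gt0.
nra.
Qed.

Let Psi_ni v w : 0 <= v -> v <= w -> Psi w <= Psi v.
Proof. exact: negative_convex_nonincreasing Psi00 Psi_convex flow_negative v w. Qed.

Let Psi_cont v : 0 < v -> {for v, continuous Psi}.
Proof. exact: negative_convex_continuous Psi00 Psi_convex flow_negative v. Qed.

Let Psi_le0 v : 0 <= v -> Psi v <= 0.
Proof.
by rewrite le_eqVlt => /predU1P[<-|/flow_negative/ltW//]; rewrite Psi00.
Qed.

Lemma flow_ge l t : 0 < l -> 0 <= t -> l <= u t l.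
Proof.
move=> l0; have [u0 upos _ _] := flow l0.
rewrite le_eqVlt => /predU1P[<-|t0]; first by rewrite u0.
have [r /andP[r0 _]] := flow_MVT l0 (lexx 0) t0; rewrite u0 subr0.
have : 0 <= - Psi (u r l) * t.
  apply: mulr_ge0; last exact: ltW.
  by rewrite oppr_ge0; apply: Psi_le0; apply: upos; exact: ltW.
lra.
Qed.

(** The integrand of [Phi]. As [Psi 0 = 0], the convention for inverses gives [q 0 = 0]:
    nonnegativity holds at 0, but monotonicity and continuity are only claimed to its right. *)
Let q v := - (Psi v)^-1.

Let q_ge0 v : 0 <= v -> 0 <= q v.
Proof. by move=> v0; rewrite oppr_ge0 invr_le0 Psi_le0. Qed.

Let q_ni v w : 0 < v -> v <= w -> q w <= q v.
Proof.
move=> v0 vw; have w0 := lt_le_trans v0 vw.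
by rewrite lerN2 lef_nV2 ?negrE ?flow_negative// Psi_ni// ltW.
Qed.

Let q_cont v : 0 < v -> {for v, continuous q}.
Proof.
move=> v0; apply: continuousN; apply: cvgV; last exact: Psi_cont.
by rewrite lt_eqF// flow_negative.
Qed.

Let q_integrable_pos a v : 0 < a -> mu.-integrable `[a, v] (EFin \o q).
Proof.
move=> a0; apply: continuous_compact_integrable; first exact: segment_compact.
apply: continuous_in_subspaceT => x; rewrite inE/= in_itv/= => /andP[ax _].
by apply: q_cont; exact: lt_le_trans ax.
Qed.

Let Q a v := \int[mu]_(x in `[a, v]) q x.

Let Q_add a v w : mu.-integrable `[a, w] (EFin \o q) -> a <= v -> v <= w ->
  Q a w = Q a v + Q v w.
Proof.
move=> ia av vw; rewrite /Q.
have := @Rintegral_itvB R q (BLeft a) (BRight w) v ia.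
rewrite !bnd_simp => /(_ av vw) h; apply/eqP; rewrite addrC -subr_eq; apply/eqP.
rewrite h; apply: Rintegral_itv_obnd_cbnd.
apply: integrableS ia => //; apply: subset_itvr; by rewrite bnd_simp.
Qed.

(** Separation of variables: [s |-> Q (l / 2) (u s l)] has derivative
    [q (u s l) * - Psi (u s l) = 1]. *)
Let Q_flow l t : 0 < l -> 0 <= t -> Q l (u t l) = t.
Proof.
move=> l0 t0; have [u0 upos ucont du] := flow l0.
(* Starting the integral at [l / 2] keeps every value [u s l >= l] strictly inside the domain, as
   differentiation of the integral requires even at [s = 0]. *)
have l20 : 0 < l / 2 by rewrite divr_gt0.
have u_gt s : 0 <= s -> l / 2 < u s l by move=> s0; have := flow_ge l0 s0; lra.
have QD s : 0 <= s -> is_derive (u s l) 1 (Q (l / 2)) (q (u s l)).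
  move=> s0.
  have us : u s l < u s l + 1 by rewrite ltrDl.
  have cq : {for u s l, continuous q} by apply: q_cont; exact: lt_trans (u_gt _ s0).
  have [dQ QE] := continuous_FTC1_closed us (q_integrable_pos _ l20) (u_gt _ s0) cq.
  by apply: DeriveDef => //; rewrite -derive1E.
have [||r _] := @MVT_segment R (fun s => Q (l / 2) (u s l)) (fun=> 1) 0 t t0.
- move=> s; rewrite in_itv/= => /andP[s0 _].
  have dus := du _ s0; have dQ := QD _ (ltW s0).
  have := @is_derive1_comp R (Q (l / 2)) (u ^~ l) s _ _ dQ dus.
  have -> : q (u s l) * - Psi (u s l) = 1.
    rewrite /q mulrNN mulVf// lt_eqF// flow_negative//.
    exact: lt_trans (u_gt _ (ltW s0)).
  by [].
- apply/subspace_continuousP => s; rewrite /= in_itv/= => /andP[s0 st].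
  apply: (@cvg_comp _ _ _ (u ^~ l) (Q (l / 2)) _ (nbhs (u s l))).
    move/subspace_continuousP : (flow_cont l0 t0); apply.
    by rewrite /= in_itv/= s0.
  have [dQ _] := QD _ s0.
  suff : {for u s l, continuous (Q (l / 2))} by [].
  by apply: differentiable_continuous; apply/derivable1_diffP.
- rewrite mul1r subr0 u0 => h; rewrite -[RHS]h.
  have l2l : l / 2 <= l by lra.
  have -> := Q_add (q_integrable_pos (u t l) l20) l2l (flow_ge l0 t0).
  by rewrite addrAC subrr add0r.
Qed.

Let Q_le v w : 0 < v -> v <= w -> Q v w <= (w - v) * q v.
Proof.
move=> v0 vw.
have -> : (w - v) * q v = \int[mu]_(x in `[v, w]) q v.
  rewrite Rintegral_cst//= lebesgue_measure_itv/= lte_fin.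
  by case: ltgtP vw => // [_|->] _; rewrite ?subrr ?mul0r ?mulr0// mulrC.
apply: le_Rintegral => //; first exact: q_integrable_pos.
- apply: continuous_compact_integrable; first exact: segment_compact.
  by apply: continuous_subspaceT => x; exact: cvg_cst.
- by move=> x; rewrite /= in_itv/= => /andP[vx _]; exact: q_ni.
Qed.

Let Q_ge v w : 0 < v -> v <= w -> (w - v) * q w <= Q v w.
Proof.
move=> v0 vw.
have -> : (w - v) * q w = \int[mu]_(x in `[v, w]) q w.
  rewrite Rintegral_cst//= lebesgue_measure_itv/= lte_fin.
  by case: ltgtP vw => // [_|->] _; rewrite ?subrr ?mul0r ?mulr0// mulrC.
apply: le_Rintegral => //; last 2 first.
- exact: q_integrable_pos.
- move=> x; rewrite /= in_itv/= => /andP[vx xw].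
  by apply: q_ni => //; exact: lt_le_trans vx.
- apply: continuous_compact_integrable; first exact: segment_compact.
  by apply: continuous_subspaceT => x; exact: cvg_cst.
Qed.

Let q_measurable (v : R) : measurable_fun (`[0, v]%classic : set R) q.
Proof.
apply/measurable_fun_itv_obnd_cbndP.
have sub : (`]0, v]%classic : set R) `<=` `]0, +oo[ by exact: subset_itvl.
apply: (measurable_funS _ sub) => //.
apply: open_continuous_measurable_fun; first exact: interval_open.
by move=> x; rewrite inE/= in_itv/= andbT; exact: q_cont.
Qed.

(** The analytic form of explosion. If [v <= phi t], then [v <= u t l] for each [l = 1 / n.+1], so
    the integral over [[l, v]] is at most [Q l (u t l) = t]; monotone convergence lets [l] tend to
    0. *)
Let q_integrable v : mu.-integrable `[0, v] (EFin \o q).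
Proof.
have q0 x : `[0, v]%classic x -> (0 <= (q x)%:E)%E.
  by rewrite /= in_itv/= lee_fin => /andP[x0 _]; exact: q_ge0.
apply/integrableP; split; first by apply/measurable_EFinP; exact: q_measurable.
suff : (\int[mu]_(x in `[0%R, v]) (q x)%:E < +oo)%E.
  apply: le_lt_trans; rewrite le_eqVlt; apply/orP; left; apply/eqP.
  by apply: eq_integral => x /set_mem /q0 qx /=; rewrite ger0_norm.
have [t t0 vt] := phi_unbounded v.
apply: (@le_lt_trans _ _ t%:E); last exact: ltry.
rewrite -integral_itv_obnd_cbnd; last first.
  by apply/measurable_EFinP/measurable_fun_itv_obnd_cbndP; exact: q_measurable.
pose F n : set R := `[n.+1%:R^-1, v]%classic.
have FE : `]0, v]%classic = \bigcup_n F n.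
  apply/seteqP; split => x /=; rewrite in_itv/=.
    move=> /andP[x0 xv]; exists (Num.trunc x^-1) => //; rewrite /F /= in_itv/= xv andbT.
    by rewrite -[leRHS]invrK lef_pV2 ?posrE ?invr_gt0// ltW// truncnS_gt.
  move=> [n _]; rewrite /F/= in_itv/= => /andP[nx ->]; rewrite andbT.
  by apply: lt_le_trans nx; rewrite invr_gt0.
have F0v n : F n `<=` `[0, v]%classic.
  by apply: subset_itvr; rewrite bnd_simp invr_ge0.
rewrite FE.
have cvgF : (\int[mu]_(x in F n) (q x)%:E)%E @[n --> \oo] -->
    (\int[mu]_(x in \bigcup_n F n) (q x)%:E)%E.
  apply: (@ge0_nondecreasing_set_cvg_integral _ (measurableTypeR R) R F (EFin \o q) mu).
  - move=> m n mn; apply/subsetPset; apply: subset_itvr.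
    by rewrite bnd_simp lef_pV2 ?posrE// ler_nat.
  - by move=> n; exact: measurable_itv.
  - by move=> n; apply/measurable_EFinP; apply: (measurable_funS _ (F0v n)).
  - by move=> n x /F0v; exact: q0.
apply: (cvge_to_le cvgF); apply: nearW => n.
have n0 : 0 < n.+1%:R^-1 :> R by rewrite invr_gt0.
have vu : v <= u t n.+1%:R^-1 by apply: le_trans vt (phi_le_flow t0 n0).
rewrite -[in leRHS](Q_flow n0 t0) /Q /Rintegral fineK; last first.
  by apply: integrable_fin_num => //; exact: q_integrable_pos.
apply: ge0_subset_integral => //; first exact: measurable_itv.
- have sub : (`[n.+1%:R^-1, u t n.+1%:R^-1]%classic : set R) `<=` `[0, u t n.+1%:R^-1].
    by apply: subset_itvr; rewrite bnd_simp ltW.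
  by apply/measurable_EFinP; apply: (measurable_funS _ sub).
- move=> x; rewrite /= in_itv/= => /andP[nx _]; rewrite lee_fin q_ge0//.
  exact: le_trans (ltW n0) nx.
- by apply: subset_itvl; rewrite bnd_simp.
Qed.

Let PhiE l : Phi Psi l = Q 0 l.
Proof.
rewrite /Phi /Q.
have -> : \int[mu]_(x in `[0, l]) (Psi x)^-1 = \int[mu]_(x in `[0, l]) (- 1 * q x).
  by apply: eq_Rintegral => x _; rewrite /q mulN1r opprK.
by rewrite RintegralZl// mulN1r opprK.
Qed.

Let Phi_add v w : 0 <= v -> v <= w -> Phi Psi w = Phi Psi v + Q v w.
Proof. by move=> v0 vw; rewrite !PhiE; apply: Q_add. Qed.

Lemma Phi0 : Phi Psi 0 = 0.
Proof. by rewrite PhiE /Q set_itv1 Rintegral_set1. Qed.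

Lemma Phi_ge0 l : 0 <= Phi Psi l.
Proof.
rewrite PhiE; apply: Rintegral_ge0 => x.
by rewrite /= in_itv/= => /andP[x0 _]; exact: q_ge0.
Qed.

Lemma Phi_increment_ge v w : 0 < v -> v <= w ->
  (w - v) / (- Psi w) <= Phi Psi w - Phi Psi v.
Proof.
move=> v0 vw; rewrite (Phi_add (ltW v0) vw) addrAC subrr add0r.
by rewrite invrN; exact: Q_ge.
Qed.

Lemma Phi_increment_le v w : 0 < v -> v <= w ->
  Phi Psi w - Phi Psi v <= (w - v) / (- Psi v).
Proof.
move=> v0 vw; rewrite (Phi_add (ltW v0) vw) addrAC subrr add0r.
by rewrite invrN; exact: Q_le.
Qed.

Lemma Phi_lt v w : 0 <= v -> v < w -> Phi Psi v < Phi Psi w.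
Proof.
have pos a c : 0 < a -> a < c -> Phi Psi a < Phi Psi c.
  move=> a0 ac; rewrite -subr_gt0; apply: lt_le_trans (Phi_increment_ge a0 (ltW ac)).
  by rewrite divr_gt0 ?subr_gt0// oppr_gt0 flow_negative// (lt_trans a0).
rewrite le_eqVlt => /predU1P[<- w0|]; last exact: pos.
rewrite Phi0; apply: le_lt_trans (Phi_ge0 (w / 2)) _; apply: pos; lra.
Qed.

Lemma Phi_cvg0 : Phi Psi l @[l --> 0^'+] --> (0 : R).
Proof.
have := parameterized_integral_cvg_left ltr01 (q_integrable 1).
move=> /cvg_at_right_filter; apply: cvg_trans; apply: near_eq_cvg.
by apply: nearW => l; rewrite PhiE.
Qed.

Lemma Phi_flow l t : 0 < l -> 0 <= t -> Phi Psi (u t l) = Phi Psi l + t.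
Proof.
by move=> l0 t0; rewrite (@Phi_add l) ?flow_ge ?Q_flow// ltW.
Qed.

Lemma phi_ge0 t : 0 <= t -> 0 <= phi t.
Proof.
move=> t0; apply: (cvgr_to_ge (phi_cvg t0)); apply: nearW => n.
have n0 : 0 < n.+1%:R^-1 :> R by rewrite invr_gt0.
by apply: le_trans (flow_ge n0 t0); exact: ltW.
Qed.

(** Passage to the limit [l = 1 / n.+1] in [Phi (u t l) = Phi l + t]. *)
Lemma Phi_phi t : 0 <= t -> Phi Psi (phi t) = t.
Proof.
move=> t0.
have n0 n : 0 < n.+1%:R^-1 :> R by rewrite invr_gt0.
have seq0 (x : nat -> R) : (forall n, 0 < x n) -> x n @[n --> \oo] --> (0 : R) ->
    Phi Psi (x n) @[n --> \oo] --> (0 : R).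
  move=> x0 xc; apply: (cvg_comp _ _ _ Phi_cvg0).
  move=> V; rewrite /at_right /within /= => -[e /= e0 eV].
  move/cvgrPdist_lt : xc => /(_ _ e0); apply: filterS => n xn.
  by apply: eV => //; rewrite /ball/=.
have lim1 : Phi Psi (u t n.+1%:R^-1) @[n --> \oo] --> t.
  rewrite -[X in _ --> X]add0r; under eq_cvg do rewrite Phi_flow//.
  apply: cvgD; last exact: cvg_cst.
  by apply: seq0 => //; exact: cvg_harmonic.
have u_pos n : 0 < u t n.+1%:R^-1 by apply: lt_le_trans (flow_ge (n0 n) t0).
(* The increment bounds require a positive lower endpoint, so the case [phi t = 0] goes through the
   limit of [Phi] at [0+] instead. *)
have := phi_ge0 t0; rewrite le_eqVlt => /predU1P[phit0|phit0].
  have u0 : u t n.+1%:R^-1 @[n --> \oo] --> (0 : R) by rewrite phit0; exact: phi_cvg.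
  by rewrite -phit0 Phi0; exact: cvg_unique (seq0 _ u_pos u0) lim1.
apply: (fun h => cvg_unique _ h lim1) => //.
apply: (@squeeze_cvgr _ _ _ _ (fun=> Phi Psi (phi t))
  (fun n => Phi Psi (phi t) + (u t n.+1%:R^-1 - phi t) / (- Psi (phi t)))).
- apply: nearW => n; have pu := phi_le_flow t0 (n0 n).
  have := Phi_increment_le phit0 pu; have := Phi_increment_ge phit0 pu.
  have : 0 <= (u t n.+1%:R^-1 - phi t) / - Psi (u t n.+1%:R^-1).
    by rewrite divr_ge0 ?subr_ge0// oppr_ge0 ltW// flow_negative.
  by move=> *; apply/andP; split; lra.
- exact: cvg_cst.
- rewrite -[X in _ --> X]addr0; apply: cvgD; first exact: cvg_cst.
  rewrite -[X in _ --> X](mul0r (- Psi (phi t))^-1); apply: cvgMr_tmp.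
  by rewrite -[X in _ --> X](subrr (phi t)); apply: cvgB; [exact: phi_cvg|exact: cvg_cst].
Qed.

Let Phi_inj v w : 0 <= v -> 0 <= w -> Phi Psi v = Phi Psi w -> v = w.
Proof.
move=> v0 w0 vw; case: (ltgtP v w) => // [/(Phi_lt v0)|/(Phi_lt w0)];
  by rewrite vw ltxx.
Qed.

Lemma phi_Phi l : 0 <= l -> phi (Phi Psi l) = l.
Proof.
by move=> l0; apply: Phi_inj; rewrite ?phi_ge0 ?Phi_phi ?Phi_ge0.
Qed.

Lemma flow_phi t l : 0 <= t -> 0 < l -> u t l = phi (t + Phi Psi l).
Proof.
move=> t0 l0; have tP : 0 <= t + Phi Psi l by rewrite addr_ge0 ?Phi_ge0.
apply: Phi_inj; first by apply: le_trans (flow_ge l0 t0); exact: ltW.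
  exact: phi_ge0.
by rewrite Phi_flow// Phi_phi// addrC.
Qed.

Lemma phi_le s t : 0 <= s -> s <= t -> phi s <= phi t.
Proof.
move=> s0 st; rewrite leNgt; apply/negP => /Phi_lt.
by rewrite !Phi_phi ?phi_ge0// ?(le_trans s0)// => /(_ isT); rewrite ltNge st.
Qed.

Lemma phi_gt0 t : 0 < t -> 0 < phi t.
Proof.
move=> t0; rewrite lt_neqAle phi_ge0 ?ltW// andbT; apply/eqP => phi0.
by have := Phi_phi (ltW t0); rewrite -phi0 Phi0 => /eqP; rewrite lt_eqF.
Qed.

(** Integrated form of [phi' = - Psi (phi)]: moving from [phi t] to [u t l] takes time [Phi l], at a
    speed between its values at the two ends. *)
Lemma phi_increment t l : 0 < t -> 0 < l ->
  - Psi (phi t) * Phi Psi l <= u t l - phi t <= - Psi (u t l) * Phi Psi l.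
Proof.
move=> t0 l0; have p0 := phi_gt0 t0; have pu := phi_le_flow (ltW t0) l0.
have up : 0 < u t l by exact: lt_le_trans pu.
have s : Phi Psi (u t l) - Phi Psi (phi t) = Phi Psi l.
  by rewrite (Phi_flow l0 (ltW t0)) (Phi_phi (ltW t0)) addrK.
have := Phi_increment_le p0 pu; have := Phi_increment_ge p0 pu; rewrite s.
rewrite ler_pdivrMr ?oppr_gt0 ?flow_negative// ler_pdivlMr ?oppr_gt0 ?flow_negative//.
by rewrite ![Phi Psi l * _]mulrC => -> ->.
Qed.

End csbp_flow.

(** * The process and its lifetime *)

Section csbp_paths.
Context {R : realType} {d : measure_display} {Omega : measurableType d}.
Variables (u : R -> R -> R) (P : R.-pker (\bar R) ~> Omega) (Z : R -> Omega -> \bar R).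
Hypothesis csbp : is_csbp u P Z.

(** Right-continuity keeps the path off [a] for a while after [t], so the infimum lies strictly
    beyond [t]; [absorb] rules out an earlier visit. *)
Lemma hit_time_gt (a : \bar R) t w : 0 <= t ->
  (forall s, 0 <= s -> s <= t -> Z s w = a -> Z t w = a) ->
  ((t%:E < hit_time Z a w)%E <-> Z t w <> a).
Proof.
move=> t0 absorb; split=> [tT Zt|Zt].
  have : (hit_time Z a w <= t%:E)%E by apply: ereal_inf_lbound; exists t.
  by rewrite leNgt tT.
have Va : nbhs (Z t w) (~` [set a]).
  apply: open_nbhs_nbhs; split => //; apply: closed_openC.
  apply: accessible_closed_set1; apply: hausdorff_accessible.
  exact: ereal_hausdorff.
have := csbp_right_continuous csbp t0 Va.
rewrite /at_right /within /= => -[e /= e0 eV].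
have e20 : 0 < e / 2 by rewrite divr_gt0.
apply: (@lt_le_trans _ _ (t + e / 2)%:E); first by rewrite lte_fin ltrDl.
apply: le_ereal_inf_tmp => _ [s [s0 Zs] <-]; rewrite lee_fin leNgt; apply/negP => st.
have [le_st|lt_ts] := leP s t; first exact/Zt/(absorb s).
apply: (eV s) => //; rewrite /ball/= ltr0_norm ?subr_lt0//; lra.
Qed.

Lemma aliveE t w : 0 <= t -> alive Z t w <-> (0%E < Z t w < +oo)%E.
Proof.
move=> t0; rewrite /alive /= /lifetime lt_min.
have T0P := @hit_time_gt 0%E t w t0.
have TooP := @hit_time_gt +oo%E t w t0.
have {}T0P := T0P (fun s s0 st => csbp_absorbing0 csbp (introT andP (conj s0 st))).
have {}TooP := TooP (fun s s0 st => csbp_absorbingoo csbp (introT andP (conj s0 st))).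
have Z0 := @csbp_ge0 _ _ _ _ _ _ csbp t w t0.
split=> /andP[h1 h2]; apply/andP; split.
- by rewrite lt_neqAle Z0 andbT eq_sym; apply/eqP; exact/T0P.
- by rewrite lt_neqAle leey andbT; apply/eqP; exact/TooP.
- by apply/T0P => Zt; rewrite Zt ltxx in h1.
- by apply/TooP => Zt; rewrite Zt ltxx in h2.
Qed.

Lemma lifetime_ge0 w : (0 <= lifetime Z w)%E.
Proof.
by rewrite /lifetime le_min; apply/andP; split;
  apply: le_ereal_inf_tmp => _ [s [s0 _] <-]; rewrite lee_fin.
Qed.

Lemma measurable_alive t : 0 <= t -> measurable (alive Z t).
Proof.
move=> t0; have -> : alive Z t = Z t @^-1` `]0%E, +oo%E[.
  apply/seteqP; split => w; first by move/(aliveE w t0); rewrite /= in_itv.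
  by rewrite /= in_itv/= => ?; exact/(aliveE w t0).
by rewrite -[X in measurable X]setTI; apply: (csbp_measurable csbp t0) => //; exact: emeasurable_itv.
Qed.

Lemma measurable_lifetime : measurable_fun setT (lifetime Z).
Proof.
apply: (measurability _ (ErealGenOInfty.measurableE R)).
move=> /= _ [_ [a ->]] <-; rewrite setTI.
have [a0|a0] := leP 0 a.
  rewrite [X in measurable X](_ : _ = alive Z a); first exact: measurable_alive.
  by apply/seteqP; split => w; rewrite /alive /= in_itv/= andbT.
rewrite [X in measurable X](_ : _ = setT)//; apply/seteqP; split => // w _.
by rewrite /= in_itv/= andbT (lt_le_trans _ (lifetime_ge0 w))// lte_fin.
Qed.

Lemma measurable_fine_Z t : 0 <= t ->
  measurable_fun setT (fun w => fine (Z t w) : measurableTypeR R).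
Proof.
move=> t0; apply: (@measurableT_comp _ _ _ _ _ _ fine) => //.
exact: (csbp_measurable csbp t0).
Qed.

(** [fine] sends [+oo] to 0, so both traps fall outside []0, +oo[]. *)
Lemma alive_fineE t : 0 <= t ->
  alive Z t = (fun w => fine (Z t w)) @^-1` `]0%R, +oo[.
Proof.
move=> t0; apply/seteqP; split => w.
  move/(aliveE w t0); rewrite /= in_itv/= andbT.
  move=> /andP[Z0 Zoo]; rewrite -lte_fin fineK// ge0_fin_numE//.
  exact: ltW.
rewrite /= in_itv/= andbT => h; apply/(aliveE w t0).
move: h (@csbp_ge0 _ _ _ _ _ _ csbp t w t0).
by case: (Z t w) => [r| |] //=; rewrite ?ltxx// !lte_fin ltry => ->.
Qed.

Lemma preimage_EFin_alive t (B : set R) : 0 <= t ->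
  Z t @^-1` (EFin @` B) `&` alive Z t =
  (fun w => fine (Z t w)) @^-1` B `&` alive Z t.
Proof.
move=> t0; apply/seteqP; split => w [].
  by move=> [r Br rE] aw; split => //=; rewrite -rE.
move=> Bw aw; split => //; exists (fine (Z t w)) => //.
have /andP[Z0 Zoo] := (aliveE w t0).1 aw.
by rewrite fineK// ge0_fin_numE// ltW.
Qed.

(** The law is the image of [Q] under [fine (Z t)], restricted to []0, +oo[] and normalised. Its
    Laplace transform is stated in product form to avoid dividing extended reals. *)
Lemma exists_cond_law (Q : probability Omega R) t : 0 <= t ->
  (0 < Q (alive Z t))%E ->
  exists p : probability (measurableTypeR R) R,
  [/\ p = cond_law Q Z t :> (set (measurableTypeR R) -> \bar R), on_pos p &
      forall l, (laplace p l * Q (alive Z t) =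
        \int[Q]_(w in alive Z t) (expR (- (fine (Z t w) * l)))%:E)%E].
Proof.
move=> t0 Qpos; have mA := measurable_alive t0.
have mf := measurable_fine_Z t0.
have Qfin : Q (alive Z t) \is a fin_num by exact: fin_num_measure.
pose c := fine (Q (alive Z t)).
have cE : Q (alive Z t) = c%:E by rewrite fineK.
have c0 : 0 < c by rewrite -lte_fin -cE.
have ci0 : 0 <= c^-1 by rewrite invr_ge0 ltW.
have [X XE] := exists_probability_pushforward Q mf.
have mD : measurable (`]0%R, +oo[%classic : set (measurableTypeR R)).
  exact: measurable_itv.
pose m := mscale (NngNum ci0) (mrestr X mD).
have mE B : m B = ((c^-1)%:E * X (B `&` `]0%R, +oo[%classic))%E by [].
have XA : X `]0%R, +oo[%classic = c%:E by rewrite XE /pushforward -cE -alive_fineE.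
have m1 : m setT = 1%E.
  apply: etrans (mE _) _; rewrite setTI XA -EFinM mulVf// gt_eqF//.
have [p pE] := exists_probability m1.
exists p; split.
- apply/funext => B; rewrite pE; apply: etrans (mE _) _.
  rewrite /cond_law /cond_prob cE inver gt_eqF// muleC; congr (_ * _)%E.
  by rewrite XE /pushforward preimage_setI -alive_fineE// preimage_EFin_alive.
- by rewrite /on_pos pE; apply: etrans (mE _) _; rewrite setIid XA -EFinM mulVf// gt_eqF.
- move=> l; rewrite /laplace pE cE.
  have exp0 (y : measurableTypeR R) : (0 <= (expR (- (y * l)))%:E)%E.
    by rewrite lee_fin expR_ge0.
  have mexp : measurable_fun (`]0%R, +oo[%classic : set (measurableTypeR R))
      (fun y : measurableTypeR R => (expR (- (y * l)))%:E).
    by apply/measurable_EFinP; exact: measurable_expNM.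
  rewrite /m ge0_integral_mscale//=.
  have -> : (\int[mrestr X mD]_(y in `]0%R, +oo[) (expR (- (y * l)))%:E =
             \int[X]_(y in `]0%R, +oo[) (expR (- (y * l)))%:E)%E.
    by apply: eq_measure_integral => B mB BD; rewrite /mrestr; congr (X _); exact/setIidPl.
  rewrite muleAC -EFinM mulVf ?gt_eqF// mul1e XE.
  rewrite ge0_integral_pushforward//=.
  by rewrite alive_fineE.
Qed.

End csbp_paths.

(** * Consequences of almost sure explosion *)

Section csbp_explosion.
Context {R : realType} {d : measure_display} {Omega : measurableType d}.
Variables (u : R -> R -> R) (P : R.-pker (\bar R) ~> Omega) (Z : R -> Omega -> \bar R).
Hypothesis csbp : is_csbp u P Z.
Hypothesis explosion : explodes_as P Z.

Lemma exists_start_law x : exists p : probability Omega R, p = P x :> (set Omega -> \bar R).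
Proof. exact: exists_probability (prob_kernel x). Qed.

Lemma measurable_Z_eq0 t : 0 <= t -> measurable [set w | Z t w = 0%E].
Proof.
move=> t0; rewrite [X in measurable X](_ : _ = setT `&` Z t @^-1` [set 0%E]).
  exact: (csbp_measurable csbp t0).
by rewrite setTI; apply/seteqP; split.
Qed.

(** Both traps are absorbing, so a path that is at 0 at time [t] never visits [+oo], whereas almost
    every path does. *)
Lemma start_law_Z_eq0 x t : 0 < x -> 0 <= t -> P x%:E [set w | Z t w = 0%E] = 0%E.
Proof.
move=> x0 t0; apply: measure_negligible; first exact: measurable_Z_eq0.
apply: negligibleS (explosion x0) => w /= Zt0 [T0oo Tooy].
have [s s0 Zs] : exists2 s, 0 <= s & Z s w = +oo%E.
  apply: contrapT => noo; move: Tooy; rewrite /Too /hit_time.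
  rewrite (_ : [set _ | _ in _] = set0) ?ereal_inf0 ?ltxx//.
  by apply/seteqP; split => // y [s [s0 Zs] yE]; case: noo; exists s.
have [st|/ltW ts] := leP s t.
  have := @csbp_absorbingoo _ _ _ _ _ _ csbp s t w (introT andP (conj s0 st)) Zs.
  by rewrite Zt0.
have := @csbp_absorbing0 _ _ _ _ _ _ csbp t s w (introT andP (conj t0 ts)) Zt0.
by rewrite Zs.
Qed.

Lemma alive_laplace x t l : 0 < x -> 0 <= t -> 0 < l ->
  (\int[P x%:E]_(w in alive Z t) (expR (- (fine (Z t w) * l)))%:E =
   (expR (- (x * u t l)))%:E)%E.
Proof.
move=> x0 t0 l0.
have x0e : (0 <= x%:E)%E by rewrite lee_fin ltW.
have := @csbp_laplace _ _ _ _ _ _ csbp x%:E t l x0e t0 l0.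
rewrite -EFinM -EFinN /= => <-.
have mA := measurable_alive csbp t0.
have mexp : measurable_fun setT (fun w => (expR (- (fine (Z t w) * l)))%:E).
  apply/measurable_EFinP.
  apply: (@measurableT_comp _ _ _ _ _ _ (fun y : measurableTypeR R => expR (- (y * l)))).
    exact: measurable_expNM.
  exact: (measurable_fine_Z csbp t0).
have mN := measurable_Z_eq0 t0.
(* Split over the three kinds of states: the trap [+oo] contributes 0 for [l > 0], and the trap 0,
   where the exponential is 1, is a null event. *)
transitivity (\int[P x%:E]_w
   (((fun w => (expR (- (fine (Z t w) * l)))%:E) \_ (alive Z t)) w +
    (\1_[set w | Z t w = 0%E] w)%:E))%E.
  rewrite ge0_integralD//=.
  - rewrite -integral_mkcond integral_indic// setIT.
    by rewrite start_law_Z_eq0// adde0.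
  - by move=> w _; apply: erestrict_ge0 => v _; rewrite lee_fin expR_ge0.
  - apply/measurable_restrict => //.
    by apply: measurable_funS mexp.
  - by apply/measurable_EFinP; exact: measurable_indic.
apply: eq_integral => w _; rewrite /patch indicE.
have Z0 := @csbp_ge0 _ _ _ _ _ _ csbp t w t0.
have AE := aliveE csbp w t0.
case: ifPn => [/set_mem/AE/andP[Zp Zoo]|/negP nA].
  rewrite memNset/=; last by move=> Z00; rewrite Z00 ltxx in Zp.
  rewrite adde0 -[in RHS](@fineK _ (Z t w)) ?ge0_fin_numE//.
  by rewrite mulrC.
have [Z00|Zn0] := eqVneq (Z t w) 0%E.
  by rewrite mem_set//= Z00 mule0 oppe0 /= expR0 add0e.
rewrite memNset/=; last by move/eqP; rewrite (negPf Zn0).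
have -> : Z t w = +oo%E.
  apply/eqP; rewrite eq_le leey leNgt; apply/negP => Zoo; apply: nA.
  by apply/mem_set/AE; rewrite Zoo lt_neqAle eq_sym Zn0 Z0.
by rewrite gt0_muley// add0e.
Qed.

Let one_gt0 : 0 < 1 :> R := ltr01.

Lemma integral_alive_Rintegral x t l : 0 < x -> 0 <= t -> 0 < l ->
  \int[P x%:E]_(w in alive Z t) expR (- (fine (Z t w) * l)) = expR (- (x * u t l)).
Proof. by move=> x0 t0 l0; rewrite /Rintegral alive_laplace. Qed.

Lemma measurable_exp_alive t l : 0 <= t ->
  measurable_fun (alive Z t) (fun w => expR (- (fine (Z t w) * l))).
Proof.
move=> t0; apply: measurable_funTS.
apply: (@measurableT_comp _ _ _ _ _ _ (fun y : measurableTypeR R => expR (- (y * l)))).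
  exact: measurable_expNM.
exact: (measurable_fine_Z csbp t0).
Qed.

Lemma fine_alive_gt0 t w : 0 <= t -> alive Z t w -> 0 < fine (Z t w).
Proof.
by move=> t0; rewrite (alive_fineE csbp t0) /= in_itv/= andbT.
Qed.

Lemma flow_le t l l' : 0 <= t -> 0 < l -> l <= l' -> u t l <= u t l'.
Proof.
move=> t0 l0 ll'; have l'0 := lt_le_trans l0 ll'.
rewrite -lerN2 -ler_expR -lee_fin.
have := alive_laplace one_gt0 t0 l0; rewrite mul1r => <-.
have := alive_laplace one_gt0 t0 l'0; rewrite mul1r => <-.
apply: ge0_le_integral => //.
- exact: (measurable_alive csbp).
- by apply/measurable_EFinP; exact: measurable_exp_alive.
- by apply/measurable_EFinP; exact: measurable_exp_alive.
- move=> w aw; rewrite lee_fin ler_expR lerN2 ler_wpM2l// ltW//.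
  exact: fine_alive_gt0 aw.
Qed.

(** The [phi] of the overview, read off the process started at 1; [decay_cvg] identifies it with
    [u (t, 0+)]. *)
Definition decay (t : R) : R := - ln (fine (P 1%E (alive Z t))).

Lemma alive_gt0 x t : 0 < x -> 0 <= t -> 0 < fine (P x%:E (alive Z t)).
Proof.
move=> x0 t0; have [p pE] := exists_start_law x%:E.
have mA := measurable_alive csbp t0.
have pfin : P x%:E (alive Z t) \is a fin_num by rewrite -pE; exact: fin_num_measure.
rewrite -lte_fin fineK//.
apply: (@lt_le_trans _ _ (expR (- (x * u t 1)))%:E); first by rewrite lte_fin expR_gt0.
rewrite -alive_laplace//.
apply: (@le_trans _ _ (\int[P x%:E]_(w in alive Z t) 1%E)%E).
  apply: ge0_le_integral => //.
  - by apply/measurable_EFinP; exact: measurable_exp_alive.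
  - move=> w aw; rewrite lee_fin -[leRHS]expR0 ler_expR oppr_le0 mulr1 ltW//.
    exact: fine_alive_gt0 aw.
by rewrite integral_cst// mul1e.
Qed.

Lemma alive_cvg x t : 0 < x -> 0 <= t ->
  expR (- (x * u t n.+1%:R^-1)) @[n --> \oo] --> fine (P x%:E (alive Z t)).
Proof.
move=> x0 t0; have [p pE] := exists_start_law x%:E.
have mA := measurable_alive csbp t0.
have fin1 : fine (P x%:E (alive Z t)) = \int[p]_(w in alive Z t) 1.
  rewrite /Rintegral integral_cst// mul1e.
  exact: (esym (congr1 (fun f => fine (f (alive Z t))) pE)).
rewrite fin1.
under eq_cvg => n do rewrite -integral_alive_Rintegral//.
have -> : (fun n : nat => \int[P x%:E]_(w in alive Z t) expR (- (fine (Z t w) * n.+1%:R^-1))) =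
          (fun n : nat => \int[p]_(w in alive Z t) expR (- (fine (Z t w) * n.+1%:R^-1))).
  apply/funext => n.
  exact: (esym (congr1 (fun f => fine (\int[f]_(w in alive Z t)
    (expR (- (fine (Z t w) * n.+1%:R^-1)))%:E)%E) pE)).
apply: (@bounded_cvg_Rintegral _ _ _ p _ mA _ _ 1).
- by move=> n; exact: measurable_exp_alive.
- move=> n w aw; rewrite ger0_norm ?expR_ge0// -[leRHS]expR0 ler_expR oppr_le0.
  by rewrite mulr_ge0 ?invr_ge0// ltW//; exact: fine_alive_gt0 aw.
- move=> w aw; rewrite -[X in _ --> X]expR0 -[X in expR X]oppr0 -(mulr0 (fine (Z t w))).
  apply: continuous_cvg; first exact: continuous_expR.
  by apply: cvgN; apply: cvgMl_tmp; exact: cvg_harmonic.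
Qed.

Lemma decay_cvg t : 0 <= t -> u t n.+1%:R^-1 @[n --> \oo] --> decay t.
Proof.
move=> t0; have -> : (fun n : nat => u t n.+1%:R^-1) =
   (fun n : nat => - ln (expR (- (1 * u t n.+1%:R^-1)))).
  by apply/funext => n; rewrite expRK mul1r opprK.
apply: cvgN; apply: (@continuous_cvg _ _ _ _ _ _ (@ln R)).
  exact: continuous_ln (alive_gt0 one_gt0 t0).
exact: alive_cvg one_gt0 t0.
Qed.

Lemma start_law_alive x t : 0 < x -> 0 <= t ->
  P x%:E (alive Z t) = (expR (- (x * decay t)))%:E.
Proof.
move=> x0 t0; have [p pE] := exists_start_law x%:E.
have mA := measurable_alive csbp t0.
have pfin : P x%:E (alive Z t) \is a fin_num by rewrite -pE; exact: fin_num_measure.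
rewrite -(fineK pfin); congr EFin.
apply: cvg_unique (alive_cvg x0 t0) _ => //.
apply: continuous_cvg; first exact: continuous_expR.
by apply: cvgN; apply: cvgMl_tmp; exact: decay_cvg.
Qed.

(** The events [alive Z n] decrease to [lifetime = +oo], which is null, so [P 1 (alive Z n)] tends
    to 0. In this form explosion reaches the analysis of the flow. *)
Lemma decay_unbounded A : exists2 t, 0 <= t & A <= decay t.
Proof.
have [p pE] := exists_start_law 1%E.
have mA n : measurable (alive Z n%:R) by exact: (measurable_alive csbp).
have capE : \bigcap_n alive Z n%:R = [set w | lifetime Z w = +oo%E].
  apply/seteqP; split => w /=.
    move=> h; apply/eqP; rewrite eq_le leey leNgt; apply/negP => lt_oo.
    have lf : lifetime Z w \is a fin_num by rewrite ge0_fin_numE// lifetime_ge0.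
    have := h (Num.trunc (fine (lifetime Z w))).+1 I.
    rewrite /alive /= -(fineK lf) lte_fin /= ltNge ltW//.
    exact: truncnS_gt.
  by move=> lE n _; rewrite /alive /= lE ltry.
have mcap : measurable (\bigcap_n alive Z n%:R) by exact: bigcap_measurable.
have cap0 : p (\bigcap_n alive Z n%:R) = 0%E.
  rewrite pE; apply: measure_negligible => //; rewrite capE.
  by apply: negligibleS (explosion one_gt0) => w /= -> [<-]; rewrite ltxx.
have : (p \o (fun n => alive Z n%:R)) @ \oo --> p (\bigcap_n alive Z n%:R).
  apply: nonincreasing_cvg_mu => //.
    by apply: le_lt_trans (ltry 1); exact: probability_le1.
  move=> m n mn; apply/subsetPset => w; rewrite /alive /=; apply: le_lt_trans.
  by rewrite lee_fin ler_nat.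
rewrite cap0 => /fine_cvg /= /cvgrPdist_lt /(_ (expR (- A)) (expR_gt0 _)).
move=> [n _ /(_ n (leqnn n))] /=; rewrite sub0r normrN.
rewrite pE start_law_alive//= ger0_norm ?expR_ge0// ltr_expR mul1r ltrN2 => /ltW.
by exists n%:R.
Qed.

End csbp_explosion.

(** * Random initial states and the exponential law of the lifetime *)

Section initial_law_mixture.
Context {R : realType} {d : measure_display} {Omega : measurableType d}.
Variable P : R.-pker (\bar R) ~> Omega.
Let T := measurableTypeR R.

Let mD : measurable (`]0%R, +oo[%classic : set T).
Proof. exact: measurable_itv. Qed.

Lemma measurable_kernel_EFin (A : set Omega) : measurable A ->
  measurable_fun setT (fun x : T => P x%:E A).
Proof.
move=> mA; apply: (@measurableT_comp _ _ _ _ _ _ (fun y => P y A)).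
  exact: measurable_kernel.
by apply/measurable_EFinP; exact: measurable_id.
Qed.

(** [initial_law] is a bare formula; the Giry bind of [mu] with the kernel supplies a genuine
    probability that agrees with it on measurable sets and whose integrals disintegrate over the
    starting point. *)
Lemma exists_initial_law (mu : probability T R) : on_pos mu ->
  exists Q : probability Omega R,
  (forall A, measurable A -> Q A = initial_law P mu A) /\
  (forall A h, measurable A -> measurable_fun setT h -> (forall w, 0 <= h w)%E ->
    \int[Q]_(w in A) h w = \int[mu]_(x in `]0%R, +oo[) \int[P x%:E]_(w in A) h w)%E.
Proof.
move=> mupos.
have /choice[p pE] : forall x : T, exists p : probability Omega R,
    p = P x%:E :> (set Omega -> \bar R).
  by move=> x; exact: exists_probability (prob_kernel x%:E).
pose f (x : T) : giry Omega R := p x.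
have mf : measurable_fun [set: T] f.
  apply: measurable_giry_codensity => // B mB.
  rewrite [X in measurable_fun _ X](_ : _ = fun x : T => P x%:E B).
    exact: measurable_kernel_EFin.
  by apply/funext => x; exact: (congr1 (fun g => g B) (pE x)).
pose Q0 := giry_bind mu mf.
have intQ0 h : measurable_fun setT h -> (forall w, 0 <= h w)%E ->
    (\int[Q0]_w h w = \int[mu]_x \int[P x%:E]_w h w)%E.
  move=> mh h0; apply: etrans (giry_int_bind mu mf mh h0) _.
  apply: eq_integral => x _.
  exact: (congr1 (fun g => (\int[g]_w h w)%E) (pE x)).
have Q0E A : measurable A -> Q0 A = (\int[mu]_x P x%:E A)%E.
  move=> mA; have mI : measurable_fun setT (EFin \o (\1_A : Omega -> R)).
    by apply/measurable_EFinP; exact: measurable_indic.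
  have I0 w : (0 <= (EFin \o (\1_A : Omega -> R)) w)%E.
    by rewrite lee_fin indicE ler0n.
  have := intQ0 _ mI I0; rewrite /= integral_indic// setIT => h.
  apply: etrans h _.
  by apply: eq_integral => x _; rewrite integral_indic// setIT.
have Q01 : Q0 setT = 1%E.
  rewrite Q0E//; transitivity (\int[mu]_x (cst 1%E : T -> \bar R) x)%E.
    by apply: eq_integral => x _; exact: prob_kernel.
  by rewrite integral_cst// mul1e; exact: probability_setT.
have [Q QE] := exists_probability Q01.
exists Q; split=> [A mA|A h mA mh h0].
  rewrite QE; apply: etrans (Q0E A mA) _; apply: esym.
  apply: (integral_setT_eq1 mD mupos) => //.
  exact: measurable_kernel_EFin.
have mhA : measurable_fun setT (h \_ A).
  by apply/measurable_restrict => //; exact: measurable_funS mh.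
have hA0 w : (0 <= (h \_ A) w)%E by apply: erestrict_ge0.
have mint : measurable_fun setT (fun x : T => (\int[P x%:E]_w (h \_ A) w)%E).
  rewrite [X in measurable_fun _ X](_ : _ = giry_int ^~ (h \_ A) \o f).
    exact: (measurableT_comp (measurable_giry_int mhA hA0) mf).
  by apply/funext => x; exact: (congr1 (fun g => (\int[g]_w (h \_ A) w)%E) (esym (pE x))).
rewrite integral_mkcond.
apply: etrans (congr1 (fun g => (\int[g]_w (h \_ A) w)%E) QE) _.
apply: etrans (intQ0 _ mhA hA0) _.
transitivity (\int[mu]_(x in `]0%R, +oo[) \int[P x%:E]_w (h \_ A) w)%E.
  apply: esym; apply: (integral_setT_eq1 mD mupos) => //.
  by move=> x; exact: integral_ge0.
by apply: eq_integral => x _; rewrite -integral_mkcond.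
Qed.

End initial_law_mixture.

Section exponential_tail.
Context {R : realType}.
Let T := measurableTypeR R.
Variable beta : R.
Hypothesis beta0 : 0 < beta.

Lemma exists_exponential_prob : exists p : probability T R,
  p = exponential_prob beta :> (set T -> \bar R).
Proof.
have [e eE] : exists e : {measure set T -> \bar R},
    e = exponential_prob beta :> (set T -> \bar R).
  by eexists (exponential_distribution_exponential_prob__canonical__measure_function_Measure beta0).
have [|p pE] := @exists_probability _ _ _ e.
  by rewrite eE; exact: integral_exponential_pdf.
by exists p; rewrite pE.
Qed.

Lemma exponential_prob_tail a : 0 <= a ->
  exponential_prob beta `]a, +oo[%classic = (expR (- (beta * a)))%:E.
Proof.
move=> a0; have [p pE] := exists_exponential_prob.
have neg0 (A : set R) : A `<=` `]-oo, 0[%classic -> exponential_prob beta A = 0%E.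
  move=> A0; apply: integral0_eq => x /A0; rewrite /= in_itv/= => x0.
  by rewrite lt0_exponential_pdf.
have p0 : p `]-oo, 0[%classic = 0%E by rewrite pE neg0.
have pa : p `[0, a]%classic = (1 - expR (- (beta * a)))%:E.
  move: a0; rewrite le_eqVlt => /predU1P[<-|a0].
    rewrite pE set_itv1 /exponential_prob integral_set1.
    by rewrite mulr0 oppr0 expR0 subrr.
  by rewrite pE exponential_prob_itv0c// mulNr EFinB.
have -> : `]a, +oo[%classic = ~` (`]-oo, 0[%classic `|` `[0, a]%classic) :> set R.
  apply/seteqP; split => y /=; rewrite !in_itv/= ?andbT.
    by move=> ay []; lra.
  by move=> /not_orP[/negP h1 /negP h2]; move: h1 h2; rewrite -leNgt negb_and -!ltNge; lra.
have pU : p (`]-oo, 0[%classic `|` `[0, a]%classic) = (1 - expR (- (beta * a)))%:E.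
  have disj : `]-oo, 0[%classic `&` `[0, a]%classic = set0 :> set T.
    by apply/seteqP; split => // y [/=]; rewrite !in_itv/=; lra.
  have mN : measurable (`]-oo, 0[%classic : set T) by exact: measurable_itv.
  have mI : measurable (`[0, a]%classic : set T) by exact: measurable_itv.
  apply: etrans (measureU p mN mI disj) _.
  by rewrite -[RHS]add0e; congr (_ + _)%E; [exact: p0|exact: pa].
rewrite -pE probability_setC ?pU; last exact: measurableU.
by rewrite -EFinB; congr EFin; ring.
Qed.

End exponential_tail.

Section lifetime_law.
Context {R : realType} {d : measure_display} {Omega : measurableType d}.
Variables (u : R -> R -> R) (P : R.-pker (\bar R) ~> Omega) (Z : R -> Omega -> \bar R).
Hypothesis csbp : is_csbp u P Z.
Variables (Q : probability Omega R) (beta : R).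
Hypothesis beta0 : 0 < beta.
Let T := measurableTypeR R.
Let F : set Omega := [set w | (lifetime Z w < +oo)%E].

Let mlife : measurable_fun setT (fun w => fine (lifetime Z w) : T).
Proof.
apply: (@measurableT_comp _ _ _ _ _ _ fine) => //.
exact: (measurable_lifetime csbp).
Qed.

Let mpre (B : set T) : measurable B -> measurable ((fun w => fine (lifetime Z w)) @^-1` B).
Proof. by move=> mB; rewrite -[X in measurable X]setTI; exact: mlife. Qed.

Let mF : measurable F.
Proof.
rewrite [X in measurable X](_ : _ = setT `&` lifetime Z @^-1` `]-oo%E, +oo%E[).
  by apply: (measurable_lifetime csbp) => //; exact: emeasurable_itv.
rewrite setTI; apply/seteqP; split => w; rewrite /F /= in_itv/=.
  by move=> ->; rewrite (lt_le_trans _ (lifetime_ge0 Z w))//.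
by case/andP.
Qed.

Let preE (B : set R) :
  lifetime Z @^-1` (EFin @` B) = (fun w => fine (lifetime Z w)) @^-1` B `&` F.
Proof.
apply/seteqP; split => w /=.
  by move=> [r Br rE]; rewrite /F /= -rE; split => //; rewrite ltry.
move=> [Bw Fw]; exists (fine (lifetime Z w)) => //.
by rewrite fineK// ge0_fin_numE// lifetime_ge0.
Qed.

Let aliveE_F t : 0 <= t ->
  alive Z t = (lifetime Z @^-1` (EFin @` `]t, +oo[)) `|` ~` F.
Proof.
move=> t0; rewrite preE; apply/seteqP; split => w; rewrite /alive /F /=.
  move=> tw; have [wF|wF] := pselect (lifetime Z w < +oo)%E; [left|by right].
  split => //; rewrite in_itv/= andbT -lte_fin fineK//.
  by rewrite ge0_fin_numE// lifetime_ge0.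
move=> [[+ wF]|/negP].
  rewrite in_itv/= andbT -lte_fin fineK//.
  by rewrite ge0_fin_numE// lifetime_ge0.
by rewrite -leNgt => /(lt_le_trans _); apply; exact: ltry.
Qed.

(** The lifetime takes values in [\bar R]: vanishing of the tails first shows that it is almost
    surely finite, and then the right rays determine its law. *)
Lemma alive_exponential_law :
  (forall t, 0 <= t -> Q (alive Z t) = (expR (- (beta * t)))%:E) ->
  forall B : set T, measurable B ->
    Q (lifetime Z @^-1` (EFin @` B)) = exponential_prob beta B.
Proof.
move=> tail.
have QF0 : Q (~` F) = 0%E.
  apply/eqP; rewrite eq_le measure_ge0 andbT; apply/lee_addgt0Pr => e e0.
  rewrite add0e; have [M Me] := exists_expRN_le beta0 e0.
  apply: (@le_trans _ _ (Q (alive Z M%:R))); last first.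
    by rewrite tail// lee_fin mulrC.
  apply: le_measure; rewrite ?inE//; first exact: measurableC.
    exact: (measurable_alive csbp).
  by rewrite aliveE_F//; exact: subsetUr.
have QF : Q F = 1%E.
  have := probability_setC Q (measurableC mF).
  by rewrite setCK QF0 sube0.
have [X XE] := exists_probability_pushforward Q mlife.
have [e eE] := exists_exponential_prob beta0.
have XB (B : set T) : measurable B -> X B = Q (lifetime Z @^-1` (EFin @` B)).
  move=> mB; rewrite preE; apply: etrans (esym (measureI_eq1 (mpre mB) mF QF)).
  by rewrite XE.
move=> B mB; rewrite -XB// -eE.
apply: probability_eq_ray mB; first by apply: le_lt_trans (ltry 1); exact: probability_le1.
move=> a; apply: etrans (XB _ (measurable_itv _)) _.
apply: etrans _ (esym (congr1 (fun f => f `]a, +oo[%classic) eE)).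
have tailB t : 0 <= t -> Q (lifetime Z @^-1` (EFin @` `]t, +oo[)) = (expR (- (beta * t)))%:E.
  move=> t0; rewrite -tail//.
  have mA := measurable_alive csbp t0.
  apply: etrans _ (measureI_eq1 mA mF QF); congr (Q _).
  rewrite aliveE_F// preE; apply/seteqP; split => w /=.
    by move=> [h Fw]; split => //; left.
  by move=> [[//|]].
(* Below 0 the tail formula does not apply; both sides equal 1 by comparison with the ray at 0. *)
have [a0|a0] := leP 0 a; first by rewrite exponential_prob_tail// tailB.
have expl0 : exponential_prob beta `]a, +oo[%classic = 1%E.
  apply/eqP; rewrite -eE eq_le probability_le1//=.
  apply: (@le_trans _ _ (e `]0, +oo[%classic)).
    by rewrite eE exponential_prob_tail// mulr0 oppr0 expR0.
  apply: le_measure; rewrite ?inE; [exact: measurable_itv|exact: measurable_itv|].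
  by apply: subset_itvr; rewrite bnd_simp ltW.
rewrite expl0; apply/eqP; rewrite eq_le probability_le1/=; last first.
  by rewrite preE; apply: measurableI => //; apply: mpre; exact: measurable_itv.
apply: (@le_trans _ _ (Q (lifetime Z @^-1` (EFin @` `]0, +oo[)))).
  by rewrite tailB// mulr0 oppr0 expR0.
apply: le_measure; rewrite ?inE ?preE.
- by apply: measurableI => //; apply: mpre; exact: measurable_itv.
- by apply: measurableI => //; apply: mpre; exact: measurable_itv.
- apply: setSI => w /=; rewrite !in_itv/= !andbT; exact: lt_trans.
Qed.

(** The instance [B = setT] of the hypothesis shows that the lifetime is almost surely finite. *)
Lemma exponential_law_alive :
  (forall B : set T, measurable B ->
    Q (lifetime Z @^-1` (EFin @` B)) = exponential_prob beta B) ->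
  forall t, 0 <= t -> Q (alive Z t) = (expR (- (beta * t)))%:E.
Proof.
move=> law t t0.
have QF : Q F = 1%E.
  have := law setT measurableT; rewrite preE preimage_setT setTI => ->.
  exact: integral_exponential_pdf.
have mA := measurable_alive csbp t0.
rewrite -exponential_prob_tail// -law; last exact: measurable_itv.
apply: etrans (esym (measureI_eq1 mA mF QF)) _; congr (Q _).
rewrite aliveE_F// preE; apply/seteqP; split => w /=.
  by move=> [[//|]].
by move=> [h Fw]; split => //; left.
Qed.

End lifetime_law.

(** * Quasi-stationary distributions *)

Section quasi_stationary.
Context {R : realType} {d : measure_display} {Omega : measurableType d}.
Variables (b : branching_triple R) (u : R -> R -> R).
Variables (P : R.-pker (\bar R) ~> Omega) (Z : R -> Omega -> \bar R).
Let Psi := branching_mechanism b.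
Hypothesis flow : cumulant_flow Psi u.
Hypothesis csbp : is_csbp u P Z.
Hypothesis explosion : explodes_as P Z.
Let T := measurableTypeR R.
Let phi := decay P Z.

Let Psi00 : Psi 0 = 0 := branching_mechanism0 b.
Let convex := @branching_mechanism_convex R b.
Let u_le := @flow_le _ _ _ _ _ _ csbp explosion.
Let phi_cvg := @decay_cvg _ _ _ _ _ _ csbp explosion.
Let phi_oo := @decay_unbounded _ _ _ _ _ _ csbp explosion.

Let flowE := @flow_phi R Psi u phi Psi00 convex flow u_le phi_cvg phi_oo.
Let phi_le' := @phi_le R Psi u phi Psi00 convex flow u_le phi_cvg phi_oo.
Let phi_ge0' := @phi_ge0 R Psi u phi Psi00 convex flow u_le phi_cvg phi_oo.
Let Phi_phi' := @Phi_phi R Psi u phi Psi00 convex flow u_le phi_cvg phi_oo.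
Let phi_Phi' := @phi_Phi R Psi u phi Psi00 convex flow u_le phi_cvg phi_oo.
Let Phi_ge0' := @Phi_ge0 R Psi u phi Psi00 convex flow u_le phi_cvg phi_oo.
Let Phi0' := @Phi0 R Psi u phi Psi00 convex flow u_le phi_cvg phi_oo.
Let phi_inc' := @phi_increment R Psi u phi Psi00 convex flow u_le phi_cvg phi_oo.
Let Phi_lt' := @Phi_lt R Psi u phi Psi00 convex flow u_le phi_cvg phi_oo.
Let Phi_cvg0' := @Phi_cvg0 R Psi u phi Psi00 convex flow u_le phi_cvg phi_oo.
Let Phi_flow' := @Phi_flow R Psi u phi Psi00 convex flow u_le phi_cvg phi_oo.

Lemma start_cond_law x t : 0 < x -> 0 <= t ->
  exists p : probability T R,
  [/\ p = cond_law (P x%:E) Z t :> (set T -> \bar R), on_pos p &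
      forall l, 0 <= l ->
        laplace p l = (expR (- (x * (phi (t + Phi Psi l) - phi t))))%:E].
Proof.
move=> x0 t0; have [Q QE] := exists_start_law P x%:E.
have QA : Q (alive Z t) = (expR (- (x * phi t)))%:E.
  by rewrite QE (start_law_alive csbp explosion).
have [|p [pE ppos pl]] := exists_cond_law csbp (Q := Q) t0.
  by rewrite QA lte_fin expR_gt0.
exists p; split; [by rewrite pE QE|exact: ppos|move=> l].
(* The semigroup is only specified for [lambda > 0]; at 0 the identity is that of total masses. *)
rewrite le_eqVlt => /predU1P[<-|l0].
  by rewrite laplace_at0// Phi0' addr0 subrr mulr0 oppr0 expR0.
have := pl l; rewrite QA.
move=> h; have := etrans h (congr1 (fun g => (\int[g]_(w in alive Z t)
  (expR (- (fine (Z t w) * l)))%:E)%E) QE).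
rewrite (alive_laplace csbp explosion)// => /(mule_EFin_eq (expR_gt0 _)) ->.
by rewrite -expRN -expRD -flowE//; congr (expR _)%:E; ring.
Qed.

Lemma exists_laplace_Phi beta : 0 < beta ->
  exists m : probability T R, on_pos m /\
    forall l, 0 <= l -> laplace m l = (expR (- (beta * Phi Psi l)))%:E.
Proof.
move=> beta0.
have : is_laplace_transform (fun l => expR (- (beta * Phi Psi l))).
  apply: (@is_laplace_transform_exp_flow R phi) => //.
  - by move=> x t x0 t0; have [p [_ ppos pl]] := start_cond_law x0 t0;
      exact: is_laplace_transform_on_pos ppos pl.
move=> /is_laplace_transformP[m [mE mg]]; exists m.
have mpos : on_pos m.
  (* No atom at 0: at [l = phi M] the transform is [exp (- beta M)], which is arbitrarily small. *)
  apply: on_pos_laplace_vanish mE mg _ => e e0.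
  have [M Me] := exists_expRN_le beta0 e0.
  exists (phi M%:R); first exact: phi_ge0'.
  by rewrite Phi_phi'// mulrC.
by split=> // l l0; rewrite -integral_exp_laplace// mg.
Qed.

Lemma initial_law_alive (mu : probability T R) t : on_pos mu -> 0 <= t ->
  initial_law P mu (alive Z t) = laplace mu (phi t).
Proof.
move=> mupos t0; apply: eq_integral => x /set_mem; rewrite /= in_itv/= andbT => x0.
by rewrite (start_law_alive csbp explosion).
Qed.

Lemma initial_cond_law (mu : probability T R) t : on_pos mu -> 0 <= t ->
  (0 < laplace mu (phi t))%E ->
  exists p : probability T R,
  [/\ forall B, measurable B -> p B = cond_law (initial_law P mu) Z t B, on_pos p &
      forall l, 0 < l -> (laplace p l * laplace mu (phi t) = laplace mu (u t l))%E].
Proof.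
move=> mupos t0 mu_gt0; have [Q [QE Qint]] := exists_initial_law P mupos.
have mA := measurable_alive csbp t0.
have QA : Q (alive Z t) = laplace mu (phi t) by rewrite QE// initial_law_alive.
have [|p [pE ppos pl]] := exists_cond_law csbp (Q := Q) t0.
  by rewrite QA.
exists p; split => //.
  move=> B mB; rewrite pE /cond_law /cond_prob (QE _ mA) QE//.
  rewrite (preimage_EFin_alive csbp _ t0); apply: measurableI => //.
  by rewrite -[X in measurable X]setTI; exact: (measurable_fine_Z csbp t0).
move=> l l0; rewrite -QA pl Qint//.
- apply: eq_integral => x /set_mem; rewrite /= in_itv/= andbT => x0.
  by rewrite (alive_laplace csbp explosion).
- apply/measurable_EFinP.
  apply: (@measurableT_comp _ _ _ _ _ _ (fun y : T => expR (- (y * l)))).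
    exact: measurable_expNM.
  exact: (measurable_fine_Z csbp t0).
Qed.

(** [Phi (u t l) = Phi l + t], so the transform at [u t l] is that at [l] times [exp (- beta t)],
    and conditioning divides by exactly this factor. *)
Lemma laplace_Phi_qsd beta (mu : probability T R) : on_pos mu ->
  (forall l, 0 <= l -> laplace mu l = (expR (- (beta * Phi Psi l)))%:E) ->
  is_qsd P Z mu.
Proof.
move=> mupos muE; split=> // t t0.
have muphi : laplace mu (phi t) = (expR (- (beta * t)))%:E.
  by rewrite muE ?Phi_phi'//; exact: phi_ge0'.
have mu_gt0 : (0 < laplace mu (phi t))%E by rewrite muphi lte_fin expR_gt0.
split; first by rewrite initial_law_alive.
have [p [pE ppos pl]] := initial_cond_law mupos t0 mu_gt0.
move=> B mB; rewrite -pE//; apply: laplace_inj => // n.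
have [->|n0] := eqVneq n 0%N; first by rewrite !laplace_at0.
have n0' : 0 < n%:R :> R by rewrite ltr0n lt0n.
have := pl _ n0'; rewrite muphi.
have un : 0 <= u t n%:R by have [_ + _ _] := flow n0'; exact.
rewrite muE// => /(mule_EFin_eq (expR_gt0 _)) ->.
rewrite muE// Phi_flow'// -expRN -expRD; congr (expR _)%:E; ring.
Qed.

(** The [n]-th convolution root is the law of parameter [beta / n]. *)
Lemma infinitely_divisible_laplace_Phi beta (mu : probability T R) : 0 < beta ->
  on_pos mu ->
  (forall l, 0 <= l -> laplace mu l = (expR (- (beta * Phi Psi l)))%:E) ->
  infinitely_divisible mu.
Proof.
move=> beta0 mupos muE n n0.
have n0' : 0 < n%:R :> R by rewrite ltr0n.
have [nu [nupos nuE]] := exists_laplace_Phi (divr_gt0 beta0 n0').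
exists nu => B mB; have [q qE] := exists_convolution_power nu n.
have ql l : 0 <= l -> (\int[q]_y (expR (- (y * l)))%:E =
    (expR (- (beta * Phi Psi l)))%:E)%E.
  move=> l0; rewrite qE (@integral_exp_convolution_power _ _ _ _
    (expR (- (beta / n%:R * Phi Psi l)))); last by rewrite integral_exp_laplace// nuE.
  rewrite -expRM_natl; congr (expR _)%:E; field.
  by rewrite gt_eqF.
have qpos : on_pos q.
  apply: on_pos_laplace_vanish ql _.
    by rewrite qE; apply: convolution_power_nonneg; exact: on_pos_nonneg.
  move=> e e0; have [M Me] := exists_expRN_le beta0 e0.
  exists (phi M%:R); first exact: phi_ge0'.
  by rewrite Phi_phi'// mulrC.
rewrite -qE; apply: laplace_inj => // k.
by rewrite -[RHS]integral_exp_laplace// ql// muE.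
Qed.

Lemma laplace_Phi_decay_rate beta (mu : probability T R) : 0 < beta -> on_pos mu ->
  (forall l, 0 <= l -> laplace mu l = (expR (- (beta * Phi Psi l)))%:E) ->
  has_decay_rate P Z mu beta.
Proof.
move=> beta0 mupos muE B mB; have [Q [QE _]] := exists_initial_law P mupos.
have mlB : measurable (lifetime Z @^-1` (EFin @` B)).
  rewrite -[X in measurable X]setTI; apply: (measurable_lifetime csbp) => //.
  exact: measurable_image_EFin.
rewrite -QE//; apply: (alive_exponential_law csbp) => // t t0.
rewrite QE; last exact: (measurable_alive csbp).
by rewrite initial_law_alive// muE ?Phi_phi'//; exact: phi_ge0'.
Qed.

(** Every [l >= 0] equals [phi (Phi l)], so the transform at [l] is the probability of surviving
    beyond time [Phi l], which the exponential law prescribes. *)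
Lemma qsd_laplace_Phi beta (mu : probability T R) : 0 < beta ->
  is_qsd P Z mu -> has_decay_rate P Z mu beta ->
  forall l, 0 <= l -> laplace mu l = (expR (- (beta * Phi Psi l)))%:E.
Proof.
move=> beta0 [mupos _] mudecay l l0; have [Q [QE _]] := exists_initial_law P mupos.
rewrite -[in LHS](phi_Phi' l0) -initial_law_alive// -QE; last first.
  by apply: (measurable_alive csbp); exact: Phi_ge0'.
apply: (exponential_law_alive csbp); last exact: Phi_ge0'.
  exact: beta0.
move=> B mB; rewrite -mudecay// QE//.
rewrite -[X in measurable X]setTI; apply: (measurable_lifetime csbp) => //.
exact: measurable_image_EFin.
Qed.

Lemma decay_cvgy : phi t @[t --> +oo] --> +oo.
Proof.
apply/cvgryPge => A; have [t0 t00 At0] := phi_oo A; near=> t.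
by apply: le_trans At0 (phi_le' t00 _); near: t; apply: nbhs_pinfty_ge; rewrite num_real.
Unshelve. all: by end_near. Qed.

Lemma shifted_decay_cvgy l : 0 <= l -> phi (t + Phi Psi l) @[t --> +oo] --> +oo.
Proof.
move=> l0; apply/cvgryPge => A; have [t0 t00 At0] := phi_oo A; near=> t.
apply: le_trans At0 (phi_le' t00 _); rewrite -[leLHS]addr0.
apply: lerD; last exact: Phi_ge0'.
by near: t; apply: nbhs_pinfty_ge; rewrite num_real.
Unshelve. all: by end_near. Qed.

Lemma decay_increment_cvg L l : Psi v @[v --> +oo] --> L -> 0 <= l ->
  phi (t + Phi Psi l) - phi t @[t --> +oo] --> - L * Phi Psi l.
Proof.
move=> PsiL; rewrite le_eqVlt => /predU1P[<-|l0].
  rewrite Phi0' mulr0; under eq_cvg => t do rewrite addr0 subrr.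
  exact: cvg_cst.
have PsiLc (f : R -> R) : f t @[t --> +oo] --> +oo ->
    - Psi (f t) * Phi Psi l @[t --> +oo] --> - L * Phi Psi l.
  by move=> foo; apply: cvgMr_tmp; apply: cvgN; exact: cvg_comp foo PsiL.
apply: (squeeze_cvgr _ (PsiLc _ decay_cvgy) (PsiLc _ (shifted_decay_cvgy (ltW l0)))).
near=> t.
have t0 : 0 < t by near: t; apply: nbhs_pinfty_gt; rewrite num_real.
by have := phi_inc' t0 l0; rewrite (flowE (ltW t0) l0).
Unshelve. all: by end_near. Qed.

Lemma start_cond_law_cvg L x (m : probability T R) :
  Psi v @[v --> +oo] --> L -> 0 < x -> on_pos m ->
  (forall l, 0 <= l -> laplace m l = (expR (- (x * - L * Phi Psi l)))%:E) ->
  weak_cvg_pos (cond_law (P x%:E) Z) m.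
Proof.
move=> PsiL x0 mpos mE f fc [M fM].
have mD : measurable (`]0%R, +oo[%classic : set T) by exact: measurable_itv.
have mf : measurable_fun (`]0%R, +oo[%classic : set T) f.
  by apply: subspace_continuous_measurable_fun.
have fin (p : probability T R) : (\int[p]_(y in `]0%R, +oo[) (f y)%:E)%E \is a fin_num.
  apply: integrable_fin_num => //; apply: (@integrable_bounded _ _ _ p _ mD _ M) => //.
  by move=> y; rewrite /= in_itv/= andbT; exact: fM.
(* The continuity theorem takes a family of laws on [(0, oo)] over all real [t]; at negative times
   [m] is a harmless filler. *)
have /choice[p pP] : forall t, exists p : probability T R, on_pos p /\
    (0 <= t -> p = cond_law (P x%:E) Z t :> (set T -> \bar R) /\
      forall l, 0 <= l ->
        laplace p l = (expR (- (x * (phi (t + Phi Psi l) - phi t))))%:E).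
  move=> t; have [t0|t0] := leP 0 t; last by exists m; split => // /(lt_le_trans t0); rewrite ltxx.
  by have [p [pE ppos pl]] := start_cond_law x0 t0; exists p.
have ppos t : on_pos (p t) by have [] := pP t.
have lap n : \int[p t]_(y in `]0%R, +oo[) expR (- (y * n%:R)) @[t --> +oo]
    --> \int[m]_(y in `]0%R, +oo[) expR (- (y * n%:R)).
  rewrite [X in _ --> X](_ : _ = expR (- (x * - L * Phi Psi n%:R))); last first.
    exact: (congr1 fine (mE n%:R (ler0n _ _))).
  have : expR (- (x * (phi (t + Phi Psi n%:R) - phi t))) @[t --> +oo]
      --> expR (- (x * - L * Phi Psi n%:R)).
    apply: continuous_cvg; first exact: continuous_expR.
    apply: cvgN; rewrite -mulrA; apply: cvgMl_tmp.
    exact: decay_increment_cvg.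
  apply: cvg_trans; apply: near_eq_cvg; near=> t.
  have t0 : 0 <= t by near: t; apply: nbhs_pinfty_ge; rewrite num_real.
  have [_ /(_ t0)[_ pl]] := pP t.
  exact: (esym (congr1 fine (pl n%:R (ler0n _ _)))).
have := @laplace_weak_cvg _ _ _ _ _ _ ppos mpos lap _ M fc fM.
move=> cvgf; apply: (@cvg_trans _ ((\int[p t]_(y in `]0%R, +oo[) (f y)%:E)%E @[t --> +oo])).
  apply: near_eq_cvg; near=> t.
  have t0 : 0 <= t by near: t; apply: nbhs_pinfty_ge; rewrite num_real.
  by have [_ /(_ t0)[-> _]] := pP t.
rewrite -(fineK (fin m)); apply/fine_cvgP; split; last exact: cvgf.
by apply: nearW => t; exact: fin.
Unshelve. all: by end_near. Qed.

Lemma cond_prob_le_cvg0 a x : (Psi v)%:E @[v --> +oo] --> -oo%E -> 0 < x ->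
  cond_prob (P x%:E) [set w | (Z t w <= a%:E)%E] (alive Z t) @[t --> +oo] --> 0%E.
Proof.
move=> Psioo x0.
pose g t := (expR (a - x * (phi (t + Phi Psi 1) - phi t)))%:E.
have g0 : g t @[t --> +oo] --> 0%E.
  have Phi10 : 0 < Phi Psi 1 by have := @Phi_lt' 0 1; rewrite Phi0'; apply.
  have hoo : x * (phi (t + Phi Psi 1) - phi t) - a @[t --> +oo] --> +oo.
    apply/cvgryPge => A.
    (* Solves [x * (K * Phi 1) - a = A]. Once [Psi (phi t) <= - K], the increment of [phi] over the
       time span [Phi 1] is at least [K * Phi 1]. *)
    pose K := (A + a) / (x * Phi Psi 1).
    have PsiK : \forall t \near +oo, Psi (phi t) <= - K.
      have /cvgeNyPle/(_ (- K)) h := Psioo.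
      have {}h := decay_cvgy h; near=> t.
      by rewrite -lee_fin; near: t; exact: h.
    near=> t.
    have t0 : 0 < t by near: t; apply: nbhs_pinfty_gt; rewrite num_real.
    have /andP[+ _] := phi_inc' t0 (ltr01 : 0 < 1 :> R).
    rewrite (flowE (ltW t0) ltr01) => inc.
    have KE : A = x * (K * Phi Psi 1) - a.
      by rewrite /K; field; rewrite !gt_eqF.
    rewrite KE lerD2r ler_pM2l//; apply: le_trans inc.
    rewrite ler_pM2r// lerNr; near: t; exact: PsiK.
  apply: cvg_EFin; first exact: nearW.
  have := @cvg_comp _ _ _ _ (fun y : R => expR (- y)) _ _ _ hoo (@cvgr_expR R).
  apply: cvg_trans; apply: near_eq_cvg; apply: nearW => t /=; by rewrite opprB.
apply: (@squeeze_cvge _ _ _ _ (cst 0%E) _ g) => //; last exact: cvg_cst.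
near=> t.
have t0 : 0 <= t by near: t; apply: nbhs_pinfty_ge; rewrite num_real.
have [p [pE ppos pl]] := start_cond_law x0 t0.
have -> : cond_prob (P x%:E) [set w | (Z t w <= a%:E)%E] (alive Z t) =
    p `]-oo, a]%classic.
  rewrite pE /cond_law /cond_prob; congr (P x%:E _ / _)%E.
  rewrite (preimage_EFin_alive csbp _ t0); apply/seteqP; split => w [/= h aw].
    split => //; rewrite in_itv/= -lee_fin fineK//.
    have /andP[Z0 Zoo] := (aliveE csbp w t0).1 aw.
    by rewrite ge0_fin_numE// ltW.
  split => //; move: h; rewrite in_itv/= -lee_fin fineK//.
  have /andP[Z0 Zoo] := (aliveE csbp w t0).1 aw.
  by rewrite ge0_fin_numE// ltW.
rewrite measure_ge0/=.
apply: le_trans (laplace_markov a ppos) _.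
by rewrite pl// -EFinM -expRD.
Unshelve. all: by end_near. Qed.

Lemma flow_mechanism_cvg : exists L : \bar R,
  (Psi v)%:E @[v --> +oo] --> L /\ (L < 0)%E.
Proof.
have [L [PsiL L0 _]] := negative_convex_cvg Psi00 convex
  (@flow_negative R Psi u phi Psi00 convex flow u_le phi_cvg phi_oo).
by exists L.
Qed.

End quasi_stationary.

Theorem theorem1p1 (R : realType) (b : branching_triple R) (u : R -> R -> R)
    (d : measure_display) (Omega : measurableType d)
    (P : R.-pker (\bar R) ~> Omega) (Z : R -> Omega -> \bar R) :
  let Psi := branching_mechanism b in
  let Psi_oo := lim ((Psi v)%:E @[v --> +oo%R]) in
  cumulant_flow Psi u ->
  is_csbp u P Z ->
  explodes_as P Z ->
  exists mu : R -> probability (measurableTypeR R) R,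
  [/\ (forall beta : R, 0 < beta ->
        [/\ is_qsd P Z (mu beta) /\ has_decay_rate P Z (mu beta) beta,
            (forall mu' : probability (measurableTypeR R) R,
               is_qsd P Z mu' -> has_decay_rate P Z mu' beta ->
               measure_eq mu' (mu beta)),
            infinitely_divisible (mu beta),
            (forall lambda : R, 0 <= lambda ->
               laplace (mu beta) lambda =
               (expR (- (beta * Phi Psi lambda)))%:E) &
            (forall mu' : probability (measurableTypeR R) R, on_pos mu' ->
               (forall lambda : R, 0 <= lambda ->
                  laplace mu' lambda =
                  (expR (- (beta * Phi Psi lambda)))%:E) ->
               measure_eq mu' (mu beta))]),
      ((Psi v)%:E @[v --> +oo%R] --> Psi_oo) /\ (Psi_oo < 0)%E,
      ((-oo < Psi_oo)%E ->
        forall x : R, 0 < x ->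
        weak_cvg_pos (cond_law (P x%:E) Z)
                     (mu (x * fine (bt_nu b `]0%R, +oo[%classic)))) &
      (Psi_oo = -oo%E ->
        forall a x : R, 0 < a -> 0 < x ->
        cond_prob (P x%:E) [set w | (Z t w <= a%:E)%E] (alive Z t)
          @[t --> +oo] --> 0%E)].
Proof.
move=> Psi Psi_oo flow csbp explosion.
have /choice[mu muP] : forall beta, exists m : probability (measurableTypeR R) R,
    0 < beta -> on_pos m /\
    forall l, 0 <= l -> laplace m l = (expR (- (beta * Phi Psi l)))%:E.
  move=> beta; have [beta0|beta0] := ltP 0 beta.
    have [m mP] := exists_laplace_Phi flow csbp explosion beta0.
    by exists m.
  (* An arbitrary law at parameters [beta <= 0], about which nothing is asserted. *)
  by exists (\d_(0%R : measurableTypeR R)).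
have lap_unique beta (m : probability (measurableTypeR R) R) : 0 < beta ->
    on_pos m ->
    (forall l, 0 <= l -> laplace m l = (expR (- (beta * Phi Psi l)))%:E) ->
    measure_eq m (mu beta).
  move=> beta0 mpos mE; have [mupos muE] := muP _ beta0.
  by apply: laplace_inj => // n; rewrite mE// muE.
have [L [PsiL L0]] := flow_mechanism_cvg flow csbp explosion.
have PsiooE : Psi_oo = L by apply/cvg_lim.
exists mu; split.
- move=> beta beta0; have [mupos muE] := muP _ beta0; split => //.
  + split; first exact: (laplace_Phi_qsd flow csbp explosion mupos muE).
    exact: (laplace_Phi_decay_rate flow csbp explosion beta0 mupos muE).
  + move=> m mqsd mdecay; have mpos := mqsd.1; apply: lap_unique => //.
    exact: (qsd_laplace_Phi flow csbp explosion beta0 mqsd mdecay).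
  + exact: (infinitely_divisible_laplace_Phi flow csbp explosion beta0 mupos muE).
  + by move=> m mpos mE; exact: lap_unique.
- by rewrite PsiooE.
- rewrite PsiooE => Loo x x0.
  have LE : L = (fine L)%:E by rewrite fineK// fin_numE gt_eqF//= lt_eqF// (lt_trans L0)// ltry.
  have PsifL : Psi v @[v --> +oo] --> fine L.
    by move: PsiL; rewrite {1}LE => /fine_cvgP[_].
  (* The index [x * nu (0, oo)] of the limit becomes [x * - fine L], the coefficient of [Phi] in the
     limiting exponent. *)
  rewrite (bt_nu_eq_limit PsifL) /=.
  have xL0 : 0 < x * - fine L.
    by rewrite mulr_gt0// oppr_gt0 -lte_fin -LE.
  have [mupos muE] := muP _ xL0.
  exact: (start_cond_law_cvg flow csbp explosion PsifL x0 mupos muE).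
- rewrite PsiooE => Loo a x a0 x0; rewrite Loo in PsiL.
  exact: (cond_prob_le_cvg0 flow csbp explosion).
Qed.
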